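(* Let $\mathbb G$ be a compact quantum group and $1\leq p\leq \infty$. Consider $\mathbf{E}\subset\mathrm{Irr}(\mathbb G)$ and $$X=\mathrm{span}\left\lbrace u_{ij}^{(\pi)},(u_{ij}^{(\pi)})^*: \pi\in \mathbf{E},1\leq i,j\leq n_\pi \right\rbrace,$$ equipped with the norm $\|\cdot\|_p$. Then for all $a\in \prod_{\pi\in\mathrm{Irr}(\mathbb G)}B(H_{\pi})$, $$\|m_a^R|_X\|_{B(X)}=\|m_{Q^{-1/2}a^*Q^{1/2}}^L|_X\|_{B(X)}.$$
   Context: $\mathbb G$ is a compact quantum group (Woronowicz) with Haar state $h$; $\mathrm{Irr}(\mathbb G)$ is the set of classes of irreducible unitary representations with fixed representatives $u^{(\pi)}=[u^{(\pi)}_{ij}]\in C(\mathbb G)\otimes B(H_\pi)$, $n_\pi=\dim H_\pi$; $\mathrm{Pol}(\mathbb G)$ is the span of the $u^{(\pi)}_{ij}$. $L^\infty(\mathbb G)$ is the von Neumann algebra generated by $\mathrm{Pol}(\mathbb G)$ in the GNS representation of $h$; $L^1(\mathbb G)=L^\infty(\mathbb G)_*$, $L^\infty(\mathbb G)$ is embedded in $L^1(\mathbb G)$ by $x\mapsto h(\cdot\,x)$, and $L^p(\mathbb G)=(L^\infty(\mathbb G),L^1(\mathbb G))_{1/p}$ (complex interpolation) with norm $\|\cdot\|_p$. $Q_\pi\in B(H_\pi)$ is the unique positive invertible operator with $d_\pi:=\mathrm{Tr}(Q_\pi)=\mathrm{Tr}(Q_\pi^{-1})$, $h(u_{ij}^{(\pi)}(u_{lm}^{(\pi)})^*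 )=\delta_{il}(Q_\pi)_{mj}/d_\pi$ and $h((u_{ij}^{(\pi)})^*u_{lm}^{(\pi)})=\delta_{jm}(Q_\pi^{-1})_{li}/d_\pi$; $Q=(Q_\pi)_\pi$, and products such as $Q^{-1/2}a^*Q^{1/2}$ are taken componentwise. For $a=(a_\pi)\in\prod_\pi B(H_\pi)$, the linear maps $m_a^L,m_a^R:\mathrm{Pol}(\mathbb G)\to\mathrm{Pol}(\mathbb G)$ are defined by $(m_a^L\otimes\iota)u^{(\pi)}=(1\otimes a_\pi)u^{(\pi)}$, $(m_a^R\otimes\iota)u^{(\pi)}=u^{(\pi)}(1\otimes a_\pi)$; they map $X$ into $X$. Operator norms are taken with value $+\infty$ when the map is unbounded. *)

(* Defs.v *)
From HB Require Import structures.
From mathcomp Require Import all_boot all_order all_algebra.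
From mathcomp Require Import ring.
From mathcomp Require Import sesquilinear spectral complex.
From mathcomp Require Import all_classical all_reals all_analysis.

Set Implicit Arguments.
Unset Strict Implicit.
Unset Printing Implicit Defensive.

Import Order.TTheory GRing.Theory Num.Theory numFieldNormedType.Exports.

Local Open Scope classical_set_scope.
Local Open Scope complex_scope.
Local Open Scope ring_scope.

(* The library norm of a complex normed space is valued in R[i]. *)
Definition nrm (R : realType) (V : normedModType R[i]) (x : V) : R :=
  complex.Re `|x|.

Section NrmTheory.
Variables (R : realType) (V : normedModType R[i]).
Implicit Types x y : V.

Lemma nrmE x : `|x| = (nrm x)%:C.
Proof. by rewrite /nrm RRe_real// normr_real. Qed.

Lemma nrm_ge0 x : 0 <= nrm x.
Proof. by rewrite -lecR -nrmE; exact: normr_ge0. Qed.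

Lemma nrm0 : nrm (0 : V) = 0.
Proof. by rewrite /nrm normr0. Qed.

Lemma nrmD x y : nrm (x + y) <= nrm x + nrm y.
Proof. by rewrite -lecR rmorphD/= -!nrmE ler_normD. Qed.

Lemma nrmZ (c : R[i]) x : nrm (c *: x) = nrm (c : R[i]^o) * nrm x.
Proof. by apply: (@complexI R); rewrite rmorphM/= -!nrmE normrZ. Qed.

Lemma nrm0_eq0 x : nrm x = 0 -> x = 0.
Proof. by move=> x0; apply/normr0_eq0; rewrite nrmE x0. Qed.

End NrmTheory.

(* Bounded linear maps, normed by the supremum over the unit ball. *)
Definition bounded_linear (R : realType) (X Y : normedModType R[i])
    (T : X -> Y) : Prop :=
  linear T /\ exists M : R, forall x, nrm (T x) <= M * nrm x.

Definition blin_pred (R : realType) (X Y : normedModType R[i]) :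
    {pred X -> Y} := fun T => `[< bounded_linear T >].

Record blin (R : realType) (X Y : normedModType R[i]) := BLin {
  blin_fun :> X -> Y ;
  blin_funP : blin_fun \in @blin_pred R X Y }.

Section BoundedLinear.
Variables (R : realType) (X Y : normedModType R[i]).

Lemma blin_submod_closed : submod_closed (@blin_pred R X Y).
Proof.
split.
  apply/asboolP; split=> [a x y|]; first by rewrite /= scaler0 addr0.
  by exists 0 => x; rewrite mul0r nrm0.
move=> a T S /asboolP[linT [M TM]] /asboolP[linS [N SN]].
apply/asboolP; split=> [b x y|].
  have -> z : (a *: T + S) z = a *: T z + S z by [].
  rewrite linT linS !scalerDr !scalerA (mulrC b a).
  exact: addrACA.
exists (nrm (a : R[i]^o) * M + N) => x.
have -> : (a *: T + S) x = a *: T x + S x by [].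
rewrite (le_trans (nrmD _ _))// mulrDl lerD// nrmZ -mulrA.
by rewrite ler_wpM2l// nrm_ge0.
Qed.

HB.instance Definition _ := [isSub for @blin_fun R X Y].
HB.instance Definition _ := [Choice of blin X Y by <:].
HB.instance Definition _ := GRing.isSubmodClosed.Build _ _
  (@blin_pred R X Y) blin_submod_closed.
HB.instance Definition _ := [SubChoice_isSubLmodule of blin X Y by <:].

Lemma blinP (T : blin X Y) : bounded_linear T.
Proof. by apply/asboolP; exact: blin_funP. Qed.

Lemma blin_ext (T S : blin X Y) : (forall x, T x = S x) -> T = S.
Proof. by move=> TS; apply/val_inj/funext. Qed.

Lemma blin0 (T : blin X Y) : T 0 = 0.
Proof.
have [linT _] := blinP T; have := linT (-1) 0 0; rewrite scaler0 add0r.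
by rewrite scaleN1r addNr.
Qed.

Lemma blinZ (T : blin X Y) a x : T (a *: x) = a *: T x.
Proof.
have [linT _] := blinP T; have := linT a x 0; rewrite addr0 => ->.
by rewrite blin0 addr0.
Qed.

Lemma blinD (T : blin X Y) x y : T (x + y) = T x + T y.
Proof.
by have [linT _] := blinP T; have := linT 1 x y; rewrite !scale1r.
Qed.

Definition opnorm (T : blin X Y) : R :=
  sup [set nrm (T x) | x in [set x : X | nrm x <= 1]].

Lemma opnorm_has_sup (T : blin X Y) :
  has_sup [set nrm (T x) | x in [set x : X | nrm x <= 1]].
Proof.
split; first by exists (nrm (T 0)), 0 => //=; rewrite nrm0.
have [_ [M TM]] := blinP T; exists `|M| => _ [x /= x1 <-].
rewrite (le_trans (TM _))// (le_trans (ler_wpM2r (nrm_ge0 _) (ler_norm M)))//.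
by rewrite ler_piMr.
Qed.

Lemma opnorm_ball (T : blin X Y) x : nrm x <= 1 -> nrm (T x) <= opnorm T.
Proof.
move=> x1; apply: ub_le_sup; first by case: (opnorm_has_sup T).
by exists x.
Qed.

Lemma opnorm_le (T : blin X Y) M :
  (forall x, nrm x <= 1 -> nrm (T x) <= M) -> opnorm T <= M.
Proof.
move=> TM; apply: ge_sup; first by case: (opnorm_has_sup T).
by move=> _ [x x1 <-]; exact: TM.
Qed.

Lemma opnorm_ge0 (T : blin X Y) : 0 <= opnorm T.
Proof.
by rewrite (le_trans (nrm_ge0 (T 0)))// opnorm_ball// nrm0.
Qed.

Lemma opnormD (T S : blin X Y) : opnorm (T + S) <= opnorm T + opnorm S.
Proof.
apply: opnorm_le => x x1.
have -> : (T + S) x = T x + S x by [].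
by rewrite (le_trans (nrmD _ _))// lerD// opnorm_ball.
Qed.

Lemma opnormZ_le a (T : blin X Y) :
  opnorm (a *: T) <= nrm (a : R[i]^o) * opnorm T.
Proof.
apply: opnorm_le => x x1.
have -> : (a *: T) x = a *: T x by [].
by rewrite nrmZ ler_wpM2l ?nrm_ge0// opnorm_ball.
Qed.

Lemma opnorm0_eq0 (T : blin X Y) : opnorm T = 0 -> T = 0.
Proof.
move=> T0; apply/blin_ext => x; have -> : (0 : blin X Y) x = 0 by [].
have [->|x0] := eqVneq x 0; first by rewrite blin0.
have nx : nrm x != 0 by apply: contra_neq x0 => /nrm0_eq0.
have : nrm (T ((nrm x)^-1%:C *: x)) <= 0.
  rewrite -T0 opnorm_ball// nrmZ {1}/nrm normc_def/= expr0n/= addr0.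
  by rewrite sqrtr_sqr ger0_norm ?invr_ge0 ?nrm_ge0// mulVf.
rewrite blinZ nrmZ => le0.
have : nrm ((nrm x)^-1%:C : R[i]^o) * nrm (T x) = 0.
  by apply/eqP; rewrite eq_le le0/= mulr_ge0 ?nrm_ge0.
move=> /eqP; rewrite mulf_eq0 => /orP[/eqP/nrm0_eq0/complexI/eqP|/eqP/nrm0_eq0//].
by rewrite invr_eq0 (negbTE nx).
Qed.

Lemma opnormZ a (T : blin X Y) :
  opnorm (a *: T) = nrm (a : R[i]^o) * opnorm T.
Proof.
apply/eqP; rewrite eq_le opnormZ_le/=.
have [->|a0] := eqVneq a 0; first by rewrite scale0r nrm0 mul0r opnorm_ge0.
have na0 : nrm (a : R[i]^o) != 0 by apply: contra_neq a0 => /nrm0_eq0.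
have nVa : nrm (a^-1 : R[i]^o) = (nrm (a : R[i]^o))^-1.
  apply: (mulfI na0); rewrite mulfV//; apply: (@complexI R).
  by rewrite rmorphM/= -!nrmE normfV mulfV// normr_eq0.
rewrite -{1}(scale1r T) -(mulVf a0) -scalerA.
rewrite (le_trans (ler_wpM2l (nrm_ge0 _) (opnormZ_le _ _)))//.
by rewrite mulrA nVa mulfV// mul1r.
Qed.

Lemma blin_ler_normD (T S : blin X Y) :
  (opnorm (T + S))%:C <= (opnorm T)%:C + (opnorm S)%:C.
Proof. by rewrite -rmorphD lecR opnormD. Qed.

Lemma blin_normrZ a (T : blin X Y) :
  (opnorm (a *: T))%:C = `|a| * (opnorm T)%:C.
Proof. by rewrite opnormZ rmorphM/= -nrmE. Qed.

Lemma blin_normr0_eq0 (T : blin X Y) : (opnorm T)%:C = 0 -> T = 0.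
Proof. by move=> /complexI /opnorm0_eq0. Qed.

HB.instance Definition _ := Lmodule_isNormed.Build R[i] (blin X Y)
  blin_ler_normD blin_normrZ blin_normr0_eq0.

End BoundedLinear.

(* The inner product is linear in the first variable. *)
HB.mixin Record isHilbert (R : realType) (H : Type)
    of CompleteNormedModule R[i] H := {
  dot : H -> H -> R[i] ;
  dotDl : forall x y z, dot (x + y) z = dot x z + dot y z ;
  dotZl : forall (c : R[i]) x z, dot (c *: x) z = c * dot x z ;
  dotC : forall x y, dot y x = Num.conj (dot x y) ;
  norm_dot : forall x : H, `|x| ^+ 2 = dot x x
}.

#[short(type="hilbertType")]
HB.structure Definition Hilbert (R : realType) :=
  {H of isHilbert R H & CompleteNormedModule R[i] H}.

Definition commutant (R : realType) (H : hilbertType R) (S : set (blin H H)) :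
    set (blin H H) :=
  [set T | forall s, S s -> forall x, T (s x) = s (T x)].

Definition commutant_pred (R : realType) (H : hilbertType R)
    (S : set (blin H H)) : {pred blin H H} := fun T => `[< commutant S T >].

(* S' as a normed space for the operator norm of B(H). *)
Record commutant_type (R : realType) (H : hilbertType R)
    (S : set (blin H H)) := CommutantType {
  commutant_val :> blin H H ;
  commutant_valP : commutant_val \in commutant_pred S }.

Section Commutant.
Variables (R : realType) (H : hilbertType R) (S : set (blin H H)).

Lemma commutant_submod_closed : submod_closed (commutant_pred S).
Proof.
split; first by apply/asboolP => s _ x; rewrite (blin0 s).
move=> a T U /asboolP cT /asboolP cU; apply/asboolP => s Ss x.
have E z : (a *: T + U) z = a *: T z + U z by [].
by rewrite !E cT// cU// blinD blinZ.
Qed.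

HB.instance Definition _ := [isSub for @commutant_val R H S].
HB.instance Definition _ := [Choice of commutant_type S by <:].
HB.instance Definition _ := GRing.isSubmodClosed.Build _ _
  (commutant_pred S) commutant_submod_closed.
HB.instance Definition _ := [SubChoice_isSubLmodule of commutant_type S by <:].

Lemma commutant_ler_normD (T U : commutant_type S) :
  `|val (T + U)| <= `|val T| + `|val U|.
Proof. exact: ler_normD. Qed.

Lemma commutant_normrZ (a : R[i]) (T : commutant_type S) :
  `|val (a *: T)| = `|a| * `|val T|.
Proof. exact: normrZ. Qed.

Lemma commutant_normr0_eq0 (T : commutant_type S) : `|val T| = 0 -> T = 0.
Proof. by move=> /normr0_eq0 T0; apply/val_inj. Qed.

HB.instance Definition _ := Lmodule_isNormed.Build R[i] (commutant_type S)
  commutant_ler_normD commutant_normrZ commutant_normr0_eq0.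

End Commutant.

(* Sigma-weakly continuous functionals on the von Neumann algebra S'. *)
Definition normal_functional (R : realType) (H : hilbertType R)
    (S : set (blin H H)) (phi : blin (commutant_type S) R[i]^o) : Prop :=
  exists xi eta : nat -> H,
    [/\ cvgn (series (fun n => nrm (xi n) ^+ 2)),
        cvgn (series (fun n => nrm (eta n) ^+ 2)) &
        forall T : commutant_type S,
          series (fun n => dot (T (xi n)) (eta n) : R[i]^o) @ \oo --> phi T].

Definition normal_pred (R : realType) (H : hilbertType R)
    (S : set (blin H H)) : {pred blin (commutant_type S) R[i]^o} :=
  fun phi => `[< normal_functional phi >].

(* The predual of S', with the norm of the dual of S'. *)
Record predual (R : realType) (H : hilbertType R) (S : set (blin H H)) :=
  Predual {
    predual_val :> blin (commutant_type S) R[i]^o ;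
    predual_valP : predual_val \in @normal_pred R H S }.

Section PredualTheory.
Variables (R : realType) (H : hilbertType R) (S : set (blin H H)).

Let interleave (T : Type) (a b : nat -> T) n :=
  if odd n then b n./2 else a n./2.

Lemma series_interleave (K : numFieldType) (V : normedModType K)
    (a b : nat -> V) n :
  series (interleave a b) n = series a (uphalf n) + series b n./2.
Proof.
elim: n => [|n IH]; first by rewrite /series/= !big_geq// addr0.
rewrite seriesSr IH /interleave.
have -> : uphalf n.+1 = n./2.+1 by [].
have -> : n.+1./2 = uphalf n by [].
rewrite uphalf_half; case: (odd n).
  by rewrite add1n [series b _.+1]seriesSr addrA.
by rewrite add0n [series a _.+1]seriesSr addrAC.
Qed.

Lemma cvg_series_interleave (K : numFieldType) (V : normedModType K)
    (a b : nat -> V) la lb :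
  series a @ \oo --> la -> series b @ \oo --> lb ->
  series (interleave a b) @ \oo --> la + lb.
Proof.
move=> ha hb.
have -> : series (interleave a b) =
    (series a \o uphalf) + (series b \o half).
  by apply/funext => n; rewrite series_interleave.
have half_oo : n./2 @[n --> \oo] --> \oo.
  move=> A [N _ NA]; exists N.*2 => // n /= Nn; apply: NA => /=.
  by rewrite -(doubleK N) half_leq.
have uphalf_oo : uphalf n @[n --> \oo] --> \oo.
  move=> A [N _ NA]; exists N.*2 => // n /= Nn; apply: NA => /=.
  by rewrite -(doubleK N) uphalf_half (leq_trans (half_leq Nn))// leq_addl.
by apply: cvgD; [exact: (cvg_comp _ _ uphalf_oo ha)|
                 exact: (cvg_comp _ _ half_oo hb)].
Qed.

Lemma normal_submod_closed : submod_closed (@normal_pred R H S).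
Proof.
split.
  apply/asboolP; exists (fun=> 0), (fun=> 0).
  have c0 : cvgn (series (fun=> nrm (0 : H) ^+ 2)).
    rewrite (_ : series _ = cst 0); first exact: is_cvg_cst.
    by apply/funext => n; rewrite /series/= big1// => i _; rewrite nrm0 expr0n.
  split=> // T; rewrite (_ : series _ = cst 0); first exact: cvg_cst.
  apply/funext => n; rewrite /series/= big1// => i _; rewrite blin0.
  by rewrite -(scale0r (0 : H)) dotZl mul0r.
move=> a phi psi /asboolP[xi [eta [cx ce h]]] /asboolP[xi' [eta' [cx' ce' h']]].
apply/asboolP; exists (interleave (fun n => a *: xi n) xi'), (interleave eta eta').
have E (V : Type) (W : Type) (f : V -> W) u v :
    (fun n => f (interleave u v n)) = interleave (f \o u) (f \o v).
  by apply/funext => n; rewrite /interleave; case: ifP.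
split.
- rewrite (E _ _ (fun x : H => nrm x ^+ 2)); apply/cvg_ex.
  have /cvg_ex[l1 hl1] := cx; have /cvg_ex[l2 hl2] := cx'.
  exists (nrm (a : R[i]^o) ^+ 2 * l1 + l2); apply: cvg_series_interleave => //.
  rewrite (_ : series _ = (fun n => nrm (a : R[i]^o) ^+ 2 *
      series (fun n => nrm (xi n) ^+ 2) n)).
    exact: cvgMr.
  apply/funext => n; rewrite /series/= mulr_sumr; apply: eq_bigr => i _.
  by rewrite nrmZ exprMn.
- rewrite (E _ _ (fun x : H => nrm x ^+ 2)); apply/cvg_ex.
  have /cvg_ex[l1 hl1] := ce; have /cvg_ex[l2 hl2] := ce'.
  by exists (l1 + l2); exact: cvg_series_interleave.
move=> T.
have -> : (fun n => dot (T (interleave (fun n => a *: xi n) xi' n))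
      (interleave eta eta' n) : R[i]^o) =
    interleave (fun n => dot (T (a *: xi n)) (eta n) : R[i]^o)
               (fun n => dot (T (xi' n)) (eta' n)).
  by apply/funext => n; rewrite /interleave; case: ifP.
have -> : (a *: phi + psi) T = a *: phi T + psi T by [].
apply: cvg_series_interleave; last exact: h'.
rewrite (_ : series _ = (fun n => a *:
    series (fun n => dot (T (xi n)) (eta n) : R[i]^o) n)).
  by apply: cvgZr; exact: h.
apply/funext => n; rewrite /series/= scaler_sumr; apply: eq_bigr => i _.
by rewrite blinZ dotZl.
Qed.

HB.instance Definition _ := [isSub for @predual_val R H S].
HB.instance Definition _ := [Choice of predual S by <:].
HB.instance Definition _ := GRing.isSubmodClosed.Build _ _
  (@normal_pred R H S) normal_submod_closed.
HB.instance Definition _ := [SubChoice_isSubLmodule of predual S by <:].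

Lemma predual_ler_normD (phi psi : predual S) :
  `|val (phi + psi)| <= `|val phi| + `|val psi|.
Proof. exact: ler_normD. Qed.

Lemma predual_normrZ (a : R[i]) (phi : predual S) :
  `|val (a *: phi)| = `|a| * `|val phi|.
Proof. exact: normrZ. Qed.

Lemma predual_normr0_eq0 (phi : predual S) : `|val phi| = 0 -> phi = 0.
Proof. by move=> /normr0_eq0 phi0; apply/val_inj. Qed.

HB.instance Definition _ := Lmodule_isNormed.Build R[i] (predual S)
  predual_ler_normD predual_normrZ predual_normr0_eq0.

End PredualTheory.

Section VectorFunctional.
Variables (R : realType) (H : hilbertType R) (S : set (blin H H)).
Implicit Types x y z : H.

Lemma dotDr x y z : dot x (y + z) = dot x y + dot x z.
Proof. by rewrite dotC dotDl rmorphD/= -!dotC. Qed.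

Lemma dotZr c x y : dot x (c *: y) = Num.conj c * dot x y.
Proof. by rewrite dotC dotZl rmorphM/= -dotC. Qed.

Lemma cauchy_schwarz x y : `|dot x y| <= `|x| * `|y|.
Proof.
have [->|y0] := eqVneq y 0.
  by rewrite -(scale0r (0 : H)) dotZr conjC0 mul0r scale0r !normr0 mulr0.
have yy : 0 < dot y y by rewrite -norm_dot exprn_gt0// normr_gt0.
have cyy : Num.conj (dot y y) = dot y y by rewrite -dotC.
rewrite -(@ler_pXn2r _ 2)// ?nnegrE ?mulr_ge0// exprMn !norm_dot.
have := exprn_ge0 2 (normr_ge0 (dot y y *: x + - dot x y *: y)).
rewrite norm_dot !(dotDl, dotDr, dotZl, dotZr) cyy rmorphN/=.
rewrite (dotC x y) normCK => h.
by rewrite -subr_ge0 -(pmulr_rge0 _ yy); move: h; congr (0 <= _); ring.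
Qed.

Definition vec_functional_fun (xi eta : H) (T : commutant_type S) : R[i]^o :=
  dot (T xi) eta.

Lemma vec_functional_bounded xi eta :
  vec_functional_fun xi eta \in @blin_pred R (commutant_type S) R[i]^o.
Proof.
apply/asboolP; split=> [a T U|].
  rewrite /vec_functional_fun.
  have -> : (a *: T + U : commutant_type S) xi = a *: T xi + U xi by [].
  by rewrite dotDl dotZl.
have [->|xi0] := eqVneq xi 0.
  exists 0 => T; rewrite mul0r /vec_functional_fun blin0.
  by rewrite -(scale0r (0 : H)) dotZl mul0r nrm0.
have nxi : 0 < nrm xi.
  rewrite lt_neqAle nrm_ge0 andbT eq_sym.
  by apply: contra_neq xi0 => /nrm0_eq0.
exists (nrm xi * nrm eta) => T.
have TE : nrm (T xi) <= nrm T * nrm xi.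
  rewrite -ler_pdivrMr// mulrC.
  have V1 : nrm ((nrm xi)^-1%:C : R[i]^o) = (nrm xi)^-1.
    apply: (@complexI R); rewrite -nrmE ger0_norm//.
    by rewrite (_ : 0 = 0%:C)// lecR invr_ge0 nrm_ge0.
  have -> : nrm T = opnorm (val T) by [].
  rewrite -V1 -nrmZ -blinZ; apply: opnorm_ball.
  by rewrite nrmZ V1 mulVf// gt_eqF.
have := cauchy_schwarz (T xi) eta; rewrite !nrmE -rmorphM/= => h.
have : nrm (vec_functional_fun xi eta T) <= nrm (T xi) * nrm eta.
  by rewrite -lecR -nrmE.
move=> /le_trans; apply; rewrite mulrAC (mulrC (nrm xi)).
by rewrite ler_wpM2r ?nrm_ge0// (le_trans TE)// mulrC.
Qed.

Lemma vec_functional_normal xi eta :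
  BLin (vec_functional_bounded xi eta) \in @normal_pred R H S.
Proof.
apply/asboolP.
exists (fun n => if n is 0 then xi else 0), (fun n => if n is 0 then eta else 0).
have single (K : numFieldType) (V : normedModType K) (f : nat -> V) :
    (forall n, f n.+1 = 0) -> series f @ \oo --> f 0.
  move=> f0; apply: cvg_near_cst; exists 1%N => // -[//|n] _ /=.
  by rewrite /series/= big_nat_recl//= big1 ?addr0.
split=> [||T].
- by apply/cvg_ex; eexists; apply: single => n; rewrite nrm0 expr0n.
- by apply/cvg_ex; eexists; apply: single => n; rewrite nrm0 expr0n.
apply: (single _ _ (fun n => dot (T (if n is 0 then xi else 0))
  (if n is 0 then eta else 0) : R[i]^o)) => n /=.
by rewrite blin0 -(scale0r (0 : H)) dotZl mul0r.
Qed.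

(* The functional T |-> <T xi, eta>. *)
Definition vec_functional (xi eta : H) : predual S :=
  Predual (vec_functional_normal xi eta).

End VectorFunctional.

Definition lin_span (K : pzRingType) (V : lmodType K) (S : set V) : set V :=
  [set v | exists n (c : 'I_n -> K) (s : 'I_n -> V),
     (forall i, S (s i)) /\ v = \sum_(i < n) c i *: s i].

Definition strip (R : realType) : set R[i]^o :=
  [set z | 0 <= complex.Re z <= 1].

(* Calderon's functions for a couple X0 -> X1 given by a continuous injection
   j.  Since j is continuous, the norm of X0 + X1 is equivalent to that of X1,
   so continuity and analyticity may be tested in X1; g is the boundary value
   of f on the imaginary axis, seen in X0. *)
Record calderon (R : realType) (X0 X1 : normedModType R[i]) (j : X0 -> X1)
    (f : R[i]^o -> X1) (g : R -> X0) : Prop := {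
  calderon_continuous : {within @strip R, continuous f} ;
  calderon_bounded : exists M : R, forall z, strip z -> nrm (f z) <= M ;
  calderon_analytic : forall z : R[i]^o, 0 < complex.Re z < 1 -> derivable f z 1 ;
  calderon_left : forall t, f (0 +i* t) = j (g t) ;
  calderon_left_continuous : continuous g ;
  calderon_left_pinfty : g t @[t --> +oo] --> 0 ;
  calderon_left_ninfty : g t @[t --> -oo] --> 0 ;
  calderon_right_pinfty : f (1 +i* t) @[t --> +oo] --> 0 ;
  calderon_right_ninfty : f (1 +i* t) @[t --> -oo] --> 0 }.

Definition calderon_norm (R : realType) (X0 X1 : normedModType R[i])
    (f : R[i]^o -> X1) (g : R -> X0) : \bar R :=
  Order.max (ereal_sup (range (fun t => (nrm (g t))%:E)))
            (ereal_sup (range (fun t => (nrm (f (1 +i* t)))%:E))).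

(* The norm of (X0, X1)_theta, equal to +oo outside of this space. *)
Definition interpolation_norm (R : realType) (X0 X1 : normedModType R[i])
    (j : X0 -> X1) (theta : R) (x : X1) : \bar R :=
  ereal_inf [set e | exists (f : R[i]^o -> X1) (g : R -> X0),
    [/\ calderon j f g, f theta%:C = x & e = calderon_norm f g]].

(* Unital C*-algebras.  The norm is a separate real-valued field because the
   library hierarchy admits no structure joining algebras with normed modules. *)
HB.mixin Record isCstar (R : realType) A of GRing.Algebra R[i] A := {
  star : A -> A ;
  cnorm : A -> R ;
  cnormD : forall x y, cnorm (x + y) <= cnorm x + cnorm y ;
  cnormZ : forall (c : R[i]) x, cnorm (c *: x) = nrm (c : R[i]^o) * cnorm x ;
  cnorm0_eq0 : forall x, cnorm x = 0 -> x = 0 ;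
  cnormM : forall x y, cnorm (x * y) <= cnorm x * cnorm y ;
  cnorm_complete : forall u : nat -> A,
    (forall e : R, 0 < e -> exists N, forall m n, (N <= m)%N -> (N <= n)%N ->
       cnorm (u m - u n) < e) ->
    exists l : A, (fun n => cnorm (u n - l)) @ \oo --> (0 : R) ;
  starD : forall x y, star (x + y) = star x + star y ;
  starZ : forall (c : R[i]) x, star (c *: x) = Num.conj c *: star x ;
  starM : forall x y, star (x * y) = star y * star x ;
  starK : forall x, star (star x) = x ;
  cnorm_starM : forall x, cnorm (star x * x) = cnorm x ^+ 2
}.

#[short(type="cstarType")]
HB.structure Definition Cstar (R : realType) :=
  {A of isCstar R A & GRing.Algebra R[i] A}.

Definition cdense (R : realType) (A : cstarType R) (D : set A) : Prop :=
  forall (x : A) (e : R), 0 < e -> exists2 y, D y & cnorm (x - y) < e.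

Definition cbounded (R : realType) (A B : cstarType R) (f : A -> B) : Prop :=
  exists M : R, forall x, cnorm (f x) <= M * cnorm x.

Definition star_rep (R : realType) (A : cstarType R) (H : hilbertType R)
    (rho : A -> blin H H) : Prop :=
  [/\ linear rho,
      forall x, rho 1 x = x,
      forall a b x, rho (a * b) x = rho a (rho b x) &
      forall a x y, dot (rho (star a) x) y = dot x (rho a y)].

Definition hilbert_tensor (R : realType) (H1 H2 H : hilbertType R)
    (t : H1 -> H2 -> H) : Prop :=
  [/\ forall x, linear (t x),
      forall y, linear (t^~ y),
      forall x y x' y', dot (t x y) (t x' y') = dot x x' * dot y y' &
      closure (lin_span [set v | exists x y, v = t x y]) = setT].

(* T is the minimal tensor product of A and B: it is the completion of the
   algebraic tensor product, represented faithfully on H1 (x) H2 for some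
   faithful representations of A on H1 and of B on H2. *)
Definition min_tensor (R : realType) (A B T : cstarType R)
    (t : A -> B -> T) : Prop :=
  [/\ (forall a, linear (t a)) /\ (forall b, linear (t^~ b)),
      t 1 1 = 1 /\ (forall a b a' b', t a b * t a' b' = t (a * a') (b * b')),
      forall a b, star (t a b) = t (star a) (star b),
      cdense (lin_span [set z | exists a b, z = t a b]) &
      exists (H1 H2 H : hilbertType R) (s : H1 -> H2 -> H)
             (rho1 : A -> blin H1 H1) (rho2 : B -> blin H2 H2)
             (rho : T -> blin H H),
        [/\ hilbert_tensor s,
            star_rep rho1 /\ injective rho1,
            star_rep rho2 /\ injective rho2,
            star_rep rho /\ injective rho &
            forall a b x y, rho (t a b) (s x y) = s (rho1 a x) (rho2 b y)]].

(* (D (x) id) D = (id (x) D) D, where al is the identification of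
   (A (x) A) (x) A with A (x) (A (x) A). *)
Definition coassociative (R : realType) (A AA : cstarType R)
    (t : A -> A -> AA) (D : A -> AA) : Prop :=
  exists (L M : cstarType R) (tl : AA -> A -> L) (tr : A -> AA -> M)
         (Did : {linear AA -> L}) (idD : {linear AA -> M})
         (al : {linear L -> M}),
    [/\ min_tensor tl /\ min_tensor tr,
        [/\ cbounded Did, cbounded idD & cbounded al],
        forall x y, Did (t x y) = tl (D x) y /\ idD (t x y) = tr x (D y),
        forall x y z, al (tl (t x y) z) = tr x (t y z) &
        forall x, al (Did (D x)) = idD (D x)].

Record compact_quantum_group (R : realType) := CompactQuantumGroup {
  CG :> cstarType R ;
  CG2 : cstarType R ;
  tens : CG -> CG -> CG2 ;
  tensP : min_tensor tens ;
  comul : {lrmorphism CG -> CG2} ;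
  comul_star : forall x, comul (star x) = star (comul x) ;
  comul_coassociative : coassociative tens comul ;
  cancellation_l :
    cdense (lin_span [set z | exists x y, z = tens x 1 * comul y]) ;
  cancellation_r :
    cdense (lin_span [set z | exists x y, z = tens 1 x * comul y]) }.

Section CompactQuantumGroups.
Variables (R : realType) (G : compact_quantum_group R).
Local Notation C := R[i].

(* The maps s are the slice maps h (x) id and id (x) h on C(G) (x) C(G). *)
Record haar_state (h : {scalar G}) : Prop := {
  haar1 : h 1 = 1 ;
  haar_ge0 : forall x, 0 <= h (star x * x) ;
  haar_left : exists s : {linear CG2 G -> G},
    [/\ cbounded s, forall x y, s (tens x y) = h x *: y &
        forall x, s (comul G x) = h x *: 1] ;
  haar_right : exists s : {linear CG2 G -> G},
    [/\ cbounded s, forall x y, s (tens x y) = h y *: x &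
        forall x, s (comul G x) = h x *: 1] }.

Definition scalar_mx_of m n (T : 'M[C]_(m, n)) : 'M[G]_(m, n) :=
  map_mx (in_alg G) T.

Definition unitary_rep n (v : 'M[G]_n) : Prop :=
  [/\ v *m (map_mx star v)^T = 1%:M,
      (map_mx star v)^T *m v = 1%:M &
      forall i j, comul G (v i j) = \sum_k tens (v i k) (v k j)].

Definition intertwiner m n (v : 'M[G]_m) (w : 'M[G]_n) (T : 'M[C]_(m, n)) :
    Prop :=
  v *m scalar_mx_of T = scalar_mx_of T *m w.

Definition irreducible_rep n (v : 'M[G]_n) : Prop :=
  [/\ (0 < n)%N, unitary_rep v &
      forall T : 'M[C]_n, intertwiner v v T -> is_scalar_mx T].

Definition equivalent_rep m n (v : 'M[G]_m) (w : 'M[G]_n) : Prop :=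
  exists T : 'M[C]_(m, n),
    [/\ T *m (T ^t*)%sesqui = 1%:M, (T ^t*)%sesqui *m T = 1%:M &
        intertwiner v w T].

(* Irr(G) together with a choice of representatives. *)
Record irr_family := IrrFamily {
  Irr :> Type ;
  irr_dim : Irr -> nat ;
  irr : forall pi : Irr, 'M[G]_(irr_dim pi) ;
  irrP : forall pi, irreducible_rep (irr pi) ;
  irr_inj : forall pi pi', equivalent_rep (irr pi) (irr pi') -> pi = pi' ;
  irr_surj : forall n (v : 'M[G]_n), irreducible_rep v ->
    exists pi, equivalent_rep v (irr pi) }.

Section Irreducibles.
Variable I : irr_family.

Definition Pol : set G :=
  lin_span [set x | exists (pi : I) i j, x = irr pi i j].

Definition coeff_span (E : set I) : set G :=
  lin_span [set x | exists (pi : I) i j,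
    E pi /\ (x = irr pi i j \/ x = star (irr pi i j))].

Definition posdefmx n (A : 'M[C]_n) : Prop :=
  A \is hermsymmx /\
  forall v : 'cV[C]_n, v != 0 -> 0 < ((v ^t*)%sesqui *m A *m v) 0 0.

Definition sqrtmx n (A : 'M[C]_n) : 'M[C]_n :=
  invmx (spectralmx A) *m diag_mx (map_mx sqrtC (spectral_diag A))
    *m spectralmx A.

Definition modular_matrices (h : {scalar G})
    (Q : forall pi : I, 'M[C]_(irr_dim pi)) : Prop :=
  forall pi : I,
    [/\ posdefmx (Q pi),
        \tr (Q pi) = \tr (invmx (Q pi)),
        forall i j l m, h (irr pi i j * star (irr pi l m)) =
          (i == l)%:R * Q pi m j / \tr (Q pi) &
        forall i j l m, h (star (irr pi i j) * irr pi l m) =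
          (j == m)%:R * invmx (Q pi) l i / \tr (Q pi)].

Definition linear_on_Pol (m : G -> G) : Prop :=
  forall (c : C) x y, Pol x -> Pol y -> m (c *: x + y) = c *: m x + m y.

(* m restricts to m_a^L on Pol(G); its values outside of Pol(G) are
   irrelevant. *)
Definition left_mult (a : forall pi : I, 'M[C]_(irr_dim pi)) (m : G -> G) :
    Prop :=
  linear_on_Pol m /\
  forall pi : I, map_mx m (irr pi) = scalar_mx_of (a pi) *m irr pi.

Definition right_mult (a : forall pi : I, 'M[C]_(irr_dim pi)) (m : G -> G) :
    Prop :=
  linear_on_Pol m /\
  forall pi : I, map_mx m (irr pi) = irr pi *m scalar_mx_of (a pi).

End Irreducibles.

Record gns_triple (h : {scalar G}) := GnsTriple {
  gns_space : hilbertType R ;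
  gns_rep : G -> blin gns_space gns_space ;
  gns_vec : gns_space ;
  gns_repP : star_rep gns_rep ;
  gns_stateE : forall x, h x = dot (gns_rep x gns_vec) gns_vec ;
  gns_cyclic : closure (range (fun x => gns_rep x gns_vec)) = setT }.

Section Lp.
Variables (I : irr_family) (h : {scalar G}) (L2 : gns_triple h).

Definition Pol_commutant : set (blin (gns_space L2) (gns_space L2)) :=
  commutant [set gns_rep L2 x | x in Pol I].

(* The bicommutant of the image of Pol(G). *)
Definition Linf := commutant_type Pol_commutant.

Definition L1 := predual Pol_commutant.

(* The embedding x |-> h( . x), where h denotes the vector state extending the
   Haar state to Linf. *)
Definition Linf_to_L1 (x : Linf) : L1 :=
  vec_functional Pol_commutant (x (gns_vec L2)) (gns_vec L2).

Definition Pol_to_L1 (x : G) : L1 :=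
  vec_functional Pol_commutant (gns_rep L2 x (gns_vec L2)) (gns_vec L2).

(* p ranges over [1, +oo] and 1 / +oo = 0. *)
Definition Lp_norm (p : \bar R) (x : G) : \bar R :=
  interpolation_norm Linf_to_L1 (fine (p^-1)%E) (Pol_to_L1 x).

Definition Lp_opnorm (p : \bar R) (X : set G) (m : G -> G) : \bar R :=
  ereal_sup [set Lp_norm p (m x) | x in [set x | X x /\ (Lp_norm p x <= 1)%E]].

End Lp.

End CompactQuantumGroups.

(* Main.v *)
(** In an orthonormal basis of eigenvectors of [Q pi], with eigenvalues [q_i],
    let [e_ij] be the matrix coefficients of [pi] and put
    [theta (e_ij) = sqrt (q_j / q_i) e_ji], extended antilinearly to [Pol].  Then
    [theta m_a^R = m^L_(Q^(-1/2) a^* Q^(1/2)) theta], and [theta] is an involution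
    that maps [X] onto itself, so it suffices to show that [theta] is isometric
    for every [||.||_p].

    Let [kappa] be the antilinear map [e_ij |-> e_ji].  Every unitary
    representation [v] is a direct sum of irreducible ones, hence
    [kappa (v_ij) = v_ji]; applied to tensor products, this makes [kappa]
    multiplicative.  On the eigenspaces of the automorphism
    [x |-> (kappa ((kappa x)^* ))^*], whose eigenvalue at [e_ij] is [q_i / q_j],
    the map [theta] is a multiple of [kappa].  So [theta] is an antilinear
    *-automorphism of [Pol] with [h (theta x)] the conjugate of [h x].

    Since [Pol] is dense in [L^2] (Peter-Weyl), [theta] extends to an antiunitary
    involution [V] of [L^2] with [V x V = theta x].  Then [T |-> V T V] and
    [phi |-> conj (phi (V . V))] are antilinear isometries of [L^infinity] and
    [L^1] compatible with the embedding, and composing Calderon's functions with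
    them and with [z |-> conj z] shows that [theta] preserves the interpolation
    norms.

    For Peter-Weyl, the vectors with all coefficients of the regular
    representation orthogonal to [Pol] form a closed space invariant under
    convolution operators, which are compact.  If it were nonzero, it would
    contain an eigenvector, and the eigenspace of the latter gives a
    finite-dimensional unitary representation, whose coefficients are in [Pol]. *)

Require Import Defs.
From HB Require Import structures.
From mathcomp Require Import all_boot all_order all_algebra.
From mathcomp Require Import ring lra.
From mathcomp Require Import sesquilinear spectral complex.
From mathcomp Require Import all_classical all_reals all_analysis.

Set Implicit Arguments.
Unset Strict Implicit.
Unset Printing Implicit Defensive.

Import Order.TTheory GRing.Theory Num.Theory numFieldNormedType.Exports.

Local Open Scope classical_set_scope.
Local Open Scope complex_scope.
Local Open Scope ring_scope.

(** * Bounded maps on dense subspaces *)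

(** In terms of the antipode S, [kappa] is x |-> S(x)^*, the automorphism that splits [Pol] into
    eigenspaces is S^2, and [theta] is x |-> R(x)^* with R the unitary antipode. None of these maps
    is given: they are defined on matrix coefficients, and their algebraic properties are derived
    from representations alone. An antilinear map is suggested by the embedding x |-> h( . x): the
    involution and R both reverse products and would exchange it with x |-> h(x . ), whereas their
    composite respects the order of products. A second obstacle is that [theta] lives on [Pol] while
    the Hilbert space is the completion of the image of C(G); this is what requires Peter-Weyl.
    There the coefficients of the regular representation are kept in C(G) instead of being
    operators: a Cauchy-Schwarz inequality for slice maps bounds their C*-norm by norms of L^2. The
    C*-algebra theory behind it rests on one iteration for square roots, without spectra. *)

Local Notation ab c := (nrm (c : _[i]^o)).

Section ComplexModulus.
Variable R : realType.
Implicit Types c d : R[i].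

Lemma abE c : (ab c)%:C = `|c|.
Proof. by rewrite -nrmE. Qed.

Lemma abM c d : ab (c * d) = ab c * ab d.
Proof. by apply: (@complexI R); rewrite rmorphM/= !abE normrM. Qed.

Lemma abJ c : ab (Num.conj c) = ab c.
Proof. by apply: (@complexI R); rewrite !abE norm_conjC. Qed.

Lemma abN1 : ab (-1 : R[i]) = 1.
Proof. by apply: (@complexI R); rewrite abE normrN1. Qed.

Lemma ab_real (x : R) : ab x%:C = `|x|.
Proof.
by apply: (@complexI R); rewrite abE normc_def/= expr0n/= addr0 sqrtr_sqr.
Qed.

Lemma absq c : (ab c ^+ 2)%:C = c * Num.conj c.
Proof. by rewrite rmorphXn/= abE normCK. Qed.

Lemma Re_le_ab c : complex.Re c <= ab c.
Proof.
rewrite -lecR abE; case: c => x y; rewrite normc_def lecR/=.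
rewrite (le_trans (ler_norm _))// -sqrtr_sqr ler_wsqrtr// lerDl sqr_ge0.
by [].
Qed.

End ComplexModulus.

(** One predicate for [nrm] on normed spaces and [cnorm] on C*-algebras, so that the same density
    and extension arguments serve both. *)
Record is_norm (R : realType) (V : lmodType R[i]) (N : V -> R) : Prop := {
  norm_tri : forall x y, N (x + y) <= N x + N y ;
  norm_scale : forall (c : R[i]) x, N (c *: x) = ab c * N x ;
  norm_eq0 : forall x, N x = 0 -> x = 0 }.

Definition seq_complete (R : realType) (V : lmodType R[i]) (N : V -> R) :=
  forall u : nat -> V,
    (forall e : R, 0 < e -> exists k, forall m n, (k <= m)%N -> (k <= n)%N ->
       N (u m - u n) < e) ->
    exists l, forall e : R, 0 < e -> exists k, forall n, (k <= n)%N ->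
       N (u n - l) < e.

Section NormTheory.
Variables (R : realType) (V : lmodType R[i]) (N : V -> R).
Hypothesis hN : is_norm N.

Lemma norm0 : N 0 = 0.
Proof. by rewrite -(scale0r 0) (norm_scale hN) nrm0 mul0r. Qed.

Lemma normN x : N (- x) = N x.
Proof. by rewrite -scaleN1r (norm_scale hN) abN1 mul1r. Qed.

Lemma normB x y : N (x - y) = N (y - x).
Proof. by rewrite -opprB normN. Qed.

Lemma norm_ge0 x : 0 <= N x.
Proof.
have := norm_tri hN x (- x); rewrite subrr norm0 normN -mulr2n.
by rewrite pmulrn_lge0.
Qed.

Lemma norm_tri3 y x z : N (x - z) <= N (x - y) + N (y - z).
Proof. by rewrite (le_trans _ (norm_tri hN _ _))// addrA subrK. Qed.

Lemma norm_small x : (forall e, 0 < e -> N x <= e) -> x = 0.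
Proof.
move=> h; apply: (norm_eq0 hN); apply/eqP; rewrite eq_le norm_ge0 andbT.
by apply/ler_addgt0Pl => e e0; rewrite addr0 h.
Qed.

Lemma norm_eq x y : (forall e, 0 < e -> N (x - y) <= e) -> x = y.
Proof. by move=> h; apply/eqP; rewrite -subr_eq0; apply/eqP/norm_small. Qed.

End NormTheory.

Lemma nrm_is_norm (R : realType) (V : normedModType R[i]) : is_norm (@nrm R V).
Proof. by split; [exact: nrmD|exact: nrmZ|exact: nrm0_eq0]. Qed.

Lemma lin_spanD (K : pzRingType) (V : lmodType K) (S : set V) c x y :
  lin_span S x -> lin_span S y -> lin_span S (c *: x + y).
Proof.
move=> [n [a [s [Ss ->]]]] [m [b [t [St ->]]]].
exists (n + m)%N, (fun i : 'I_(n + m) => match fintype.split i with inl j => c * a j | inr j => b j end),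
  (fun i : 'I_(n + m) => match fintype.split i with inl j => s j | inr j => t j end).
split.
  by move=> i; case: (fintype.split i).
rewrite big_split_ord/= scaler_sumr; congr (_ + _).
  apply: eq_bigr => i _; have := @unsplitK n m (inl i); rewrite /= => ->.
  by rewrite scalerA.
apply: eq_bigr => i _; have := @unsplitK n m (inr i); rewrite /= => ->.
by [].
Qed.

Lemma lin_span_in (K : pzRingType) (V : lmodType K) (S : set V) x :
  S x -> lin_span S x.
Proof.
move=> Sx; exists 1%N, (fun=> 1), (fun=> x); split => //.
by rewrite big_ord1 scale1r.
Qed.

Lemma lin_span0 (K : pzRingType) (V : lmodType K) (S : set V) : lin_span S 0.
Proof.
exists 0%N, (fun=> 0), (fun=> 0); split; first by case.
by rewrite big_ord0.
Qed.

Lemma lin_span_ind (K : pzRingType) (V : lmodType K) (S P : set V) :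
  P 0 -> (forall c x y, S x -> P y -> P (c *: x + y)) ->
  forall x, lin_span S x -> P x.
Proof.
move=> P0 PD _ [n [c [s [Ss ->]]]].
elim: n c s Ss => [|n IH] c s Ss; first by rewrite big_ord0.
by rewrite big_ord_recl; apply: PD => //; apply: IH => i; exact: Ss.
Qed.

Definition norm_dense (R : realType) (V : lmodType R[i]) (N : V -> R)
    (D : set V) : Prop :=
  forall x (e : R), 0 < e -> exists2 y, D y & N (x - y) < e.

Lemma invS_lt (R : realType) (e : R) :
  0 < e -> exists k, forall n, (k <= n)%N -> n.+1%:R^-1 < e.
Proof.
move=> e0; have [k kP] := ltr_add_invr e0; rewrite add0r in kP.
exists k => n kn; rewrite (le_lt_trans _ kP)//.
by rewrite lef_pV2 ?posrE// ler_nat.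
Qed.

Section DenseExtension.
Variables (R : realType) (X B : lmodType R[i]) (NX : X -> R) (NB : B -> R).
Hypotheses (hX : is_norm NX) (hB : is_norm NB).
Variables (tau : R[i] -> R[i]) (M : R).
Hypotheses (M0 : 0 <= M).

Lemma dense_eq0 (f : X -> B) (S : set X) :
  (forall c x y, f (c *: x + y) = tau c *: f x + f y) ->
  (forall x, NB (f x) <= M * NX x) ->
  norm_dense NX (lin_span S) ->
  (forall x, S x -> f x = 0) -> forall x, f x = 0.
Proof.
move=> flin fM dS fS x.
have f0 : f 0 = 0.
  apply: (norm_eq0 hB); apply/eqP; rewrite eq_le norm_ge0// andbT.
  by rewrite (le_trans (fM _))// norm0// mulr0.
apply: (norm_small hB) => e e0.
have [y Sy xy] := dS x (e / (M + 1)) ltac:(by rewrite divr_gt0// ltr_wpDl).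
have fy : f y = 0.
  apply: (lin_span_ind (P := fun z => f z = 0) _ _ Sy) => // c z w Sz fw.
  by rewrite flin fS// fw scaler0 addr0.
have -> : f x = f (x - y).
  have := flin 1 (x - y) y; rewrite scale1r subrK fy addr0 => ->.
  have := flin 1 (x - y) 0; rewrite scale1r !addr0 f0 addr0 => h.
  by rewrite -h.
rewrite (le_trans (fM _))// (le_trans (ler_wpM2l M0 (ltW xy)))//.
rewrite mulrA ler_pdivrMr ?ltr_wpDl// mulrC ler_wpM2l ?(ltW e0)//.
by rewrite lerDl.
Qed.

Hypothesis hBc : seq_complete NB.
Hypotheses (tauN : forall c, ab (tau c) = ab c) (tauN1 : tau (-1) = -1).
Variable gr : X -> B -> Prop.
Hypotheses (gr0 : gr 0 0)
  (grD : forall c x b x' b', gr x b -> gr x' b' ->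
     gr (c *: x + x') (tau c *: b + b'))
  (grM : forall x b, gr x b -> NB b <= M * NX x)
  (grd : norm_dense NX [set x | exists b, gr x b]).

Let grB x b x' b' : gr x b -> gr x' b' -> gr (x - x') (b - b').
Proof.
move=> h h'; have := grD (-1) h' h; rewrite tauN1 !scaleN1r.
by rewrite addrC (addrC (- b')).
Qed.

(** The value [l] at [x] is characterized by its distance to every point of the graph at once. This
    makes it independent of the approximating sequence, and linearity and the bound follow without
    further limits. *)
Let limex x : exists l, forall x' b, gr x' b -> NB (b - l) <= M * NX (x' - x).
Proof.
have n0 n : (0 : R) < n.+1%:R^-1 by rewrite invr_gt0.
have /choice[u uP] : forall n : nat, exists p : X * B,
    gr p.1 p.2 /\ NX (x - p.1) < n.+1%:R^-1.
  by move=> n; have [y [b yb] xy] := grd x (n0 n); exists (y, b).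
have [|l lP] := hBc (u := fun n => (u n).2).
  move=> e e0.
  (* Two points within e / (2 (M + 1)) of [x] have images within e M / (M + 1) < e; the [+ 1] covers
     M = 0. *)
  have Me : 0 < e / (2 * (M + 1)) by rewrite divr_gt0// mulr_gt0// ltr_wpDl.
  have [k kP] := invS_lt Me.
  exists k => m n km kn; have [um xm] := uP m; have [un xn] := uP n.
  rewrite (le_lt_trans (grM (grB um un)))//.
  have : NX ((u m).1 - (u n).1) <= 2 * (e / (2 * (M + 1))).
    rewrite (le_trans (norm_tri3 hX x _ _))// mulr_natl mulr2n lerD//.
      by rewrite normB// ltW// (lt_trans xm)// kP.
    by rewrite ltW// (lt_trans xn)// kP.
  move=> /(ler_wpM2l M0) /le_lt_trans; apply.
  have -> : M * (2 * (e / (2 * (M + 1)))) = e * (M / (M + 1)).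
    by field; rewrite gt_eqF// ltr_wpDl.
  rewrite -[ltRHS]mulr1 ltr_pM2l// ltr_pdivrMr ?ltr_wpDl// mul1r.
  by rewrite ltrDl.
exists l => x' b h; apply/ler_addgt0Pr => e e0.
have e2 : 0 < e / 2 by rewrite divr_gt0.
have [k kP] := lP _ e2.
have Me : 0 < e / (2 * (M + 1)) by rewrite divr_gt0// mulr_gt0// ltr_wpDl.
have [k' k'P] := invS_lt Me.
pose n := maxn k k'; have [un xn] := uP n.
have b1 := kP n (leq_maxl _ _).
have b2 : NX (x - (u n).1) <= e / (2 * (M + 1)).
  by rewrite ltW// (lt_trans xn)// k'P// leq_maxr.
rewrite (le_trans (norm_tri3 hB (u n).2 _ _))//.
have h1 := grM (grB h un).
have h2 := ler_wpM2l M0 (norm_tri3 hX x x' (u n).1).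
have h3 := ler_wpM2l M0 b2.
have h4 : M * (e / (2 * (M + 1))) <= e / 2.
  have -> : M * (e / (2 * (M + 1))) = (e / 2) * (M / (M + 1)).
    by field; rewrite gt_eqF// ltr_wpDl.
  by rewrite ler_piMr ?(ltW e2)// ler_pdivrMr ?ltr_wpDl// mul1r lerDl.
rewrite mulrDr in h2; lra.
Qed.

(** The map is given by its graph [gr]. The bound [grM], applied to differences, makes [gr]
    single-valued, so a map prescribed on generators needs no separate proof that it is well
    defined. *)
Lemma dense_ext : exists f : X -> B,
  [/\ forall x b, gr x b -> f x = b,
      forall c x y, f (c *: x + y) = tau c *: f x + f y &
      forall x, NB (f x) <= M * NX x].
Proof.
have /choice[f fP] := limex; exists f; split.
- move=> x b h; apply: (norm_eq hB) => e e0.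
  by rewrite normB// (le_trans (fP _ _ _ h))// subrr norm0// mulr0 ltW.
- move=> c x y; apply: (norm_eq hB) => e e0.
  pose K := 2 * M * (ab c + 1) + 1.
  have c0 : 0 <= ab c by exact: nrm_ge0.
  have K0 : 0 < K by rewrite /K ltr_wpDl// !mulr_ge0// addr_ge0.
  have [x' [b xb] xx] := grd x (divr_gt0 e0 K0).
  have [y' [b' yb] yy] := grd y (divr_gt0 e0 K0).
  rewrite (le_trans (norm_tri3 hB (tau c *: b + b') _ _))//.
  have h1 := fP (c *: x + y) _ _ (grD c xb yb).
  have h2 : NX (c *: x' + y' - (c *: x + y)) <= (ab c + 1) * (e / K).
    have -> : c *: x' + y' - (c *: x + y) = c *: (x' - x) + (y' - y).
      by rewrite scalerBr opprD addrACA.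
    rewrite (le_trans (norm_tri hX _ _))// (norm_scale hX) mulrDl mul1r.
    by rewrite lerD ?ler_wpM2l// normB// ltW.
  have h3 : NB (tau c *: b + b' - (tau c *: f x + f y)) <= M * ((ab c + 1) * (e / K)).
    have -> : tau c *: b + b' - (tau c *: f x + f y) =
        tau c *: (b - f x) + (b' - f y).
      by rewrite scalerBr opprD addrACA.
    rewrite (le_trans (norm_tri hB _ _))// (norm_scale hB) tauN.
    rewrite mulrDl mul1r mulrDr lerD//.
      rewrite mulrCA ler_wpM2l// (le_trans (fP _ _ _ xb))// ler_wpM2l//.
      by rewrite normB// ltW.
    by rewrite (le_trans (fP _ _ _ yb))// ler_wpM2l// normB// ltW.
  rewrite normB// in h1.
  have h4 := ler_wpM2l M0 h2.
  have -> : e = K * (e / K) by field; rewrite gt_eqF.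
  have E : M * ((ab c + 1) * (e / K)) + M * ((ab c + 1) * (e / K)) <= K * (e / K).
    have -> : M * ((ab c + 1) * (e / K)) + M * ((ab c + 1) * (e / K)) =
      (2 * M * (ab c + 1)) * (e / K) by ring.
    by rewrite ler_wpM2r ?(ltW (divr_gt0 e0 K0))// /K lerDl.
  rewrite (le_trans _ E)// lerD//.
  by rewrite (le_trans h1).
- move=> x.
  have := fP x 0 0 gr0; rewrite !sub0r !normN//.
Qed.

End DenseExtension.

(** * Hilbert spaces *)

Section Hilbert.
Variables (R : realType) (H : hilbertType R).
Implicit Types (x y z : H) (c : R[i]).

Lemma dot0l x : dot (0 : H) x = 0.
Proof. by rewrite -(scale0r (0 : H)) dotZl mul0r. Qed.

Lemma dot0r x : dot x (0 : H) = 0.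
Proof. by rewrite dotC dot0l conjC0. Qed.

Lemma dotNl x y : dot (- x) y = - dot x y.
Proof. by rewrite -scaleN1r dotZl mulN1r. Qed.

Lemma dotNr x y : dot x (- y) = - dot x y.
Proof. by rewrite dotC dotNl rmorphN/= -dotC. Qed.

Lemma dotBl x y z : dot (x - y) z = dot x z - dot y z.
Proof. by rewrite dotDl dotNl. Qed.

Lemma dotBr x y z : dot x (y - z) = dot x y - dot x z.
Proof. by rewrite dotDr dotNr. Qed.

Lemma dot_sumr (I : Type) (r : seq I) (P : pred I) (F : I -> H) x :
  dot x (\sum_(i <- r | P i) F i) = \sum_(i <- r | P i) dot x (F i).
Proof. by elim/big_rec2 : _ => [|i _ y _ <-]; rewrite ?dot0r ?dotDr. Qed.

Lemma dot_suml (I : Type) (r : seq I) (P : pred I) (F : I -> H) x :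
  dot (\sum_(i <- r | P i) F i) x = \sum_(i <- r | P i) dot (F i) x.
Proof. by elim/big_rec2 : _ => [|i _ y _ <-]; rewrite ?dot0l ?dotDl. Qed.

Lemma dotxx x : dot x x = (nrm x ^+ 2)%:C.
Proof. by rewrite -norm_dot nrmE rmorphXn. Qed.

Lemma dotxx_eq0 x : dot x x = 0 -> x = 0.
Proof.
rewrite dotxx => /complexI/eqP; rewrite sqrf_eq0 => /eqP; exact: nrm0_eq0.
Qed.

Lemma dotxx_ge0 x : 0 <= dot x x.
Proof. by rewrite dotxx (_ : 0 = 0%:C)// lecR sqr_ge0. Qed.

Lemma ab_dot x y : ab (dot x y) <= nrm x * nrm y.
Proof. by rewrite -lecR abE rmorphM/= -!nrmE cauchy_schwarz. Qed.

Lemma dot_extl x y : (forall z, dot x z = dot y z) -> x = y.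
Proof.
move=> h; apply/eqP; rewrite -subr_eq0; apply/eqP/dotxx_eq0.
by rewrite dotBl h subrr.
Qed.

Lemma dot_extr x y : (forall z, dot z x = dot z y) -> x = y.
Proof. by move=> h; apply: dot_extl => z; rewrite dotC h -dotC. Qed.

Lemma dot0_norm_dense (D : set H) x :
  norm_dense (@nrm R H) D -> (forall y, D y -> dot x y = 0) -> x = 0.
Proof.
move=> dD h; apply: (norm_small (nrm_is_norm H)) => e e0.
have [->|x0] := eqVneq x 0; first by rewrite nrm0 ltW.
have nx : 0 < nrm x.
  by rewrite lt_neqAle nrm_ge0 andbT eq_sym; apply: contra_neq x0 => /nrm0_eq0.
have [y Dy xy] := dD x e e0.
rewrite -(ler_pM2l nx) -expr2 (le_trans _ (ler_wpM2l (ltW nx) (ltW xy)))//.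
rewrite (le_trans _ (ab_dot _ _))// dotBr (h _ Dy) subr0 dotxx ab_real.
by rewrite ger0_norm ?sqr_ge0.
Qed.

Lemma parallelogram x y :
  nrm (x + y) ^+ 2 + nrm (x - y) ^+ 2 = 2 * nrm x ^+ 2 + 2 * nrm y ^+ 2.
Proof.
have : dot (x + y) (x + y) + dot (x - y) (x - y) = 2 * dot x x + 2 * dot y y.
  by rewrite !(dotDl, dotDr, dotBl, dotBr, dotNl, dotNr); ring.
rewrite !dotxx.
have -> : 2 = 2%:C :> R[i] by rewrite rmorph_nat.
by rewrite -!rmorphM -!rmorphD => /complexI.
Qed.

Lemma nrmB2 x y :
  nrm (x - y) ^+ 2 = nrm x ^+ 2 - 2 * complex.Re (dot x y) + nrm y ^+ 2.
Proof.
have : dot (x - y) (x - y) = dot x x - (dot x y + Num.conj (dot x y)) + dot y y.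
  by rewrite -dotC !(dotDl, dotDr, dotBl, dotBr, dotNl, dotNr); ring.
rewrite !dotxx; case: (dot x y) => a b /(congr1 (@complex.Re R)) /= ->.
by rewrite mulr_natl mulr2n.
Qed.

Lemma hilbert_complete : seq_complete (@nrm R H).
Proof.
move=> u uc.
have : cvg (u @ \oo).
  apply: cauchy_cvg; apply/cauchy_ballP => -[e ei] e0.
  have ei0 : ei = 0 by move: e0; rewrite ltcE/= => /andP[/eqP].
  subst ei; rewrite ltcR in e0.
  have [k kP] := uc e e0; exists (u @` [set n | (k <= n)%N], u @` [set n | (k <= n)%N]).
    by split; exists k => // n kn; exists n.
  move=> -[_ _] [/= [m km <-] [n kn <-]].
  by rewrite -ball_normE/= nrmE ltcR kP.
move=> /cvg_ex[l ul]; exists l => e e0.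
have e0' : (0 : R[i]) < e%:C by rewrite ltcR.
have /cvgrPdist_lt/(_ _ e0') [k _ kP] := ul.
exists k => n kn; have := kP n kn.
by rewrite /= distrC nrmE ltcR.
Qed.

(** * Orthogonal projection, Riesz representation, adjoints *)

Section Projection.
Variable M : set H.
Hypotheses (M0 : M 0) (MD : forall c x y, M x -> M y -> M (c *: x + y)).

(** A minimizing sequence in [M] is Cauchy by the parallelogram law. As [M] is any subspace, closed
    or not, its limit is only placed in the closure of [M]. *)
Lemma projection x : exists m,
  (forall e : R, 0 < e -> exists2 y, M y & nrm (m - y) < e) /\
  (forall y, M y -> dot (x - m) y = 0).
Proof.
pose D := [set nrm (x - y) | y in M].
have Dlb : lbound D 0 by move=> _ [y _ <-]; exact: nrm_ge0.
have hD : has_inf D by split; [exists (nrm (x - 0)), 0|exists 0].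
pose d := inf D.
have d0 : 0 <= d by apply: lb_le_inf => //; case: hD.
have dP y : M y -> d <= nrm (x - y).
  by move=> My; apply: ge_inf; [case: hD|exists y].
have /choice[u uP] : forall n : nat, exists y, M y /\ nrm (x - y) < d + n.+1%:R^-1.
  move=> n; have n0 : (0 : R) < n.+1%:R^-1 by rewrite invr_gt0.
  by have [_ [y My <-] yd] := inf_adherent n0 hD; exists y.
have mid y z : M y -> M z -> M (2^-1 *: (y + z)).
  move=> My Mz; rewrite -[X in M X]addr0; apply: MD => //.
  by rewrite -[y]scale1r; exact: MD.
have par y z (e : R) : M y -> M z -> 0 <= e -> nrm (x - y) <= d + e -> nrm (x - z) <= d + e ->
    nrm (y - z) ^+ 2 <= 4 * (2 * d * e + e ^+ 2).
  move=> My Mz e0 hy hz.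
  have := parallelogram (x - y) (x - z).
  have -> : x - y - (x - z) = - (y - z) by rewrite !opprB addrC addrA subrK.
  rewrite (normN (nrm_is_norm H)).
  have -> : x - y + (x - z) = 2 *: (x - 2^-1 *: (y + z)).
    rewrite scalerBr scalerA mulfV ?pnatr_eq0// scale1r.
    by rewrite scaler_nat mulr2n opprD addrACA.
  rewrite nrmZ exprMn.
  have -> : ab (2 : R[i]) = 2.
    by rewrite (_ : 2 = 2%:C) ?ab_real ?ger0_norm// rmorph_nat.
  move=> E.
  have h1 : nrm (x - y) ^+ 2 <= (d + e) ^+ 2.
    by rewrite ler_sqr ?nnegrE ?nrm_ge0// addr_ge0.
  have h2 : nrm (x - z) ^+ 2 <= (d + e) ^+ 2.
    by rewrite ler_sqr ?nnegrE ?nrm_ge0// addr_ge0.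
  have h3 : d ^+ 2 <= nrm (x - 2^-1 *: (y + z)) ^+ 2.
    by rewrite ler_sqr ?nnegrE ?nrm_ge0//; apply: dP; exact: mid.
  nra.
have [|m mP] := hilbert_complete (u := u).
  move=> e e0.
  (* By [par] the squared distance is at most 4 (2 d f + f^2) <= 4 f (2 d + 1), because f <= 1; the
     denominator makes this smaller than e^2. *)
  pose f := Num.min 1 (e ^+ 2 / (8 * (2 * d + 1) + 8)).
  have K0 : 0 < 8 * (2 * d + 1) + 8 by rewrite ltr_wpDl// mulr_ge0// addr_ge0// mulr_ge0.
  have f0 : 0 < f by rewrite lt_min ltr01/= divr_gt0// exprn_gt0.
  have f1 : f <= 1 by rewrite ge_min lexx.
  have fe : f * (8 * (2 * d + 1) + 8) <= e ^+ 2.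
    by rewrite -ler_pdivlMr// ge_min lexx orbT.
  have [k kP] := invS_lt f0.
  exists k => i j ki kj; have [Mi ui] := uP i; have [Mj uj] := uP j.
  have hi : nrm (x - u i) <= d + f by rewrite (le_trans (ltW ui))// lerD2l ltW// kP.
  have hj : nrm (x - u j) <= d + f by rewrite (le_trans (ltW uj))// lerD2l ltW// kP.
  have := par _ _ f Mi Mj (ltW f0) hi hj.
  rewrite -(@ltr_pXn2r _ 2)// ?nnegrE ?nrm_ge0 ?(ltW e0)// => /le_lt_trans; apply.
  nra.
have dm y : M y -> d <= nrm (x - m - y).
  move=> My; apply/ler_addgt0Pr => e e0.
  have [k kP] := mP e e0; have [Mu _] := uP k.
  have := dP (u k + y); rewrite -[u k]scale1r => /(_ (MD _ Mu My)).
  rewrite scale1r => /le_trans; apply.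
  have -> : x - (u k + y) = (x - m - y) + (m - u k).
    by rewrite opprD -!addrA; congr (_ + _); rewrite (addrC (- y)) addrA addKr.
  rewrite (le_trans (nrmD _ _))// lerD2l (normB (nrm_is_norm H)) ltW// kP//.
have md : nrm (x - m) <= d.
  apply/ler_addgt0Pr => e e0; have e2 : 0 < e / 2 by rewrite divr_gt0.
  have [k kP] := mP _ e2; have [k' k'P] := invS_lt e2.
  pose n := maxn k k'; have [_ un] := uP n.
  rewrite (le_trans (norm_tri3 (nrm_is_norm H) (u n) _ _))//.
  rewrite (le_trans (lerD (ltW un) (ltW (kP n (leq_maxl _ _)))))// -addrA.
  by rewrite lerD2l [leRHS](splitr e) lerD2r ltW// k'P// leq_maxr.
exists m; split.
  move=> e e0; have [k kP] := mP e e0; exists (u k); first by case: (uP k).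
  by rewrite (normB (nrm_is_norm H)) kP.
move=> y My; have [->|y0] := eqVneq y 0; first by rewrite dot0r.
have ny : 0 < nrm y.
  by rewrite lt_neqAle nrm_ge0 andbT eq_sym; apply: contra_neq y0 => /nrm0_eq0.
(* The best multiple of [y]: moving [m] by [c *: y] lowers the squared distance by |<x - m, y>|^2 /
   |y|^2, which minimality forces to be 0. *)
pose c := dot (x - m) y / (nrm y ^+ 2)%:C.
have My' : M (c *: y) by rewrite -[_ *: _]addr0; exact: MD.
have := dm _ My'; move/(le_trans md).
rewrite -(@ler_pXn2r _ 2)// ?nnegrE ?nrm_ge0// (nrmB2 (x - m)) => h.
have E1 : complex.Re (dot (x - m) (c *: y)) = ab (dot (x - m) y) ^+ 2 / nrm y ^+ 2.
  rewrite dotZr /c rmorphM/= mulrAC (mulrC (Num.conj _)) -absq.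
  have -> : Num.conj ((nrm y ^+ 2)%:C)^-1 = ((nrm y ^+ 2)^-1)%:C :> R[i].
    by rewrite -fmorphV /Num.conj/= oppr0.
  by rewrite -rmorphM.
have E2 : nrm (c *: y) ^+ 2 = ab (dot (x - m) y) ^+ 2 / nrm y ^+ 2.
  rewrite nrmZ /c abM -fmorphV ab_real.
  rewrite (@ger0_norm _ ((nrm y ^+ 2)^-1)) ?invr_ge0 ?sqr_ge0//.
  by field; rewrite gt_eqF.
rewrite E1 E2 in h.
have : ab (dot (x - m) y) ^+ 2 / nrm y ^+ 2 <= 0 by lra.
rewrite pmulr_lle0 ?invr_gt0 ?exprn_gt0// => h0.
have : ab (dot (x - m) y) ^+ 2 = 0 by apply/eqP; rewrite eq_le h0 sqr_ge0.
by move=> /eqP; rewrite sqrf_eq0 => /eqP /nrm0_eq0.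
Qed.

End Projection.

(** The representing vector is a multiple of the component [z] of [x0] orthogonal to the kernel. The
    projection [m] of [x0] is a priori in the closure of the kernel, and boundedness of [f] puts it
    in the kernel. *)
Lemma riesz (f : H -> R[i]) (M : R) :
  (forall c x y, f (c *: x + y) = c * f x + f y) ->
  (forall x, ab (f x) <= M * nrm x) -> exists t, forall x, f x = dot x t.
Proof.
move=> fl fM.
have f0 : f 0 = 0 by have := fl (-1) 0 0; rewrite scaler0 add0r mulN1r addNr.
have [h|/existsNP[x0 fx0]] := pselect (forall x, f x = 0).
  by exists 0 => x; rewrite h dot0r.
have fB x y : f (x - y) = f x - f y.
  by have := fl (-1) y x; rewrite scaleN1r mulN1r (addrC (- y)) (addrC (- f y)).
have [||m [mcl mo]] := @projection [set x | f x = 0] _ _ x0 => //.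
  by move=> c x y /= fx fy; rewrite fl fx fy mulr0 addr0.
have fm : f m = 0.
  apply: (norm_small (nrm_is_norm R[i]^o)) => e e0.
  have M0 : 0 < `|M| + 1 by rewrite ltr_wpDl.
  have [y fy my] := mcl _ (divr_gt0 e0 M0).
  have -> : f m = f (m - y) by rewrite fB fy subr0.
  rewrite (le_trans (fM _))// (@le_trans _ _ ((`|M| + 1) * nrm (m - y)))//.
    rewrite ler_wpM2r ?nrm_ge0// (le_trans (ler_norm _))// lerDl//.
  by rewrite (le_trans (ler_wpM2l (ltW M0) (ltW my)))// mulrCA mulfV ?gt_eqF// mulr1.
pose z := x0 - m.
have fz : f z = f x0 by rewrite /z fB fm subr0.
have zz : dot z z != 0.
  by apply/eqP => /dotxx_eq0 zz; apply: fx0; rewrite -fz zz f0.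
exists (Num.conj (f z) / Num.conj (dot z z) *: z) => x.
have fz0 : f z != 0 by rewrite fz; apply/eqP.
have := mo (x - (f x / f z) *: z); rewrite /= fB.
have -> : f ((f x / f z) *: z) = f x.
  by rewrite -[_ *: z]addr0 fl f0 addr0 mulfVK.
rewrite subrr => /(_ erefl); rewrite -/z dotBr dotZr => /eqP.
rewrite subr_eq0 => /eqP E.
rewrite dotZr rmorphM/= conjCK fmorphV/= conjCK (dotC z x) E rmorphM/= conjCK.
rewrite -(dotC z z) mulrCA -mulrA; field.
by rewrite fz0 zz.
Qed.

Lemma adjoint (L : H -> H) (M : R) :
  (forall c x y, L (c *: x + y) = c *: L x + L y) ->
  (forall x, nrm (L x) <= M * nrm x) ->
  exists L' : H -> H, [/\ forall x y, dot (L x) y = dot x (L' y),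
    forall c x y, L' (c *: x + y) = c *: L' x + L' y &
    forall x, nrm (L' x) <= M * nrm x].
Proof.
move=> Ll LM.
have /choice[L' L'P] : forall y, exists t, forall x, dot (L x) y = dot x t.
  move=> y; apply: (@riesz _ (M * nrm y)) => [c x z|x].
    by rewrite Ll dotDl dotZl.
  rewrite (le_trans (ab_dot _ _))// mulrAC ler_wpM2r ?nrm_ge0//.
exists L'; split => [x y|c x y|x]; first by rewrite L'P.
  apply: dot_extr => z; rewrite -L'P dotDr dotZr dotDr dotZr.
  by rewrite !L'P.
have [->|h] := eqVneq (L' x) 0.
  rewrite nrm0; have [->|x0] := eqVneq x 0; first by rewrite nrm0 mulr0.
  by rewrite (le_trans (nrm_ge0 _) (LM _)).
have n0 : 0 < nrm (L' x).
  by rewrite lt_neqAle nrm_ge0 andbT eq_sym; apply: contra_neq h => /nrm0_eq0.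
rewrite -(ler_pM2l n0) -expr2.
have -> : nrm (L' x) ^+ 2 = ab (dot (L' x) (L' x)).
  by rewrite dotxx ab_real ger0_norm// sqr_ge0.
rewrite -L'P (le_trans (ab_dot _ _))//.
rewrite (le_trans (ler_wpM2r (nrm_ge0 x) (LM _)))//.
by rewrite (mulrC M) mulrA.
Qed.

End Hilbert.

(** * C*-algebras and their representations *)

Lemma conj_real (R : realType) (x : R) : Num.conj (x%:C) = x%:C :> R[i].
Proof. exact: conjc_real. Qed.

Section Cstar.
Variables (R : realType) (A : cstarType R).
Implicit Types (x y u d e a : A) (c : R[i]).
Local Notation N := (@cnorm R A).

Lemma cnorm_is_norm : is_norm N.
Proof. by split; [exact: cnormD|exact: cnormZ|exact: cnorm0_eq0]. Qed.
Let cN := cnorm_is_norm.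

Lemma cnorm_ge0 x : 0 <= N x.
Proof. exact: (norm_ge0 cN). Qed.

Lemma cstar_complete : seq_complete N.
Proof.
move=> u uc; have [l ul] := @cnorm_complete R A u uc; exists l => e e0.
have /cvgrPdist_lt/(_ _ e0) [k _ kP] := ul.
exists k => n kn; have := kP n kn.
by rewrite /= sub0r normrN ger0_norm// cnorm_ge0.
Qed.

Lemma star0 : star (0 : A) = 0.
Proof. by rewrite -{1}(scale0r (0 : A)) starZ conjC0 scale0r. Qed.

Lemma starN x : star (- x) = - star x.
Proof. by rewrite -scaleN1r starZ rmorphN1 scaleN1r. Qed.

Lemma starB x y : star (x - y) = star x - star y.
Proof. by rewrite starD starN. Qed.

Lemma star1 : star (1 : A) = 1.
Proof. by rewrite -[LHS]mulr1 -{2}(starK 1) -starM mulr1 starK. Qed.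

Lemma star_sum (I : Type) (r : seq I) (P : pred I) (F : I -> A) :
  star (\sum_(i <- r | P i) F i) = \sum_(i <- r | P i) star (F i).
Proof. by elim/big_rec2 : _ => [|i _ y _ <-]; rewrite ?star0 ?starD. Qed.

Lemma cnorm_star x : N (star x) = N x.
Proof.
suff h y : N y <= N (star y).
  by apply/eqP; rewrite eq_le h andbT -{2}(starK x) h.
have [->|y0] := eqVneq y 0; first by rewrite (norm0 cN) cnorm_ge0.
have ny : 0 < N y.
  by rewrite lt_neqAle cnorm_ge0 andbT eq_sym; apply: contra_neq y0 => /cnorm0_eq0.
by rewrite -(ler_pM2r ny) -expr2 -cnorm_starM cnormM.
Qed.

Lemma cnorm1 : N 1 = 1.
Proof.
have := cnorm_starM (1 : A); rewrite star1 mulr1 => /eqP.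
rewrite expr2 -{1}(mulr1 (N 1)) -subr_eq0 -mulrBr mulf_eq0 => /orP[/eqP/cnorm0_eq0/eqP|].
  by rewrite oner_eq0.
by rewrite subr_eq0 eq_sym => /eqP.
Qed.

Lemma cnorm_sa2 x : star x = x -> N (x * x) = N x ^+ 2.
Proof. by move=> xs; rewrite -cnorm_starM xs. Qed.

(* [1 - w] is the square root, where [w = lim w_n], [w_{n+1} = (u + w_n^2) / 2];
   the scalar iteration [r] started at [u = 1] dominates the increments. *)
Lemma cstar_sqrt u : star u = u -> N u <= 1 ->
  exists e, [/\ star e = e, e * e = 1 - u, N (1 - e) <= 1 &
    forall x, x * u = u * x -> x * e = e * x].
Proof.
move=> us u1.
pose w := fix w n := if n is n'.+1 then 2^-1 *: (u + w n' * w n') else 0.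
pose r := fix r n : R := if n is n'.+1 then 2^-1 * (1 + r n' * r n') else 0.
have wS n : w n.+1 = 2^-1 *: (u + w n * w n) by [].
have rS n : r n.+1 = 2^-1 * (1 + r n * r n) by [].
have ab2 : ab (2^-1 : R[i]) = 2^-1.
  have -> : 2^-1 = (2^-1)%:C :> R[i] by rewrite fmorphV rmorph_nat.
  by rewrite ab_real ger0_norm.
have rb n : 0 <= r n <= 1.
  elim: n => [|n /andP[r0 r1]]; first by rewrite /= lexx ler01.
  have h1 : 0 <= r n * r n by rewrite mulr_ge0.
  have h2 : r n * r n <= 1 by rewrite mulr_ile1.
  by rewrite rS; apply/andP; split; lra.
have wr n : N (w n) <= r n.
  elim: n => [|n IH]; first by rewrite /= (norm0 cN).
  rewrite wS rS cnormZ ab2 ler_wpM2l// (le_trans (cnormD _ _))// lerD//.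
  by rewrite (le_trans (cnormM _ _))// ler_pM ?cnorm_ge0.
have wc n x : x * u = u * x -> x * w n = w n * x.
  move=> xu; elim: n => [|n IH]; first by rewrite mulr0 mul0r.
  rewrite wS -scalerAr -scalerAl mulrDr mulrDl xu; congr (_ *: (_ + _)).
  by rewrite mulrA IH -mulrA IH mulrA.
have ww m n : w m * w n = w n * w m by apply: (wc n); apply/esym/(wc m).
have ws n : star (w n) = w n.
  elim: n => [|n IH]; first exact: star0.
  rewrite wS starZ starD us starM IH; congr (_ *: _).
  have -> : 2^-1 = (2^-1)%:C :> R[i] by rewrite fmorphV rmorph_nat.
  by rewrite conj_real.
have winc n : N (w n.+1 - w n) <= r n.+1 - r n.
  elim: n => [|n IH].
    by rewrite /= !mul0r !subr0 !addr0 cnormZ ab2 mulr1 ler_piMr.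
  rewrite (wS n.+1) (rS n.+1) {2}(wS n) {2}(rS n) -scalerBr -mulrBr cnormZ ab2.
  rewrite ler_wpM2l//.
  have -> : u + w n.+1 * w n.+1 - (u + w n * w n) = (w n.+1 - w n) * (w n.+1 + w n).
    rewrite mulrDr !mulrBl opprD addrACA subrr add0r (ww n).
    by rewrite addrA subrK.
  have -> : 1 + r n.+1 * r n.+1 - (1 + r n * r n) = (r n.+1 - r n) * (r n.+1 + r n).
    by ring.
  rewrite (le_trans (cnormM _ _))// ler_pM ?cnorm_ge0//.
  by rewrite (le_trans (cnormD _ _))// lerD.
have wrm n m : (n <= m)%N -> N (w m - w n) <= r m - r n.
  move=> nm; rewrite -(subnK nm); elim: (m - n)%N => [|k IH].
    by rewrite add0n !subrr (norm0 cN).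
  rewrite addSn (le_trans (norm_tri3 cN (w (k + n)%N) _ _))//.
  have -> : r (k + n).+1 - r n = (r (k + n).+1 - r (k + n)%N) + (r (k + n)%N - r n).
    by rewrite addrA subrK.
  by rewrite lerD.
have rnd : nondecreasing_seq r.
  move=> n m nm; rewrite -subr_ge0 (le_trans _ (wrm _ _ nm))//.
  exact: cnorm_ge0.
have rc : cvgn r.
  apply: nondecreasing_is_cvgn => //; exists 1 => _ [n _ <-].
  by case/andP: (rb n).
have [|l lP] := cstar_complete (u := w).
  move=> e e0.
  have /cvgrPdist_lt/(_ _ (divr_gt0 e0 (ltr0n R 2))) [k _ kP] := rc.
  have h m n : (k <= n)%N -> (n <= m)%N -> N (w m - w n) < e.
    move=> kn nm; rewrite (le_lt_trans (wrm _ _ nm))//.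
    have := kP n kn; have := kP m (leq_trans kn nm); rewrite /=.
    rewrite !ltr_norml => /andP[a1 a2] /andP[b1 b2].
    by lra.
  exists k => m n km kn; have [nm|mn] := leqP n m; first exact: h.
  by rewrite (normB cN) h// ltnW.
have lim2 (f : A -> A) (K : R) : (forall n, N (f l - f (w n)) <= K * N (l - w n)) ->
    (forall n, f (w n) = 0) -> f l = 0.
  move=> fl fw; apply: (norm_small cN) => e e0.
  have K0 : 0 < `|K| + 1 by rewrite ltr_wpDl.
  have [k kP] := lP _ (divr_gt0 e0 K0).
  have := fl k; rewrite fw subr0 => /le_trans; apply.
  rewrite (@le_trans _ _ ((`|K| + 1) * N (l - w k)))//.
    by rewrite ler_wpM2r ?cnorm_ge0// (le_trans (ler_norm _))// lerDl.
  have := kP k (leqnn k); rewrite (normB cN) => /ltW/(ler_wpM2l (ltW K0)).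
  by rewrite mulrCA mulfV ?gt_eqF// mulr1.
have l1 : N l <= 1.
  apply/ler_addgt0Pr => e e0; have [k kP] := lP e e0.
  have -> : l = w k - (w k - l) by rewrite subKr.
  rewrite (le_trans (cnormD _ _))// lerD//; last first.
    by rewrite (normN cN) ltW// kP.
  by rewrite (le_trans (wr k))//; case/andP: (rb k).
have lc x : x * u = u * x -> x * l = l * x.
  move=> xu; apply/eqP; rewrite -subr_eq0; apply/eqP.
  apply: (lim2 (fun z => x * z - z * x) (2 * N x)) => [n|n]; last by rewrite wc// subrr.
  have -> : x * l - l * x - (x * w n - w n * x) = x * (l - w n) - (l - w n) * x.
    by rewrite mulrBr mulrBl !opprB addrACA [RHS]addrACA; congr (_ + _); rewrite addrC.
  rewrite (le_trans (cnormD _ _))// (normN cN).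
  have -> : 2 * N x * N (l - w n) = N x * N (l - w n) + N (l - w n) * N x by ring.
  by rewrite lerD// cnormM.
have ls : star l = l.
  apply/eqP; rewrite -subr_eq0; apply/eqP.
  apply: (lim2 (fun z => star z - z) 2) => [n|n]; last by rewrite ws subrr.
  have -> : star l - l - (star (w n) - w n) = star (l - w n) - (l - w n).
    by rewrite starB !opprB addrACA [RHS]addrACA; congr (_ + _); rewrite addrC.
  by rewrite (le_trans (cnormD _ _))// (normN cN) cnorm_star mulr_natl mulr2n.
have lu : l + l - l * l = u.
  have h : l = 2^-1 *: (u + l * l).
    apply: (norm_eq cN) => e e0.
    have e3 : 0 < e / 3 by rewrite divr_gt0.
    have [k kP] := lP _ e3.
    have -> : l - 2^-1 *: (u + l * l) =
        (l - w k.+1) + 2^-1 *: (w k * w k - l * l).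
      rewrite wS !scalerDr scalerN !opprD -!addrA; congr (_ + (_ + _)).
      by rewrite addKr.
    have -> : w k * w k - l * l = (w k - l) * w k + l * (w k - l).
      by rewrite mulrBl mulrBr addrA subrK.
    have h1 := kP k.+1 (leqnSn k); have h2 := kP k (leqnn k).
    have h3 : N (w k) <= 1 by rewrite (le_trans (wr k))//; case/andP: (rb k).
    rewrite (le_trans (cnormD _ _))// (normB cN) cnormZ ab2.
    have h4 : N ((w k - l) * w k + l * (w k - l)) <= 2 * (e / 3).
      rewrite (le_trans (cnormD _ _))// mulr_natl mulr2n lerD//.
        rewrite (le_trans (cnormM _ _))// -[leRHS]mulr1 ler_pM ?cnorm_ge0// ltW//.
      rewrite (le_trans (cnormM _ _))// -[leRHS]mul1r ler_pM ?cnorm_ge0// ltW//.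
    lra.
  have -> : l + l = 2%:R *: l by rewrite scaler_nat mulr2n.
  by rewrite {1}h scalerA mulfV ?pnatr_eq0// scale1r addrK.
exists (1 - l); split.
- by rewrite starB star1 ls.
- by rewrite mulrBr mulr1 mulrBl mul1r -lu -addrA -opprD addrA.
- by rewrite subKr.
- by move=> x xu; rewrite mulrBr mulrBl mulr1 mul1r lc.
Qed.

(** Both d + i e and d - i e have norm 1, since their adjoint times themselves is d^2 + e^2 = 1, and
    d is half their sum. *)
Lemma pair_norm d e : star d = d -> star e = e -> d * e = e * d ->
  d * d + e * e = 1 -> N d <= 1.
Proof.
move=> ds es de h1.
have unit1 (s : R[i]) : s * s = -1 -> Num.conj s = - s -> N (d + s *: e) = 1.
  move=> s2 sc; have : N (d + s *: e) ^+ 2 = 1.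
    rewrite -cnorm_starM starD starZ ds es sc.
    rewrite mulrDl !mulrDr -!scalerAl -!scalerAr scalerA mulNr s2 opprK scale1r.
    by rewrite de scaleNr addrA -(addrA (d * d)) subrr addr0 h1 cnorm1.
  move=> /eqP; rewrite sqrf_eq1 => /orP[/eqP//|/eqP h].
  by have := cnorm_ge0 (d + s *: e); rewrite h lerNr oppr0 ler10.
pose j : R[i] := 0 +i* 1.
have j2 : j * j = -1 by rewrite /j; simpc.
have jc : Num.conj j = - j by rewrite /j; simpc.
have h2 := unit1 j j2 jc.
have h3 : N (d + (- j) *: e) = 1.
  by apply: unit1; rewrite ?mulrNN// rmorphN/= jc.
have : N (2 *: d) <= 2.
  have -> : 2 *: d = (d + j *: e) + (d + (- j) *: e).
    by rewrite scaleNr addrACA subrr addr0 scaler_nat mulr2n.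
  by rewrite (le_trans (cnormD _ _))// h2 h3.
rewrite cnormZ.
have -> : ab (2 : R[i]) = 2.
  by rewrite (_ : 2 = 2%:C) ?ab_real ?ger0_norm// rmorph_nat.
by rewrite -[X in _ <= X -> _]mulr1 ler_pM2l.
Qed.

(** For a self-adjoint square root e of 1 - d^2 the pair (e, d) satisfies e^2 + d^2 = 1, so
    [pair_norm] bounds the norm of e by 1. *)
Lemma cnorm_1Bsq d : star d = d -> N d <= 1 -> N (1 - d * d) <= 1.
Proof.
move=> ds d1.
have d2 : N (d * d) <= 1 by rewrite cnorm_sa2// expr_le1// cnorm_ge0.
have d2s : star (d * d) = d * d by rewrite starM ds.
have [e [es ee _ ec]] := cstar_sqrt d2s d2.
have de : d * e = e * d by apply: ec; rewrite mulrA.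
rewrite -ee cnorm_sa2// expr_le1// ?cnorm_ge0//.
by apply: (pair_norm es ds); rewrite // ee subrK.
Qed.

(** * Positivity and norms in representations *)

Section Representation.
Variables (H : hilbertType R) (rho : A -> blin H H).
Hypothesis hr : star_rep rho.

Lemma rep_lin c x y v : rho (c *: x + y) v = c *: rho x v + rho y v.
Proof. by have [-> _ _ _] := hr. Qed.
Lemma rep0 v : rho 0 v = 0.
Proof. by have := rep_lin (-1) 0 0 v; rewrite scaler0 add0r scaleN1r addNr. Qed.
Lemma repD x y v : rho (x + y) v = rho x v + rho y v.
Proof. by have := rep_lin 1 x y v; rewrite !scale1r. Qed.
Lemma repZ c x v : rho (c *: x) v = c *: rho x v.
Proof. by have := rep_lin c x 0 v; rewrite !addr0 rep0 addr0. Qed.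
Lemma repN x v : rho (- x) v = - rho x v.
Proof. by rewrite -scaleN1r repZ scaleN1r. Qed.
Lemma repB x y v : rho (x - y) v = rho x v - rho y v.
Proof. by rewrite repD repN. Qed.
Lemma rep1 v : rho 1 v = v.
Proof. by have [_ -> _ _] := hr. Qed.
Lemma repM x y v : rho (x * y) v = rho x (rho y v).
Proof. by have [_ _ -> _] := hr. Qed.
Lemma rep_star x v w : dot (rho (star x) v) w = dot v (rho x w).
Proof. by have [_ _ _ ->] := hr. Qed.
Lemma rep_star' x v w : dot (rho x v) w = dot v (rho (star x) w).
Proof. by rewrite -rep_star starK. Qed.

(** When b has norm 1, the element 1 - b^* b is the square of a self-adjoint element, hence positive
    in any representation, which says |b v| <= |v|. *)
Lemma rep_le a v : nrm (rho a v) <= N a * nrm v.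
Proof.
have [->|a0] := eqVneq a 0; first by rewrite rep0 nrm0 mulr_ge0 ?cnorm_ge0 ?nrm_ge0.
have na : 0 < N a.
  by rewrite lt_neqAle cnorm_ge0 andbT eq_sym; apply: contra_neq a0 => /cnorm0_eq0.
pose b := ((N a)^-1)%:C *: a.
have nb : N b = 1.
  by rewrite cnormZ ab_real ger0_norm ?invr_ge0 ?(ltW na)// mulVf// gt_eqF.
have -> : a = (N a)%:C *: b.
  by rewrite scalerA -rmorphM mulfV ?gt_eqF// scale1r.
rewrite repZ nrmZ cnormZ nb mulr1 ler_wpM2l ?nrm_ge0//.
have bs : star (star b * b) = star b * b by rewrite starM starK.
have b1 : N (star b * b) <= 1 by rewrite cnorm_starM nb expr1n.
have [e [es ee _ _]] := cstar_sqrt bs b1.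
have : 0 <= dot (rho (1 - star b * b) v) v.
  by rewrite -ee repM rep_star' es dotxx_ge0.
rewrite repB rep1 repM dotBl rep_star subr_ge0 !dotxx lecR ler_sqr ?nnegrE ?nrm_ge0//.
Qed.

Hypothesis ri : injective rho.

Lemma rep_eq0 a : (forall v, rho a v = 0) -> a = 0.
Proof. by move=> h; apply: ri; apply: blin_ext => v; rewrite h rep0. Qed.

(** After scaling to norm at most 1, [g] is the square root of d^2, in other words the modulus of d,
    and [f] is the square root of [g]. Positivity of d in the faithful representation forces d = g.
    Commutation is recorded for the later use of [pair_norm]. *)
Lemma rep_ge0_sqr d : star d = d -> (forall v, 0 <= dot (rho d v) v) ->
  exists e, [/\ star e = e, e * e = d & forall x, x * d = d * x -> x * e = e * x].
Proof.
move=> ds dge.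
have [->|d0] := eqVneq d 0.
  by exists 0; split; rewrite ?star0 ?mulr0// => x _; rewrite mulr0 mul0r.
have nd : 0 < N d.
  by rewrite lt_neqAle cnorm_ge0 andbT eq_sym; apply: contra_neq d0 => /cnorm0_eq0.
wlog d1 : d ds dge d0 nd / N d <= 1.
  move=> h; pose b := ((N d)^-1)%:C *: d.
  have nb : N b = 1.
    by rewrite cnormZ ab_real ger0_norm ?invr_ge0 ?(ltW nd)// mulVf// gt_eqF.
  have bs : star b = b by rewrite starZ ds conj_real.
  have [||||e [es ee ec]] := h b bs.
  - move=> v; rewrite repZ dotZl mulr_ge0//.
    by rewrite (_ : 0 = 0%:C)// lecR invr_ge0 ltW.
  - by apply: contra_neq d0 => b0; apply: cnorm0_eq0; move: nb; rewrite b0 (norm0 cN) => /esym/eqP; rewrite oner_eq0.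
  - by rewrite nb.
  - by rewrite nb.
  have sc : (Num.sqrt (N d))%:C * (Num.sqrt (N d))%:C = (N d)%:C :> R[i].
    by rewrite -rmorphM -expr2 sqr_sqrtr// ltW.
  exists ((Num.sqrt (N d))%:C *: e); split.
  - by rewrite starZ es conj_real.
  - rewrite -scalerAl -scalerAr scalerA sc ee scalerA -rmorphM mulfV ?gt_eqF//.
    by rewrite scale1r.
  - move=> x xd; rewrite -scalerAl -scalerAr ec//.
    by rewrite /b -scalerAl -scalerAr xd.
have u1 := cnorm_1Bsq ds d1.
have us : star (1 - d * d) = 1 - d * d by rewrite starB star1 starM ds.
have [g [gs gg g1 gc]] := cstar_sqrt us u1.
rewrite subKr in gg.
have dg : d * g = g * d by apply: gc; rewrite mulrBr mulrBl mulr1 mul1r mulrA.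
have ugs : star (1 - g) = 1 - g by rewrite starB star1 gs.
have [f [fs ff _ fc]] := cstar_sqrt ugs g1.
rewrite subKr in ff.
suff dgE : d = g.
  exists f; split=> //; first by rewrite ff.
  move=> x xd; apply: fc.
  have xg : x * g = g * x.
    apply: gc; rewrite mulrBr mulrBl mulr1 mul1r mulrA xd -mulrA xd mulrA.
    by [].
  by rewrite mulrBr mulrBl mulr1 mul1r xg.
apply/eqP; rewrite -subr_eq0; apply/eqP/rep_eq0 => v.
(* As (d + g) (d - g) = 0, the nonnegative numbers <d w, w> and <g w, w> add up to 0, so both
   vanish. *)
pose w := rho (d - g) v.
have pw : rho d w + rho g w = 0.
  rewrite -repD -repM (_ : (d + g) * (d - g) = 0) ?rep0//.
  by rewrite mulrDl !mulrBr gg dg addrA subrK subrr.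
have h0 : dot (rho d w) w + dot (rho g w) w = 0 by rewrite -dotDl pw dot0l.
have gge : 0 <= dot (rho g w) w by rewrite -ff repM rep_star' fs dotxx_ge0.
have gw : rho g w = 0.
  have : dot (rho g w) w = 0.
    move: h0 => /eqP; rewrite paddr_eq0// => /andP[_ /eqP//].
  by rewrite -ff !repM rep_star' fs => /dotxx_eq0 ->; rewrite blin0.
have dw : rho d w = 0 by move: pw; rewrite gw addr0.
apply: dotxx_eq0; rewrite rep_star' starB ds gs -/w repB dw gw subrr dot0r.
by [].
Qed.

(** If b = a / M is contractive in the representation, both y = b^* b and 1 - y are positive there,
    hence squares of commuting self-adjoint elements, and [pair_norm] bounds the norm of y by 1. *)
Lemma rep_isometry a M : 0 <= M -> (forall v, nrm (rho a v) <= M * nrm v) -> N a <= M.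
Proof.
rewrite le_eqVlt => /orP[/eqP <- h|M0 h].
  rewrite (rep_eq0 (a := a)) ?(norm0 cN)// => v; apply: nrm0_eq0.
  by apply/eqP; rewrite eq_le nrm_ge0 andbT (le_trans (h v))// mul0r.
pose b := (M^-1)%:C *: a.
have abE' : a = M%:C *: b by rewrite scalerA -rmorphM mulfV ?gt_eqF// scale1r.
have rb v : nrm (rho b v) <= nrm v.
  rewrite repZ nrmZ ab_real ger0_norm ?invr_ge0 ?(ltW M0)//.
  by rewrite mulrC ler_pdivrMr// mulrC.
suff : N b <= 1.
  move=> h1; rewrite abE' (cnormZ M%:C b) ab_real ger0_norm ?(ltW M0)//.
  by rewrite ler_piMr// ltW.
pose y := star b * b.
have ys : star y = y by rewrite starM starK.
have yge v : 0 <= dot (rho y v) v by rewrite repM rep_star dotxx_ge0.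
have [f [fs ff fc]] := rep_ge0_sqr ys yge.
have y1s : star (1 - y) = 1 - y by rewrite starB star1 ys.
have [v|e [es ee ec]] := rep_ge0_sqr y1s.
  rewrite repB rep1 repM dotBl rep_star subr_ge0 !dotxx lecR ler_sqr ?nnegrE ?nrm_ge0//.
have fe : f * e = e * f.
  apply: ec; rewrite mulrBr mulrBl mulr1 mul1r; congr (_ - _).
  by rewrite -ff mulrA.
have f1 : N f <= 1 by apply: (pair_norm fs es fe); rewrite ff ee addrC subrK.
have : N y <= 1 by rewrite -ff cnorm_sa2// expr_le1// cnorm_ge0.
by rewrite cnorm_starM expr_le1// cnorm_ge0.
Qed.

End Representation.

End Cstar.

(** * Slice maps of the minimal tensor product *)

Lemma closure_norm_dense (R : realType) (V : normedModType R[i]) (D : set V) :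
  closure D = setT -> norm_dense (@nrm R V) D.
Proof.
move=> DT x e e0; have : closure D x by rewrite DT.
have e0' : (0 : R[i]) < e%:C by rewrite ltcR.
move=> /(_ _ (nbhsx_ballx x _ e0')) [y [Dy]].
by rewrite -ball_normE/= nrmE ltcR => xy; exists y.
Qed.

Lemma nrm_le_dot (R : realType) (H : hilbertType R) (x : H) (M : R) :
  0 <= M -> (forall y, ab (dot x y) <= M * nrm y) -> nrm x <= M.
Proof.
move=> M0 /(_ x); rewrite dotxx ab_real ger0_norm ?sqr_ge0// expr2.
have [->|x0 h] := eqVneq x 0; first by rewrite nrm0.
rewrite -(ler_pM2r (x := nrm x))// lt_neqAle nrm_ge0 andbT eq_sym.
by apply: contra_neq x0 => /nrm0_eq0.
Qed.

(** Composed with a faithful representation of [B], which is isometric, the homomorphism becomes a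
    representation of [A], which is contractive. *)
Lemma star_hom_le (R : realType) (A B : cstarType R) (H : hilbertType R)
    (rho : B -> blin H H) (f : A -> B) :
  star_rep rho -> injective rho -> linear f -> f 1 = 1 ->
  (forall x y, f (x * y) = f x * f y) -> (forall x, f (star x) = star (f x)) ->
  forall x, cnorm (f x) <= cnorm x.
Proof.
move=> hr ri fl f1 fM fs x; apply: (rep_isometry hr ri); first exact: cnorm_ge0.
have hf : star_rep (rho \o f).
  split=> [c y z|v|y z v|y v w] /=.
  - by apply: blin_ext => v; rewrite fl (rep_lin hr).
  - by rewrite f1 (rep1 hr).
  - by rewrite fM (repM hr).
  - by rewrite fs (rep_star hr).
exact: (rep_le hf).
Qed.

Section MinTensor.
Variables (R : realType).

Lemma min_tensor_flip (A B T : cstarType R) (t : A -> B -> T) :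
  min_tensor t -> min_tensor (fun b a => t a b).
Proof.
move=> [[tl tr] [t1 tM] ts td [H1 [H2 [H [s [rho1 [rho2 [rho]]]]]]]].
move=> [[sl sr sd scl] r1 r2 r rt].
split=> //.
  have -> : [set z | exists b a, z = t a b] = [set z | exists a b, z = t a b] => //.
  by apply/seteqP; split => z [x [y ->]]; exists y, x.
exists H2, H1, H, (fun y x => s x y), rho2, rho1, rho; split=> //.
split=> //; first by move=> x y x' y'; rewrite sd mulrC.
have -> : [set v | exists x y, v = s y x] = [set v | exists x y, v = s x y] => //.
by apply/seteqP; split => z [x [y ->]]; exists y, x.
Qed.

Variables (A B T : cstarType R) (t : A -> B -> T).
Hypothesis ht : min_tensor t.

Lemma tensDr a c b b' : t a (c *: b + b') = c *: t a b + t a b'.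
Proof. by case: ht => -[h _] _ _ _ _; rewrite h. Qed.
Lemma tensDl c a a' b : t (c *: a + a') b = c *: t a b + t a' b.
Proof. by case: ht => -[_ h] _ _ _ _; rewrite (h b). Qed.
Lemma tens0r a : t a 0 = 0.
Proof. by have := tensDr a (-1) 0 0; rewrite scaler0 add0r scaleN1r addNr. Qed.
Lemma tens0l b : t 0 b = 0.
Proof. by have := tensDl (-1) 0 0 b; rewrite scaler0 add0r scaleN1r addNr. Qed.
Lemma tensZl c a b : t (c *: a) b = c *: t a b.
Proof. by have := tensDl c a 0 b; rewrite !addr0 tens0l addr0. Qed.
Lemma tensZr c a b : t a (c *: b) = c *: t a b.
Proof. by have := tensDr a c b 0; rewrite !addr0 tens0r addr0. Qed.
Lemma tensM a b a' b' : t a b * t a' b' = t (a * a') (b * b').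
Proof. by case: ht => _ [_ h] _ _ _; rewrite h. Qed.
Lemma tens11 : t 1 1 = 1.
Proof. by case: ht => _ [h _] _ _ _. Qed.
Lemma tens_star a b : star (t a b) = t (star a) (star b).
Proof. by case: ht => _ _ h _ _; rewrite h. Qed.
Lemma tens_dense : norm_dense (@cnorm R T) (lin_span [set z | exists a b, z = t a b]).
Proof. by case: ht => _ _ _ h _; exact: h. Qed.
Lemma tens_faithful : exists (H : hilbertType R) (rho : T -> blin H H),
  star_rep rho /\ injective rho.
Proof. by case: ht => _ _ _ _ [H1 [H2 [H [s [r1 [r2 [r []]]]]]]]; exists H, r. Qed.

Lemma tens_lel a : cnorm (t a 1) <= cnorm a.
Proof.
have [H [rho [hr ri]]] := tens_faithful.
apply: (star_hom_le hr ri (f := fun a => t a 1)) => [c x y|||].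
- exact: tensDl.
- exact: tens11.
- by move=> x y; rewrite tensM mulr1.
- by move=> x; rewrite tens_star star1.
Qed.

Lemma tens_ler b : cnorm (t 1 b) <= cnorm b.
Proof.
have [H [rho [hr ri]]] := tens_faithful.
apply: (star_hom_le hr ri (f := fun b => t 1 b)) => [c x y|||].
- exact: tensDr.
- exact: tens11.
- by move=> x y; rewrite tensM mulr1.
- by move=> x; rewrite tens_star star1.
Qed.

Lemma tens_le a b : cnorm (t a b) <= cnorm a * cnorm b.
Proof.
have -> : t a b = t a 1 * t 1 b by rewrite tensM mulr1 mul1r.
by rewrite (le_trans (cnormM _ _))// ler_pM ?cnorm_ge0 ?tens_lel ?tens_ler.
Qed.

(** The slice map phi (x) id together with a bound [K]. Slices id (x) phi are obtained by exchanging
    the arguments of [t], which [min_tensor_flip] permits. *)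
Definition is_slice (phi : A -> R[i]) (K : R) (s : T -> B) : Prop :=
  [/\ 0 <= K, forall c x y, s (c *: x + y) = c *: s x + s y,
      forall z, cnorm (s z) <= K * cnorm z &
      forall a b, s (t a b) = phi a *: b].

(** For z in the algebraic tensor product, the matrix coefficient of its slice at v, v' equals
    phi(a'), where a' is the slice of z along the other leg by the vector functional of v, v'.
    Faithful representations being isometric, |a'| <= |z| |v| |v'|, so the bound of phi carries
    over. *)
Lemma slice_exists (phi : A -> R[i]) (K : R) : 0 <= K ->
  (forall c x y, phi (c *: x + y) = c * phi x + phi y) ->
  (forall a, ab (phi a) <= K * cnorm a) -> exists s, is_slice phi K s.
Proof.
move=> K0 phil phiK.
pose S := [set p : T * B | exists a b, p = (t a b, phi a *: b)].
pose gr z b := lin_span S (z, b).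
have phi0 : phi 0 = 0.
  by have := phil (-1) 0 0; rewrite scaler0 add0r mulN1r addNr.
have grM z b : gr z b -> cnorm b <= K * cnorm z.
  have [_ _ _ _ [H1 [H2 [H [s [rho1 [rho2 [rho]]]]]]]] := ht.
  move=> [[sl sr sd scl] [r1 i1] [r2 i2] [r i] rt] g.
  have ns x y : nrm (s x y) = nrm x * nrm y.
    apply/eqP; rewrite -(@eqrXn2 _ 2)// ?mulr_ge0 ?nrm_ge0//; apply/eqP.
    by apply: (@complexI R); rewrite -dotxx sd !dotxx -rmorphM exprMn.
  apply: (rep_isometry r2 i2) => [|v]; first by rewrite mulr_ge0 ?cnorm_ge0.
  apply: nrm_le_dot => [|v']; first by rewrite !mulr_ge0 ?cnorm_ge0 ?nrm_ge0.
  have [a' [ha1 ha2]] : exists a', (forall x x', dot (rho1 a' x) x' =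
      dot (rho z (s x v)) (s x' v')) /\ phi a' = dot (rho2 b v) v'.
    pose P := [set p : T * B | exists a', (forall x x', dot (rho1 a' x) x' =
      dot (rho p.1 (s x v)) (s x' v')) /\ phi a' = dot (rho2 p.2 v) v'].
    apply: (@lin_span_ind _ _ _ P _ _ _ g).
      exists 0; rewrite phi0 (rep0 r2) dot0l; split => // x x'.
      by rewrite (rep0 r1) (rep0 r) !dot0l.
    move=> c [z1 b1] [z2 b2] [a [d [-> ->]]] [a2 [h1 h2]].
    exists ((c * dot (rho2 d v) v') *: a + a2); split=> [x x'|].
      rewrite (rep_lin r1) dotDl dotZl h1 (rep_lin r) dotDl dotZl rt sd.
      by rewrite -mulrA (mulrC (dot (rho2 d v) v')).
    rewrite phil h2 (rep_lin r2) (repZ r2) dotDl !dotZl.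
    by congr (_ + _); rewrite -!mulrA; congr (_ * _); rewrite mulrC.
  rewrite -ha2 (le_trans (phiK _))//.
  have : cnorm a' <= cnorm z * nrm v * nrm v'.
    apply: (rep_isometry r1 i1) => [|x]; first by rewrite !mulr_ge0 ?cnorm_ge0 ?nrm_ge0.
    apply: nrm_le_dot => [|x']; first by rewrite !mulr_ge0 ?cnorm_ge0 ?nrm_ge0.
    rewrite ha1 (le_trans (ab_dot _ _))// ns.
    have := rep_le r z (s x v); rewrite ns => h.
    have n1 : 0 <= nrm x' * nrm v' by rewrite mulr_ge0 ?nrm_ge0.
    rewrite (le_trans (ler_wpM2r n1 h))// le_eqVlt; apply/orP; left; apply/eqP.
    by ring.
  by move=> /(ler_wpM2l K0) /le_trans; apply; rewrite !mulrA.
have [||||||f [f1 f2 f3]] := @dense_ext R T B (@cnorm R T) (@cnorm R B)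
    (cnorm_is_norm _) (cnorm_is_norm _) id K K0 (@cstar_complete R B) _ _ gr.
- by [].
- by [].
- exact: lin_span0.
- by move=> c x b x' b' h h'; exact: (lin_spanD c h h').
- exact: grM.
- move=> x e e0; have [y yS xy] := tens_dense x e0; exists y => //=.
  have := lin_span_ind (P := fun y => exists b, gr y b) _ _ yS; apply.
    by exists 0; exact: lin_span0.
  move=> c z w [a [b ->]] [b' h]; exists (c *: (phi a *: b) + b').
  have hin : gr (t a b) (phi a *: b) by apply: lin_span_in; exists a, b.
  exact: (lin_spanD c hin h).
by exists f; split=> // a b; apply: f1; apply: lin_span_in; exists a, b.
Qed.

Section Slice.
Variables (phi : A -> R[i]) (K : R) (s : T -> B).
Hypothesis hs : is_slice phi K s.

Lemma sliceD c x y : s (c *: x + y) = c *: s x + s y. Proof. by case: hs. Qed.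
Lemma slice0 : s 0 = 0.
Proof. by have := sliceD (-1) 0 0; rewrite scaler0 add0r scaleN1r addNr. Qed.
Lemma slice_le z : cnorm (s z) <= K * cnorm z. Proof. by case: hs. Qed.
Lemma slice_tens a b : s (t a b) = phi a *: b. Proof. by case: hs. Qed.
Lemma slice_K0 : 0 <= K. Proof. by case: hs. Qed.

Lemma sliceMr z b : s (z * t 1 b) = s z * b.
Proof.
apply/eqP; rewrite -subr_eq0; apply/eqP.
apply: (@dense_eq0 R T B (@cnorm R T) (@cnorm R B) (cnorm_is_norm _)
  (cnorm_is_norm _) id (K * cnorm b + K * cnorm b) _ (fun z => s (z * t 1 b) - s z * b) _ _ _ tens_dense).
- by rewrite addr_ge0 // mulr_ge0 ?cnorm_ge0// slice_K0.
- move=> c x y; rewrite mulrDl -scalerAl !sliceD mulrDl -scalerAl scalerBr.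
  by rewrite opprD addrACA.
- move=> x; rewrite (le_trans (norm_tri (cnorm_is_norm _) _ _))//.
  rewrite (normN (cnorm_is_norm _)) mulrDl lerD//.
    rewrite (le_trans (slice_le _))// -mulrA ler_wpM2l ?slice_K0//.
    rewrite (le_trans (cnormM _ _))// mulrC ler_wpM2r ?cnorm_ge0//.
    exact: tens_ler.
  rewrite (le_trans (cnormM _ _))// mulrAC ler_wpM2r ?cnorm_ge0//.
  exact: slice_le.
- by move=> _ [a [d ->]]; rewrite tensM !slice_tens mulr1 scalerAl subrr.
Qed.

Lemma sliceMl z b : s (t 1 b * z) = b * s z.
Proof.
apply/eqP; rewrite -subr_eq0; apply/eqP.
apply: (@dense_eq0 R T B (@cnorm R T) (@cnorm R B) (cnorm_is_norm _)
  (cnorm_is_norm _) id (K * cnorm b + K * cnorm b) _ (fun z => s (t 1 b * z) - b * s z) _ _ _ tens_dense).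
- by rewrite addr_ge0 // mulr_ge0 ?cnorm_ge0// slice_K0.
- move=> c x y; rewrite mulrDr -scalerAr !sliceD mulrDr -scalerAr scalerBr.
  by rewrite opprD addrACA.
- move=> x; rewrite (le_trans (norm_tri (cnorm_is_norm _) _ _))//.
  rewrite (normN (cnorm_is_norm _)) mulrDl lerD//.
    rewrite (le_trans (slice_le _))// -mulrA ler_wpM2l ?slice_K0//.
    rewrite (le_trans (cnormM _ _))// ler_wpM2r ?cnorm_ge0//.
    exact: tens_ler.
  rewrite (le_trans (cnormM _ _))// mulrC mulrAC ler_wpM2r ?cnorm_ge0//.
  exact: slice_le.
- by move=> _ [a [d ->]]; rewrite tensM !slice_tens mul1r scalerAr subrr.
Qed.

Lemma slice_star z : (forall a, phi (star a) = Num.conj (phi a)) ->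
  s (star z) = star (s z).
Proof.
move=> ps; apply/eqP; rewrite -subr_eq0; apply/eqP.
apply: (@dense_eq0 R T B (@cnorm R T) (@cnorm R B) (cnorm_is_norm _)
  (cnorm_is_norm _) Num.conj (K + K) _ (fun z => s (star z) - star (s z)) _ _ _ tens_dense).
- by rewrite addr_ge0 // slice_K0.
- move=> c x y; rewrite starD starZ !sliceD starD starZ scalerBr.
  by rewrite opprD addrACA.
- move=> x; rewrite (le_trans (norm_tri (cnorm_is_norm _) _ _))//.
  rewrite (normN (cnorm_is_norm _)) mulrDl cnorm_star lerD ?slice_le//.
  by rewrite (le_trans (slice_le _))// cnorm_star.
- by move=> _ [a [d ->]]; rewrite tens_star !slice_tens ps starZ subrr.
Qed.

End Slice.

(** Vector functionals suffice: their slices recover the matrix coefficients of X between elementary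
    tensors, and these determine X in the faithful representation. *)
Lemma slice_sep X : (forall phi K s, is_slice phi K s -> s X = 0) -> X = 0.
Proof.
move=> h.
have [_ _ _ _ [H1 [H2 [H [s [rho1 [rho2 [rho]]]]]]]] := ht.
move=> [[sl sr sd scl] [r1 i1] [r2 i2] [r i] rt].
have h0 x w x' w' : dot (rho X (s x w)) (s x' w') = 0.
  have [|||sg hsg] := @slice_exists (fun a => dot (rho1 a x) x') (nrm x * nrm x').
  - by rewrite mulr_ge0 ?nrm_ge0.
  - by move=> c y z; rewrite (rep_lin r1) dotDl dotZl.
  - move=> a; rewrite (le_trans (ab_dot _ _))// mulrAC ler_wpM2r ?nrm_ge0// mulrC.
    exact: (rep_le r1).
  have E : forall Z, (dot (rho Z (s x w)) (s x' w') - dot (rho2 (sg Z) w) w' : R[i]^o) = 0.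
    apply: (@dense_eq0 R T R[i]^o (@cnorm R T) (@nrm R R[i]^o) (cnorm_is_norm _)
      (nrm_is_norm _) id (nrm (s x w) * nrm (s x' w') + nrm x * nrm x' * nrm w * nrm w')
       _ _ _ _ _ tens_dense).
    - by rewrite addr_ge0// ?mulr_ge0 ?nrm_ge0.
    - move=> c y z; rewrite (rep_lin r) (sliceD hsg) (rep_lin r2) !dotDl !dotZl.
      by rewrite scalerBr opprD addrACA.
    - move=> Z; rewrite (le_trans (nrmD _ _))// (normN (nrm_is_norm _)) mulrDl lerD//.
        rewrite (le_trans (ab_dot _ _))// mulrAC ler_wpM2r ?nrm_ge0// mulrC.
        exact: (rep_le r).
      rewrite (le_trans (ab_dot _ _))// mulrAC ler_wpM2r ?nrm_ge0//.
      rewrite (le_trans (rep_le r2 _ _))// mulrAC ler_wpM2r ?nrm_ge0//.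
      exact: (slice_le hsg).
    - move=> _ [a [b ->]]; rewrite (slice_tens hsg) rt sd (repZ r2) dotZl.
      by rewrite subrr.
  have := E X; rewrite (h _ _ _ hsg) (rep0 r2) dot0l subr0.
  by [].
have dS := closure_norm_dense scl.
apply: (rep_eq0 r i).
apply: (@dense_eq0 R H H (@nrm R H) (@nrm R H) (nrm_is_norm _)
      (nrm_is_norm _) id (cnorm X) (cnorm_ge0 _) _ _ _ _ dS).
- by move=> c x y; rewrite blinD blinZ.
- exact: (rep_le r).
move=> _ [x [w ->]].
apply: (dot0_norm_dense dS).
move=> y; apply: (lin_span_ind (P := fun y => dot (rho X (s x w)) y = 0)).
  by rewrite dot0r.
by move=> c _ z [x' [w' ->]] hz; rewrite dotDr dotZr hz h0 mulr0 addr0.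
Qed.

End MinTensor.

Lemma slice_pos (R : realType) (A B T : cstarType R) (t : A -> B -> T)
    (ht : min_tensor t) (h : A -> R[i]) K (s : T -> B) : is_slice t h K s ->
  (forall c x y, h (c *: x + y) = c * h x + h y) ->
  (forall a, ab (h a) <= K * cnorm a) ->
  (forall x, 0 <= h (star x * x)) ->
  exists (H2 : hilbertType R) (rho2 : B -> blin H2 H2),
    [/\ star_rep rho2, injective rho2 &
        forall v Z, 0 <= dot (rho2 (s (star Z * Z)) v) v].
Proof.
move=> hs hl hK hpos.
have [_ _ _ _ [H1 [H2 [H [ss [rho1 [rho2 [rho]]]]]]]] := ht.
move=> [[sl sr sd scl] [r1 i1] [r2 i2] [r i] rt].
exists H2, rho2; split=> // v Z.
have K0 := slice_K0 hs.
have v0 := nrm_ge0 v.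
(* The vector functional of [v] is sliced off first: the resulting element of
   [A] is positive in [rho1], hence a square. *)
have [|||sg hsg] := @slice_exists R B A T _ (min_tensor_flip ht)
    (fun b => dot (rho2 b v) v) (nrm v * nrm v).
- by rewrite mulr_ge0.
- by move=> c y z; rewrite (rep_lin r2) dotDl dotZl.
- move=> b; rewrite (le_trans (ab_dot _ _))// mulrAC ler_wpM2r// mulrC.
  exact: (rep_le r2).
have vv0 : 0 <= nrm v * nrm v by rewrite mulr_ge0.
have E1 x x' : forall W, (dot (rho W (ss x v)) (ss x' v) - dot (rho1 (sg W) x) x' : R[i]^o) = 0.
  apply: (@dense_eq0 R T R[i]^o (@cnorm R T) (@nrm R R[i]^o) (cnorm_is_norm _)
      (nrm_is_norm _) id (nrm (ss x v) * nrm (ss x' v) + nrm v * nrm v * nrm x * nrm x')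
       _ _ _ _ _ (tens_dense ht)).
  - by rewrite addr_ge0// ?mulr_ge0 ?nrm_ge0.
  - move=> c y z; rewrite (rep_lin r) (sliceD hsg) (rep_lin r1) !dotDl !dotZl.
    by rewrite scalerBr opprD addrACA.
  - move=> W; rewrite (le_trans (nrmD _ _))// (normN (nrm_is_norm _)) mulrDl lerD//.
      rewrite (le_trans (ab_dot _ _))// mulrAC ler_wpM2r ?nrm_ge0// mulrC.
      exact: (rep_le r).
    rewrite (le_trans (ab_dot _ _))// mulrAC ler_wpM2r ?nrm_ge0//.
    rewrite (le_trans (rep_le r1 _ _))// mulrAC ler_wpM2r ?nrm_ge0//.
    exact: (slice_le hsg).
  - move=> _ [a [b ->]]; rewrite (slice_tens hsg) rt sd (repZ r1) dotZl.
    by rewrite (mulrC (dot (rho2 b v) v)) subrr.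
have E2 : forall W, (h (sg W) - dot (rho2 (s W) v) v : R[i]^o) = 0.
  apply: (@dense_eq0 R T R[i]^o (@cnorm R T) (@nrm R R[i]^o) (cnorm_is_norm _)
      (nrm_is_norm _) id (K * (nrm v * nrm v) + K * nrm v * nrm v)
       _ _ _ _ _ (tens_dense ht)).
  - by rewrite addr_ge0// ?mulr_ge0 ?nrm_ge0.
  - move=> c y z; rewrite (sliceD hsg) (sliceD hs) (rep_lin r2) hl dotDl !dotZl.
    by rewrite scalerBr opprD addrACA.
  - move=> W; rewrite (le_trans (nrmD _ _))// (normN (nrm_is_norm _)) mulrDl lerD//.
      rewrite (le_trans (hK _))// -(mulrA K) ler_wpM2l//.
      exact: (slice_le hsg).
    rewrite (le_trans (ab_dot _ _))// mulrAC ler_wpM2r//.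
    rewrite (le_trans (rep_le r2 _ _))// mulrAC ler_wpM2r//.
    exact: (slice_le hs).
  - move=> _ [a [b ->]]; rewrite (slice_tens hsg) (slice_tens hs).
    have -> : h (dot (rho2 b v) v *: a) = dot (rho2 b v) v * h a.
      have h0 : h 0 = 0 by have := hl (-1) 0 0; rewrite scaler0 add0r mulN1r addNr.
      by have := hl (dot (rho2 b v) v) a 0; rewrite !addr0 h0 addr0.
    by rewrite (repZ r2) dotZl mulrC subrr.
have /eqP := E2 (star Z * Z); rewrite subr_eq0 => /eqP <-.
have sgs : star (sg (star Z * Z)) = sg (star Z * Z).
  rewrite -(slice_star (min_tensor_flip ht) hsg) ?starM ?starK// => b.
  by rewrite (rep_star r2) dotC.
have [x|e [es ee _]] := rep_ge0_sqr r1 i1 sgs.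
  have /eqP := E1 x x (star Z * Z); rewrite subr_eq0 => /eqP <-.
  by rewrite (repM r) (rep_star r) dotxx_ge0.
by rewrite -ee -{1}es hpos.
Qed.

(* Positivity of [s (X^* X)] for [X = l Z (1 (x) b) - W], [b = s (Z^* W)]. *)
Lemma slice_cauchy_schwarz (R : realType) (A B T : cstarType R) (t : A -> B -> T)
    (ht : min_tensor t) (h : A -> R[i]) K (s : T -> B) : is_slice t h K s ->
  (forall c x y, h (c *: x + y) = c * h x + h y) ->
  (forall a, ab (h a) <= K * cnorm a) ->
  (forall x, 0 <= h (star x * x)) ->
  (forall a, h (star a) = Num.conj (h a)) ->
  forall Z W, cnorm (s (star Z * W)) ^+ 2 <=
    cnorm (s (star Z * Z)) * cnorm (s (star W * W)).
Proof.
move=> hs hl hK hpos hst Z W.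
have [H2 [rho [hr ri pos]]] := slice_pos ht hs hl hK hpos.
pose b := s (star Z * W); pose g := cnorm (s (star W * W)).
have g0 : 0 <= g by exact: cnorm_ge0.
rewrite -/b -/g.
(* The norm of s (Z^* Z) is replaced by any strictly larger [be], which is positive and can be
   inverted. *)
suff main be : cnorm (s (star Z * Z)) < be -> cnorm b ^+ 2 <= be * g.
  apply/ler_addgt0Pr => e e0.
  have K1 : 0 < g + 1 by rewrite ltr_wpDl.
  have := main (cnorm (s (star Z * Z)) + e / (g + 1)).
  rewrite ltrDl divr_gt0// => /(_ isT) /le_trans; apply.
  rewrite mulrDl lerD2l mulrAC ler_pdivrMr// ler_wpM2l ?(ltW e0)// lerDl.
  by [].
move=> hbe; have be0 : 0 < be by rewrite (le_lt_trans (cnorm_ge0 _) hbe).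
have : cnorm b <= Num.sqrt (be * g).
  apply: (rep_isometry hr ri); first exact: sqrtr_ge0.
  move=> v; rewrite -(@ler_pXn2r _ 2)// ?nnegrE ?mulr_ge0 ?sqrtr_ge0 ?nrm_ge0//.
  rewrite exprMn sqr_sqrtr ?mulr_ge0 ?(ltW be0)//.
  (* With l = 1 / be the quadratic term is at most |b v|^2 / be, half of the cross term, so
     positivity leaves |b v|^2 / be <= g |v|^2. *)
  pose l := (be^-1)%:C : R[i].
  have lc : Num.conj l = l by exact: conj_real.
  pose X := l *: (Z * t 1 b) - W.
  have := pos v X.
  have -> : star X * X = l ^+ 2 *: (t 1 (star b) * (star Z * Z) * t 1 b)
      - l *: (t 1 (star b) * (star Z * W))
      - l *: (star W * Z * t 1 b) + star W * W.
    rewrite /X starB starZ lc starM (tens_star ht) star1.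
    rewrite mulrBl !mulrBr -!scalerAl -!scalerAr scalerA -expr2.
    by rewrite opprB !mulrA addrA addrAC.
  have sN := sliceD hs.
  have sB x y : s (x - y) = s x - s y.
    by have := sN (-1) y x; rewrite !scaleN1r addrC => ->; rewrite addrC.
  have sD x y : s (x + y) = s x + s y by have := sN 1 x y; rewrite !scale1r.
  have sZ c x : s (c *: x) = c *: s x.
    by have := sN c x 0; rewrite !addr0 (slice0 hs) addr0.
  rewrite sD !sB !sZ !(sliceMr ht hs) !(sliceMl ht hs) -/b.
  have -> : s (star W * Z) = star b.
    by rewrite /b -(slice_star ht hs)// starM starK.
  rewrite (repD hr) !(repB hr) !(repZ hr) !(repM hr).
  have -> : dot (l ^+ 2 *: rho (star b) (rho (s (star Z * Z)) (rho b v)) -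
     l *: rho (star b) (rho b v) - l *: rho (star b) (rho b v) +
     rho (s (star W * W)) v) v =
     l ^+ 2 * dot (rho (s (star Z * Z)) (rho b v)) (rho b v)
     - 2 * l * dot (rho b v) (rho b v) + dot (rho (s (star W * W)) v) v.
    by rewrite dotDl !dotBl !dotZl !(rep_star hr); ring.
  move=> /(fun p => le_trans p (lexx _)).
  rewrite lecE /= => /andP[_].
  set q1 := dot (rho (s (star Z * Z)) _) _; set q2 := dot (rho (s (star W * W)) _) _.
  rewrite dotxx.
  have -> : complex.Re (l ^+ 2 * q1 - 2 * l * (nrm (rho b v) ^+ 2)%:C + q2) =
     be^-1 ^+ 2 * complex.Re q1 - 2 * be^-1 * nrm (rho b v) ^+ 2 + complex.Re q2.
    rewrite /l; case: q1 q2 => [a1 a2] [b1 b2] /=.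
    by rewrite !(mulr0, mul0r, subr0, addr0); ring.
  have h1 : complex.Re q1 <= be * nrm (rho b v) ^+ 2.
    rewrite (le_trans (Re_le_ab _))// (le_trans (ab_dot _ _))//.
    rewrite expr2 mulrA ler_wpM2r ?nrm_ge0//.
    by rewrite (le_trans (rep_le hr _ _))// ler_wpM2r ?nrm_ge0// ltW.
  have h2 : complex.Re q2 <= g * nrm v ^+ 2.
    rewrite (le_trans (Re_le_ab _))// (le_trans (ab_dot _ _))//.
    by rewrite expr2 mulrA ler_wpM2r ?nrm_ge0// (rep_le hr).
  have h3 : be^-1 ^+ 2 * complex.Re q1 <= be^-1 * nrm (rho b v) ^+ 2.
    have p2 : 0 <= be^-1 ^+ 2 by rewrite sqr_ge0.
    rewrite (le_trans (ler_wpM2l p2 h1))// expr2 mulrA mulrVK ?unitfE ?gt_eqF//.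
  move=> h4; rewrite -mulrA -ler_pdivrMl//; lra.
rewrite -(@ler_pXn2r _ 2)// ?nnegrE ?sqrtr_ge0 ?cnorm_ge0// sqr_sqrtr//.
by rewrite mulr_ge0// ltW.
Qed.

(** * The regular representation *)

(* [tau] is the identity for linear maps, the conjugation for antilinear ones. *)
Definition blin_tw (R : realType) (tau : R[i] -> R[i]) (X B : lmodType R[i])
    (NX : X -> R) (NB : B -> R) (f : X -> B) : Prop :=
  (forall c x y, f (c *: x + y) = tau c *: f x + f y) /\
  exists2 M, 0 <= M & forall x, NB (f x) <= M * NX x.

Section TwistedLinear.
Variable R : realType.

(** The main device for the identities below: bounded maps are compared on a total set, such as
    elementary tensors, the products of the cancellation property, or the vectors [iota y]. *)
Lemma blin_tw_eq (tau : R[i] -> R[i]) (X B : lmodType R[i])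
    (NX : X -> R) (NB : B -> R) (f g : X -> B) (S : set X) :
  is_norm NX -> is_norm NB -> blin_tw tau NX NB f -> blin_tw tau NX NB g ->
  norm_dense NX (lin_span S) -> (forall x, S x -> f x = g x) ->
  forall x, f x = g x.
Proof.
move=> hX hB [fl [M M0 fM]] [gl [K K0 gK]] dS fg x.
apply/eqP; rewrite -subr_eq0; apply/eqP.
apply: (@dense_eq0 R X B NX NB hX hB tau (M + K) _ (fun x => f x - g x) _ _ _ dS).
- by rewrite addr_ge0.
- by move=> c y z; rewrite fl gl scalerBr opprD addrACA.
- move=> y; rewrite (le_trans (norm_tri hB _ _))// (normN hB) mulrDl lerD//.
- by move=> y Sy; rewrite fg// subrr.
Qed.

Lemma blin_tw_comp (t1 t2 : R[i] -> R[i]) (X Y Z : lmodType R[i])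
    (NX : X -> R) (NY : Y -> R) (NZ : Z -> R) (f : Y -> Z) (g : X -> Y) :
  blin_tw t1 NY NZ f -> blin_tw t2 NX NY g -> blin_tw (t1 \o t2) NX NZ (f \o g).
Proof.
move=> [fl [M M0 fM]] [gl [K K0 gK]]; split=> [c x y|]; first by rewrite /= gl fl.
exists (M * K) => [|x]; first by rewrite mulr_ge0.
by rewrite (le_trans (fM _))// -mulrA ler_wpM2l.
Qed.

Lemma blin_twD (tau : R[i] -> R[i]) (X B : lmodType R[i])
    (NX : X -> R) (NB : B -> R) (f g : X -> B) : is_norm NB ->
  blin_tw tau NX NB f -> blin_tw tau NX NB g ->
  blin_tw tau NX NB (fun x => f x + g x).
Proof.
move=> hB [fl [M M0 fM]] [gl [K K0 gK]]; split=> [c x y|].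
  by rewrite fl gl scalerDr addrACA.
exists (M + K) => [|x]; first by rewrite addr_ge0.
by rewrite (le_trans (norm_tri hB _ _))// mulrDl lerD.
Qed.

Lemma blin_tw0 (tau : R[i] -> R[i]) (X B : lmodType R[i])
    (NX : X -> R) (NB : B -> R) : is_norm NB ->
  blin_tw tau NX NB (fun=> 0).
Proof.
move=> hB; split=> [c x y|]; first by rewrite scaler0 addr0.
by exists 0 => // x; rewrite (norm0 hB) mul0r.
Qed.

Lemma blin_tw_sum (tau : R[i] -> R[i]) (X B : lmodType R[i])
    (NX : X -> R) (NB : B -> R) (I : Type) (r : seq I) (P : pred I)
    (f : I -> X -> B) : is_norm NB ->
  (forall i, blin_tw tau NX NB (f i)) ->
  blin_tw tau NX NB (fun x => \sum_(i <- r | P i) f i x).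
Proof.
move=> hB hf; elim: r => [|i r IH].
  have -> : (fun x => \sum_(i <- [::] | P i) f i x) = fun=> 0.
    by apply/funext => x; rewrite big_nil.
  exact: blin_tw0.
have -> : (fun x => \sum_(j <- i :: r | P j) f j x) =
    fun x => (if P i then f i x else 0) + \sum_(j <- r | P j) f j x.
  by apply/funext => x; rewrite big_cons; case: ifP; rewrite ?add0r.
apply: blin_twD => //; case: (P i) => //; exact: blin_tw0.
Qed.

Lemma blin_tw_scale (tau : R[i] -> R[i]) (X B : lmodType R[i])
    (NX : X -> R) (NB : B -> R) (f : X -> R[i]^o) (b : B) : is_norm NB ->
  blin_tw tau NX (@nrm R R[i]^o) f -> blin_tw tau NX NB (fun x => f x *: b).
Proof.
move=> hB [fl [M M0 fM]]; split=> [c x y|].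
  by rewrite fl scalerDl -[RHS]/(_ + _) scalerA.
exists (M * NB b) => [|x]; first by rewrite mulr_ge0 ?(norm_ge0 hB).
by rewrite (norm_scale hB) mulrAC ler_wpM2r ?(norm_ge0 hB).
Qed.

Lemma blin_tw_mull (A : cstarType R) (a : A) :
  blin_tw id (@cnorm R A) (@cnorm R A) (fun x => a * x).
Proof.
split=> [c x y|]; first by rewrite mulrDr scalerAr.
by exists (cnorm a) => [|x]; [exact: cnorm_ge0|exact: cnormM].
Qed.

Lemma blin_tw_mulr (A : cstarType R) (a : A) :
  blin_tw id (@cnorm R A) (@cnorm R A) (fun x => x * a).
Proof.
split=> [c x y|]; first by rewrite mulrDl scalerAl.
by exists (cnorm a) => [|x]; [exact: cnorm_ge0|rewrite mulrC cnormM].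
Qed.

Lemma blin_tw_star (A : cstarType R) :
  blin_tw Num.conj (@cnorm R A) (@cnorm R A) star.
Proof.
split=> [c x y|]; first by rewrite starD starZ.
by exists 1 => // x; rewrite mul1r cnorm_star.
Qed.

Lemma blin_tw_dotl (H : hilbertType R) (y : H) :
  blin_tw id (@nrm R H) (@nrm R R[i]^o) (fun x => dot x y).
Proof.
split=> [c x z|]; first by rewrite dotDl dotZl.
by exists (nrm y) => [|x]; [exact: nrm_ge0|rewrite mulrC ab_dot].
Qed.

Lemma blin_tw_dotr (H : hilbertType R) (y : H) :
  blin_tw Num.conj (@nrm R H) (@nrm R R[i]^o) (fun x => dot y x).
Proof.
split=> [c x z|]; first by rewrite dotDr dotZr.
by exists (nrm y) => [|x]; [exact: nrm_ge0|rewrite ab_dot].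
Qed.

Lemma blin_tw_slice (A B T : cstarType R) (t : A -> B -> T) phi K s :
  is_slice t phi K s -> blin_tw id (@cnorm R T) (@cnorm R B) s.
Proof. by move=> [K0 sD sM _]; split=> //; exists K. Qed.

End TwistedLinear.

Lemma norm_dense_span (R : realType) (V : lmodType R[i]) (N : V -> R) (D : set V) :
  norm_dense N D -> norm_dense N (lin_span D).
Proof.
by move=> h x e e0; have [y Dy xy] := h x e e0; exists y => //; exact: lin_span_in.
Qed.

Section Fourier.
Variables (R : realType) (G : compact_quantum_group R) (h : {scalar G}).
Hypothesis hh : haar_state h.
Variable L2 : gns_triple h.
Local Notation H := (gns_space L2).
Local Notation AA := (CG2 G).
Local Notation N := (@cnorm R G).
Local Notation N2 := (@cnorm R AA).
Local Notation t := (@tens R G).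
Let tP : min_tensor t := tensP G.

(** The GNS map from C(G) to L^2(G). It has dense range but need not be injective; maps out of L^2
    are therefore extended from graphs by means of an L^2 bound. *)
Definition gns_map (x : G) : H := gns_rep L2 x (gns_vec L2).
Local Notation iota := gns_map.

Let hr : star_rep (gns_rep L2) := gns_repP L2.

Lemma iotaD c x y : iota (c *: x + y) = c *: iota x + iota y.
Proof. exact: (rep_lin hr). Qed.
Lemma iotaZ c x : iota (c *: x) = c *: iota x. Proof. exact: (repZ hr). Qed.
Lemma iota0 : iota 0 = 0. Proof. exact: (rep0 hr). Qed.

Lemma dot_iota x y : dot (iota x) (iota y) = h (star y * x).
Proof.
by rewrite (gns_stateE L2) /iota (repM hr) (rep_star hr).
Qed.

Lemma hD c x y : h (c *: x + y) = c * h x + h y.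
Proof. exact: linearP. Qed.
Lemma hZ c x : h (c *: x) = c * h x.
Proof. exact: linearZ. Qed.

Lemma h_star x : h (star x) = Num.conj (h x).
Proof. by rewrite !(gns_stateE L2) (rep_star hr) -dotC. Qed.

Lemma nrm_iota2 x : (nrm (iota x) ^+ 2)%:C = h (star x * x).
Proof. by rewrite -dotxx dot_iota. Qed.

Lemma nrm_vac : nrm (gns_vec L2) = 1.
Proof.
have := nrm_iota2 1; rewrite star1 mulr1 (haar1 hh) /iota (rep1 hr).
move=> /complexI/eqP; rewrite sqrf_eq1 => /orP[/eqP//|/eqP E].
by have := nrm_ge0 (gns_vec L2); rewrite E lerNr oppr0 ler10.
Qed.

Lemma iota_le x : nrm (iota x) <= N x.
Proof. by have := rep_le hr x (gns_vec L2); rewrite nrm_vac mulr1. Qed.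

Lemma h_le x : ab (h x) <= N x.
Proof.
by rewrite (gns_stateE L2) (le_trans (ab_dot _ _))// nrm_vac mulr1 iota_le.
Qed.

Lemma h_ge0 x : 0 <= h (star x * x).
Proof. by rewrite -nrm_iota2 (_ : 0 = 0%:C)// lecR sqr_ge0. Qed.

Lemma iota_dense : norm_dense (@nrm R H) (range iota).
Proof. exact: closure_norm_dense (gns_cyclic L2). Qed.

Lemma iota_dense_span : norm_dense (@nrm R H) (lin_span (range iota)).
Proof. exact: norm_dense_span iota_dense. Qed.

Lemma blin_iota : blin_tw id N (@nrm R H) iota.
Proof.
split; first exact: iotaD.
by exists 1 => // x; rewrite mul1r iota_le.
Qed.

Lemma comulD c x y : comul G (c *: x + y) = c *: comul G x + comul G y.
Proof. exact: linearP. Qed.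
Lemma comulM x y : comul G (x * y) = comul G x * comul G y.
Proof. exact: rmorphM. Qed.
Lemma comul_le x : N2 (comul G x) <= N x.
Proof.
have [K [rho [kr ki]]] := tens_faithful tP.
apply: (star_hom_le kr ki) => [c y z||y z|y].
- exact: comulD.
- exact: rmorph1.
- exact: comulM.
- exact: comul_star.
Qed.
Lemma blin_comul : blin_tw id N N2 (comul G).
Proof.
split; first exact: comulD.
by exists 1 => // x; rewrite mul1r comul_le.
Qed.

(** The bound is enlarged to [|M| + 1] so that K >= 1: then K also bounds [h], as
    [slice_cauchy_schwarz] requires, and K <= K^2. *)
Lemma haar_slice_l : exists K s, [/\ is_slice t h K s, 1 <= K &
  forall x, s (comul G x) = h x *: 1].
Proof.
have [s [[M sM] st sc]] := haar_left hh.
exists (`|M| + 1), s; split => //; last by rewrite lerDr.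
split=> [|c x y|z|//]; first by rewrite addr_ge0.
  exact: linearP.
rewrite (le_trans (sM _))// ler_wpM2r ?cnorm_ge0//.
by rewrite (le_trans (ler_norm _))// lerDl.
Qed.

Lemma haar_slice_r : exists K s, is_slice (fun b a => t a b) h K s /\
  forall x, s (comul G x) = h x *: 1.
Proof.
have [s [[M sM] st sc]] := haar_right hh.
exists (`|M| + 1), s; split => //.
split=> [|c x y|z|//]; first by rewrite addr_ge0.
  exact: linearP.
rewrite (le_trans (sM _))// ler_wpM2r ?cnorm_ge0//.
by rewrite (le_trans (ler_norm _))// lerDl.
Qed.

Lemma Om_exists : exists Om : H -> AA -> G,
  forall eta, is_slice t (fun a => dot (iota a) eta) (nrm eta) (Om eta).
Proof.
suff /choice[f fP] : forall eta, exists s,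
    is_slice t (fun a => dot (iota a) eta) (nrm eta) s by exists f.
move=> eta.
apply: slice_exists => //.
- exact: nrm_ge0.
- by move=> c x y; rewrite iotaD dotDl dotZl.
- by move=> a; rewrite (le_trans (ab_dot _ _))// mulrC ler_wpM2l ?nrm_ge0 ?iota_le.
Qed.

(* [Om eta] slices the first leg by the vector functional of [eta]. *)
Definition vec_slice := projT1 (cid Om_exists).
Local Notation Om := vec_slice.
Lemma OmP eta : is_slice t (fun a => dot (iota a) eta) (nrm eta) (Om eta).
Proof. exact: (projT2 (cid Om_exists)). Qed.

Lemma OmDl c eta eta' Z :
  Om (c *: eta + eta') Z = Num.conj c *: Om eta Z + Om eta' Z.
Proof.
have hb e := blin_tw_slice (OmP e).
have hb2 : blin_tw id N2 N (fun Z => Num.conj c *: Om eta Z + Om eta' Z).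
  apply: blin_twD; [exact: cnorm_is_norm| |exact: hb].
  have := blin_tw_comp (blin_tw_mull (Num.conj c *: 1)) (hb eta).
  by congr blin_tw; apply/funext => x; rewrite /= -scalerAl mul1r.
apply: (blin_tw_eq (cnorm_is_norm _) (cnorm_is_norm _) (hb _) hb2 (tens_dense tP)).
move=> _ [a [b ->]]; rewrite !(slice_tens (OmP _)) dotDr dotZr scalerDl scalerA.
by [].
Qed.

Lemma OmB eta eta' Z : Om (eta - eta') Z = Om eta Z - Om eta' Z.
Proof.
by have := OmDl (-1) eta' eta Z; rewrite rmorphN1 !scaleN1r addrC => ->; rewrite addrC.
Qed.

Section HaarSlice.
Variables (K : R) (s : AA -> G).
Hypotheses (hs : is_slice t h K s) (K1 : 1 <= K)
  (sc : forall x, s (comul G x) = h x *: 1).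

Lemma Om_iota c Z : Om (iota c) Z = s (t (star c) 1 * Z).
Proof.
have hb2 : blin_tw id N2 N (fun Z => s (t (star c) 1 * Z)).
  exact: (blin_tw_comp (blin_tw_slice hs) (blin_tw_mull _)).
apply: (blin_tw_eq (cnorm_is_norm _) (cnorm_is_norm _) (blin_tw_slice (OmP _)) hb2 (tens_dense tP)).
move=> _ [a [b ->]]; rewrite (slice_tens (OmP _)) (tensM tP) mul1r (slice_tens hs).
by rewrite dot_iota.
Qed.

Let scs Z W : N (s (star Z * W)) ^+ 2 <= N (s (star Z * Z)) * N (s (star W * W)).
Proof.
apply: (slice_cauchy_schwarz tP hs) => [|a||].
- exact: hD.
- rewrite (le_trans (h_le a))// ler_peMl// cnorm_ge0//.
- exact: h_ge0.
- exact: h_star.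
Qed.

Let s_comul2 y : N (s (star (comul G y) * comul G y)) = nrm (iota y) ^+ 2.
Proof.
rewrite -comul_star -comulM sc cnormZ cnorm1 mulr1 -nrm_iota2 ab_real.
by rewrite ger0_norm// sqr_ge0.
Qed.

(** Cauchy-Schwarz for the slice: by invariance the second factor (h (x) id) Delta(y^* y) is h(y^*
    y) 1, so a C*-norm gets bounded by an L^2 norm. *)
Lemma s_le Y y : N (s (Y * comul G y)) <= K * N2 Y * nrm (iota y).
Proof.
have K0 : 0 <= K by rewrite (le_trans ler01).
rewrite -(@ler_pXn2r _ 2)// ?nnegrE ?cnorm_ge0 ?mulr_ge0 ?nrm_ge0 ?cnorm_ge0//.
have := scs (star Y) (comul G y); rewrite starK s_comul2 => /le_trans; apply.
rewrite exprMn ler_wpM2r ?sqr_ge0// (le_trans (slice_le hs _))//.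
rewrite exprMn.
have h1 : N2 (Y * star Y) <= N2 Y ^+ 2.
  by rewrite (le_trans (cnormM _ _))// cnorm_star expr2.
rewrite (le_trans (ler_wpM2l K0 h1))// ler_wpM2r ?sqr_ge0// expr2.
by rewrite ler_peMl.
Qed.

(** For eta = iota c, Cauchy-Schwarz applies with the first factor h(c^* c) 1 and the second h(y^*
    y) 1; density of the range of [iota] gives the general case. With the C*-norm on the left, the
    coefficients of the regular representation can be taken in C(G). *)
Lemma Om_comul_le eta y : N (Om eta (comul G y)) <= nrm eta * nrm (iota y).
Proof.
have base c : N (Om (iota c) (comul G y)) <= nrm (iota c) * nrm (iota y).
  rewrite -(@ler_pXn2r _ 2)// ?nnegrE ?cnorm_ge0 ?mulr_ge0 ?nrm_ge0//.
  rewrite Om_iota -[X in t _ X]star1 -(tens_star tP) exprMn.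
  rewrite (le_trans (scs _ _))// s_comul2 ler_wpM2r ?sqr_ge0//.
  rewrite (tens_star tP) star1 (tensM tP) mul1r (slice_tens hs) cnormZ cnorm1 mulr1.
  by rewrite -nrm_iota2 ab_real ger0_norm ?sqr_ge0.
apply/ler_addgt0Pr => e e0.
(* [B] collects the two errors made by replacing eta with iota c: the slice of the difference, and
   |iota c| against |eta|. *)
pose B := N2 (comul G y) + nrm (iota y).
have B0 : 0 <= B by rewrite addr_ge0 ?cnorm_ge0 ?nrm_ge0.
have B1 : 0 < B + 1 by rewrite ltr_wpDl.
have [_ [c _ <-] ec] := iota_dense eta (divr_gt0 e0 B1).
have -> : Om eta (comul G y) = Om (eta - iota c) (comul G y) + Om (iota c) (comul G y).
  by rewrite OmB subrK.
rewrite (le_trans (norm_tri (cnorm_is_norm _) _ _))//.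
have h1 := slice_le (OmP (eta - iota c)) (comul G y).
have h2 := base c.
have h3 : nrm (iota c) <= nrm eta + nrm (eta - iota c).
  by rewrite -{1}(subKr eta (iota c)) (le_trans (nrmD _ _))// (normN (nrm_is_norm _)).
have h4 := ler_wpM2r (nrm_ge0 (iota y)) h3.
have h5 : nrm (eta - iota c) * B <= e.
  rewrite (le_trans (ler_wpM2r B0 (ltW ec)))// mulrAC ler_pdivrMr//.
  by rewrite ler_wpM2l ?(ltW e0)// lerDl.
rewrite /B mulrDr in h5; rewrite mulrDl in h4; lra.
Qed.

End HaarSlice.

Lemma U_exists : exists U : H -> H -> G, forall eta,
  [/\ forall y, U eta (iota y) = Om eta (comul G y),
      forall c x y, U eta (c *: x + y) = c *: U eta x + U eta y &
      forall xi, N (U eta xi) <= nrm eta * nrm xi].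
Proof.
suff /choice[f fP] : forall eta, exists u : H -> G,
    [/\ forall y, u (iota y) = Om eta (comul G y),
        forall c x y, u (c *: x + y) = c *: u x + u y &
        forall xi, N (u xi) <= nrm eta * nrm xi] by exists f.
move=> eta.
have [K [s [hs K1 sc]]] := haar_slice_l.
pose gr x b := exists2 y, x = iota y & b = Om eta (comul G y).
have [||||||f [f1 f2 f3]] := @dense_ext R H G (@nrm R H) N (nrm_is_norm _)
  (cnorm_is_norm _) id (nrm eta) (nrm_ge0 _) (@cstar_complete R G) _ _ gr.
- by [].
- by [].
- by exists 0; rewrite ?iota0// raddf0 (slice0 (OmP _)).
- move=> c x b x' b' [y -> ->] [y' -> ->]; exists (c *: y + y').
    by rewrite iotaD.
  by rewrite comulD (sliceD (OmP _)).
- by move=> x b [y -> ->]; exact: (Om_comul_le hs).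
- move=> x e e0; have [_ [y _ <-] xy] := iota_dense x e0.
  by exists (iota y) => //=; exists (Om eta (comul G y)); exists y.
by exists f; split=> // y; apply: f1; exists y.
Qed.

(* [U eta xi] is the coefficient of the regular representation at the vectors
   [eta], [xi]: formally [(<., eta> (x) id) (Delta xi)]. *)
Definition reg_coeff := projT1 (cid U_exists).
Local Notation U := reg_coeff.
Lemma U_iota eta y : U eta (iota y) = Om eta (comul G y).
Proof. by case: (projT2 (cid U_exists) eta). Qed.
Lemma UDr eta c x y : U eta (c *: x + y) = c *: U eta x + U eta y.
Proof. by case: (projT2 (cid U_exists) eta). Qed.
Lemma U_le eta xi : N (U eta xi) <= nrm eta * nrm xi.
Proof. by case: (projT2 (cid U_exists) eta). Qed.

Lemma blin_U eta : blin_tw id (@nrm R H) N (U eta).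
Proof.
split; first exact: UDr.
by exists (nrm eta) => [|x]; [exact: nrm_ge0|exact: U_le].
Qed.

Lemma iota_eq (tau : R[i] -> R[i]) (B : lmodType R[i]) (NB : B -> R) (f g : H -> B) :
  is_norm NB -> blin_tw tau (@nrm R H) NB f -> blin_tw tau (@nrm R H) NB g ->
  (forall y, f (iota y) = g (iota y)) -> forall x, f x = g x.
Proof.
move=> hB hf hg fg.
apply: (blin_tw_eq (nrm_is_norm _) hB hf hg iota_dense_span).
by move=> _ [y _ <-].
Qed.

Lemma UDl c x y xi : U (c *: x + y) xi = Num.conj c *: U x xi + U y xi.
Proof.
have hb2 : blin_tw id (@nrm R H) N (fun xi => Num.conj c *: U x xi + U y xi).
  apply: blin_twD; [exact: cnorm_is_norm| |exact: blin_U].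
  have := blin_tw_comp (blin_tw_mull (Num.conj c *: 1)) (blin_U x).
  by congr blin_tw; apply/funext => z; rewrite /= -scalerAl mul1r.
apply: (iota_eq (cnorm_is_norm _) (blin_U _) hb2) => z.
by rewrite !U_iota OmDl.
Qed.

Lemma blin_Ul xi : blin_tw Num.conj (@nrm R H) N (U^~ xi).
Proof.
split=> [c x y|]; first exact: UDl.
by exists (nrm xi) => [|x]; [exact: nrm_ge0|rewrite mulrC U_le].
Qed.

(** Formally [haar_op Y xi] is (h (x) id)(Y Delta(xi)). The constant is packed with the map, and the
    value is described for every slice of [h], all of which coincide by density. *)
Lemma S_exists : exists p : R * (AA -> H -> G), 0 <= p.1 /\ forall Y,
  [/\ forall y, forall s K', is_slice t h K' s -> p.2 Y (iota y) = s (Y * comul G y),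
      forall c x y, p.2 Y (c *: x + y) = c *: p.2 Y x + p.2 Y y &
      forall xi, N (p.2 Y xi) <= p.1 * N2 Y * nrm xi].
Proof.
have [K [s [hs K1 sc]]] := haar_slice_l.
have K0 : 0 <= K by rewrite (le_trans ler01).
suff /choice[S SP] : forall Y, exists u : H -> G,
  [/\ forall y, u (iota y) = s (Y * comul G y),
      forall c x y, u (c *: x + y) = c *: u x + u y &
      forall xi, N (u xi) <= K * N2 Y * nrm xi].
  exists (K, S); split=> // Y; have [S1 S2 S3] := SP Y; split=> // y s' K' hs'; rewrite /= S1.
  apply: (blin_tw_eq (cnorm_is_norm _) (cnorm_is_norm _) (blin_tw_slice hs)
    (blin_tw_slice hs') (tens_dense tP)).
  by move=> _ [a [b ->]]; rewrite (slice_tens hs) (slice_tens hs').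
move=> Y.
pose gr x b := exists2 y, x = iota y & b = s (Y * comul G y).
have KY : 0 <= K * N2 Y by rewrite mulr_ge0 ?cnorm_ge0.
have [||||||f [f1 f2 f3]] := @dense_ext R H G (@nrm R H) N (nrm_is_norm _)
  (cnorm_is_norm _) id (K * N2 Y) KY (@cstar_complete R G) _ _ gr.
- by [].
- by [].
- by exists 0; rewrite ?iota0// raddf0 mulr0 (slice0 hs).
- move=> c x b x' b' [y -> ->] [y' -> ->]; exists (c *: y + y').
    by rewrite iotaD.
  by rewrite comulD mulrDr -scalerAr (sliceD hs).
- by move=> x b [y -> ->]; exact: (s_le hs).
- move=> x e e0; have [_ [y _ <-] xy] := iota_dense x e0.
  by exists (iota y) => //=; exists (s (Y * comul G y)); exists y.
by exists f; split=> // y; apply: f1; exists y.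
Qed.

Definition SK := (projT1 (cid S_exists)).1.
Definition haar_op := (projT1 (cid S_exists)).2.
Local Notation S := haar_op.
Let SP := projT2 (cid S_exists).
Lemma SK_ge0 : 0 <= SK. Proof. exact: SP.1. Qed.
Lemma S_iota Y y s K : is_slice t h K s -> S Y (iota y) = s (Y * comul G y).
Proof. by move=> hs; case: (SP.2 Y) => /(_ y s K hs). Qed.
Lemma SDr Y c x y : S Y (c *: x + y) = c *: S Y x + S Y y.
Proof. by case: (SP.2 Y). Qed.
Lemma S_le Y xi : N (S Y xi) <= SK * N2 Y * nrm xi.
Proof. by case: (SP.2 Y). Qed.

Lemma blin_S Y : blin_tw id (@nrm R H) N (S Y).
Proof.
split; first exact: SDr.
by exists (SK * N2 Y) => [|x]; [rewrite mulr_ge0 ?SK_ge0 ?cnorm_ge0|exact: S_le].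
Qed.

Lemma SDl c x y xi : S (c *: x + y) xi = c *: S x xi + S y xi.
Proof.
have [K [s [hs K1 sc]]] := haar_slice_l.
have hb2 : blin_tw id (@nrm R H) N (fun xi => c *: S x xi + S y xi).
  apply: blin_twD; [exact: cnorm_is_norm| |exact: blin_S].
  have := blin_tw_comp (blin_tw_mull (c *: 1)) (blin_S x).
  by congr blin_tw; apply/funext => z; rewrite /= -scalerAl mul1r.
apply: (iota_eq (cnorm_is_norm _) (blin_S _) hb2) => z.
by rewrite !(S_iota _ _ hs) mulrDl -scalerAl (sliceD hs).
Qed.

Lemma blin_Sl xi : blin_tw id N2 N (S^~ xi).
Proof.
split=> [c x y|]; first exact: SDl.
exists (SK * nrm xi) => [|x]; first by rewrite mulr_ge0 ?SK_ge0 ?nrm_ge0.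
by rewrite mulrAC S_le.
Qed.

Lemma S_tens c xi : S (t (star c) 1) xi = U (iota c) xi.
Proof.
have [K [s [hs K1 sc]]] := haar_slice_l.
apply: (iota_eq (cnorm_is_norm _) (blin_S _) (blin_U _)) => y.
by rewrite (S_iota _ _ hs) U_iota (Om_iota hs).
Qed.

Lemma S_star_tens a w xi : S (star (t a w)) xi = star w * U (iota a) xi.
Proof.
have [K [s [hs K1 sc]]] := haar_slice_l.
have hb2 := blin_tw_comp (blin_tw_mull (star w)) (blin_U (iota a)).
apply: (iota_eq (cnorm_is_norm _) (blin_S _) hb2) => y.
rewrite /= (S_iota _ _ hs) U_iota (Om_iota hs) (tens_star tP).
have -> : t (star a) (star w) = t 1 (star w) * t (star a) 1.
  by rewrite (tensM tP) mul1r mulr1.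
by rewrite -mulrA (sliceMl tP hs).
Qed.

(** By invariance (h (x) id)((1 (x) x) Delta(p y)) = h(p y) x. These operators have rank at most
    one, and the cancellation property makes their sums approximate all the others. *)
Lemma S_mul_comul x p xi : S (t 1 x * comul G p) xi = dot xi (iota (star p)) *: x.
Proof.
have [K [s [hs K1 sc]]] := haar_slice_l.
have hb2 : blin_tw id (@nrm R H) N (fun xi => dot xi (iota (star p)) *: x).
  by apply: blin_tw_scale; [exact: cnorm_is_norm|exact: blin_tw_dotl].
apply: (iota_eq (cnorm_is_norm _) (blin_S _) hb2) => y.
rewrite (S_iota _ _ hs) -mulrA -comulM (sliceMl tP hs) sc dot_iota starK.
by rewrite -scalerAr mulr1.
Qed.

Lemma S_star_comul y xi : S (star (comul G y)) xi = dot xi (iota y) *: 1.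
Proof.
have := S_mul_comul 1 (star y) xi; rewrite (tens11 tP) mul1r starK => <-.
by rewrite comul_star.
Qed.

Lemma cancel_dense : norm_dense N2 (lin_span [set z | exists x y, z = t 1 x * comul G y]).
Proof. exact: cancellation_r. Qed.

Lemma cancel_dense_star :
  norm_dense N2 (lin_span [set z | exists x y, z = comul G y * t 1 x]).
Proof.
move=> Z e e0; have [Y YS ZY] := cancel_dense (star Z) e0.
exists (star Y).
  move: YS => [n [c [s [Ss ->]]]]; exists n, (fun i => Num.conj (c i)), (fun i => star (s i)).
  split=> [i|]; last by rewrite star_sum; apply: eq_bigr => i _; rewrite starZ.
  have [x [y ->]] := Ss i; exists (star x), (star y).
  by rewrite starM (tens_star tP) star1 comul_star.
by rewrite -{1}(starK Z) -starB cnorm_star.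
Qed.

(** * Convolution operators *)

Section Convolution.
Variable c : G.

(** The map is (omega (x) id (x) id)(Delta (x) id) with omega = <., iota c>, that is, convolution on
    the first leg. On Delta(y), coassociativity replaces Delta (x) id by id (x) Delta, and slicing
    the first leg then commutes with Delta. *)
Lemma Lam_exists : exists Lam : AA -> AA,
  [/\ blin_tw id N2 N2 Lam,
      forall y w, Lam (t y w) = t (U (iota c) (iota y)) w &
      forall y, Lam (comul G y) = comul G (U (iota c) (iota y))].
Proof.
have [L [M [tl [tr [Did [idD [al]]]]]]] := comul_coassociative G.
move=> [[tlP trP] [[K1 Didb] [K2 idDb] [K3 alb]] Dt alt coass].
have [|||sg hsg] := @slice_exists R G AA M tr trP (fun a => dot (iota a) (iota c)) (nrm (iota c)).
- exact: nrm_ge0.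
- by move=> k x y; rewrite iotaD dotDl dotZl.
- by move=> a; rewrite (le_trans (ab_dot _ _))// mulrC ler_wpM2l ?nrm_ge0 ?iota_le.
have mk (X Y : cstarType R) (f : {linear X -> Y}) (B : R) :
    (forall x, cnorm (f x) <= B * cnorm x) -> blin_tw id (@cnorm R X) (@cnorm R Y) f.
  move=> fB; split=> [k x y|]; first exact: linearP.
  exists `|B| => // x; rewrite (le_trans (fB _))// ler_wpM2r ?cnorm_ge0//.
  exact: ler_norm.
have bD := mk _ _ Did _ Didb; have bI := mk _ _ idD _ idDb; have bA := mk _ _ al _ alb.
have bS := blin_tw_slice hsg.
have bt1 b : blin_tw id N N2 (fun a => t a b).
  split=> [k x y|]; first exact: (tensDl tP).
  exists (cnorm b) => [|x]; first exact: cnorm_ge0.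
  by rewrite mulrC (tens_le tP).
exists (sg \o (al \o Did)); split.
- exact: (blin_tw_comp bS (blin_tw_comp bA bD)).
- move=> y w /=; rewrite (Dt y w).1 U_iota.
  have btl : blin_tw id N2 (@cnorm R L) (fun Z => tl Z w).
    split=> [k x z|]; first exact: (tensDl tlP).
    exists (cnorm w) => [|x]; first exact: cnorm_ge0.
    by rewrite mulrC (tens_le tlP).
  have b1 := blin_tw_comp bS (blin_tw_comp bA btl).
  have b2 := blin_tw_comp (bt1 w) (blin_tw_slice (OmP (iota c))).
  apply: (blin_tw_eq (cnorm_is_norm _) (cnorm_is_norm _) b1 b2 (tens_dense tP)).
  move=> _ [p [q ->]] /=; rewrite alt (slice_tens hsg) (slice_tens (OmP _)).
  by rewrite (tensZl tP).
- move=> y /=; rewrite coass U_iota.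
  have b1 := blin_tw_comp bS bI.
  have b2 := blin_tw_comp blin_comul (blin_tw_slice (OmP (iota c))).
  apply: (blin_tw_eq (cnorm_is_norm _) (cnorm_is_norm _) b1 b2 (tens_dense tP)).
  move=> _ [p [q ->]] /=; rewrite (Dt p q).2 (slice_tens hsg) (slice_tens (OmP _)).
  by rewrite linearZ.
Qed.

Definition convop_left := projT1 (cid Lam_exists).
Local Notation Lam := convop_left.
Lemma blin_Lam : blin_tw id N2 N2 Lam.
Proof. by case: (projT2 (cid Lam_exists)). Qed.
Lemma Lam_tens y w : Lam (t y w) = t (U (iota c) (iota y)) w.
Proof. by case: (projT2 (cid Lam_exists)). Qed.
Lemma Lam_comul y : Lam (comul G y) = comul G (U (iota c) (iota y)).
Proof. by case: (projT2 (cid Lam_exists)). Qed.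
Lemma Lam_mulr Z x : Lam (Z * t 1 x) = Lam Z * t 1 x.
Proof.
have b1 := blin_tw_comp blin_Lam (blin_tw_mulr (t 1 x)).
have b2 := blin_tw_comp (blin_tw_mulr (t 1 x)) blin_Lam.
apply: (blin_tw_eq (cnorm_is_norm _) (cnorm_is_norm _) b1 b2 (tens_dense tP)).
move=> _ [p [q ->]] /=; rewrite (tensM tP) mulr1 !Lam_tens (tensM tP) mulr1.
by [].
Qed.

Definition convop xi : H := iota (U (iota c) xi).
Local Notation conv := convop.

Lemma blin_conv : blin_tw id (@nrm R H) (@nrm R H) conv.
Proof. exact: (blin_tw_comp blin_iota (blin_U _)). Qed.

Lemma conv_adj_exists : exists L' : H -> H,
  (forall x y, dot (conv x) y = dot x (L' y)) /\
  blin_tw id (@nrm R H) (@nrm R H) L'.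
Proof.
have [cl [M M0 cM]] := blin_conv.
have [L' [h1 h2 h3]] := adjoint cl cM.
by exists L'; split=> //; split=> //; exists M.
Qed.

Definition convop_adj := projT1 (cid conv_adj_exists).
Local Notation conv_adj := convop_adj.
Lemma conv_adjP x y : dot (conv x) y = dot x (conv_adj y).
Proof. by case: (projT2 (cid conv_adj_exists)). Qed.
Lemma blin_conv_adj : blin_tw id (@nrm R H) (@nrm R H) conv_adj.
Proof. by case: (projT2 (cid conv_adj_exists)). Qed.

(** Slicing [Lam_comul] by [z] moves the convolution operator from one argument of the coefficient
    to its adjoint in the other. Together with [U_convl] this says that [conv2] commutes with the
    regular representation. *)
Lemma U_conv z xi : U z (conv xi) = U (conv_adj z) xi.
Proof.
have b1 := blin_tw_comp (blin_U z) blin_conv.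
apply: (iota_eq (cnorm_is_norm _) b1 (blin_U _)) => y.
change (U z (iota (U (iota c) (iota y))) = U (conv_adj z) (iota y)).
rewrite (U_iota z) -Lam_comul (U_iota (conv_adj z)).
have b2 := blin_tw_comp (blin_tw_slice (OmP z)) blin_Lam.
apply: (blin_tw_eq (cnorm_is_norm _) (cnorm_is_norm _) b2 (blin_tw_slice (OmP _)) (tens_dense tP)).
move=> _ [a [w ->]] /=; rewrite Lam_tens !(slice_tens (OmP _)).
by rewrite -conv_adjP.
Qed.

Lemma U_convl eta xi : U (conv eta) xi = U eta (conv_adj xi).
Proof.
have b1 := blin_tw_comp (blin_Ul xi) blin_conv.
apply: (iota_eq (cnorm_is_norm _) b1 (blin_Ul _)) => y.
have bs k := blin_tw_comp (blin_Sl k) (@blin_tw_star R AA).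
have b2 := blin_tw_comp (bs xi) blin_Lam.
have E a k : U (iota a) k = S (star (t a 1)) k.
  by rewrite -S_tens (tens_star tP) star1.
change (U (iota (U (iota c) (iota y))) xi = U (iota y) (conv_adj xi)).
rewrite (E (U (iota c) (iota y))) (E y (conv_adj xi)) -Lam_tens.
(* [S] is taken at adjoints and is explicit at (1 (x) x) Delta(p), so the test elements are the
   products Delta(p) (1 (x) x). *)
apply: (blin_tw_eq (cnorm_is_norm _) (cnorm_is_norm _) b2 (bs _) cancel_dense_star).
move=> _ [x [p ->]] /=; rewrite Lam_mulr Lam_comul !starM !(tens_star tP) !star1.
rewrite -!comul_star !S_mul_comul !starK.
rewrite -[iota (U _ _)]/(conv (iota p)) (dotC _ xi) conv_adjP -dotC.
by [].
Qed.

(* Cancellation makes [conv] a norm limit of operators of finite rank. *)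
Lemma conv_compact e : 0 < e -> exists n (p x : 'I_n -> H), forall xi,
  nrm (conv xi - \sum_i dot xi (p i) *: x i) <= e * nrm xi.
Proof.
move=> e0.
have K1 : 0 < SK + 1 by rewrite ltr_wpDl ?SK_ge0.
have [Y YS tY] := cancel_dense (t (star c) 1) (divr_gt0 e0 K1).
have [n [p [x hY]]] : exists n (p x : 'I_n -> H), forall xi,
    iota (S Y xi) = \sum_i dot xi (p i) *: x i.
  move: YS => [n [k [s [Ss ->]]]].
  have /choice[f fP] : forall i, exists q : G * G, s i = t 1 q.1 * comul G q.2.
    by move=> i; have [x [y ->]] := Ss i; exists (x, y).
  exists n, (fun i => iota (star (f i).2)), (fun i => k i *: iota (f i).1) => xi.
  elim: n k s Ss f fP => [|n IH] k s Ss f fP.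
    rewrite !big_ord0 (_ : S 0 xi = 0) ?iota0//.
    by have := SDl (-1) 0 0 xi; rewrite scaler0 addr0 scaleN1r addNr.
  rewrite !big_ord_recl SDl iotaD.
  rewrite (IH _ _ _ (fun i => f (lift ord0 i)))//; congr (_ + _).
  by rewrite fP S_mul_comul iotaZ !scalerA mulrC.
exists n, p, x => xi; rewrite -hY /conv -S_tens.
have -> : iota (S (t (star c) 1) xi) - iota (S Y xi) = iota (S (t (star c) 1 - Y) xi).
  have := SDl (-1) Y (t (star c) 1) xi; rewrite !scaleN1r addrC => ->.
  by rewrite -scaleN1r iotaD scaleN1r addrC.
rewrite (le_trans (iota_le _))// (le_trans (S_le _ _))// ler_wpM2r ?nrm_ge0//.
rewrite (le_trans (ler_wpM2l SK_ge0 (ltW tY)))// mulrCA ger_pMr//.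
by rewrite ler_pdivrMr// mul1r lerDl.
Qed.

Definition convop2 xi := conv_adj (conv xi).
Local Notation conv2 := convop2.

Lemma blin_conv2 : blin_tw id (@nrm R H) (@nrm R H) conv2.
Proof. exact: (blin_tw_comp blin_conv_adj blin_conv). Qed.

Lemma U_conv2 eta xi : U (conv2 eta) xi = U eta (conv2 xi).
Proof. by rewrite /convop2 -U_conv U_convl. Qed.

Lemma conv2_sa x y : dot (conv2 x) y = dot x (conv2 y).
Proof. by rewrite /convop2 -conv_adjP dotC -conv_adjP -dotC. Qed.

End Convolution.

End Fourier.

(** * Eigenvectors of compact operators *)

Section Ultra.
Variables (R : realType) (F : set_system nat) (FU : UltraFilter F).

(** Along an ultrafilter every bounded scalar sequence is Cauchy, hence so are the images of a
    bounded sequence under all finite rank operators simultaneously. This replaces a diagonal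
    extraction of subsequences. *)
Definition ultra_cauchy (V : lmodType R[i]) (N : V -> R) (f : nat -> V) :=
  forall e : R, 0 < e -> exists2 A, F A & forall i j, A i -> A j -> N (f i - f j) < e.

Lemma ultra_cauchyD (V : lmodType R[i]) (N : V -> R) f g : is_norm N ->
  ultra_cauchy N f -> ultra_cauchy N g -> ultra_cauchy N (fun i => f i + g i).
Proof.
move=> hN hf hg e e0; have e2 : 0 < e / 2 by rewrite divr_gt0.
have [A FA hA] := hf _ e2; have [B FB hB] := hg _ e2.
exists (A `&` B) => [|i j [Ai Bi] [Aj Bj]]; first exact: filterI.
rewrite opprD addrACA (le_lt_trans (norm_tri hN _ _))//.
by rewrite [ltRHS](splitr e) ltrD ?hA ?hB.
Qed.

Lemma ultra_cauchy_cst (V : lmodType R[i]) (N : V -> R) x : is_norm N ->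
  ultra_cauchy N (fun=> x).
Proof.
move=> hN e e0; exists setT => [|i j _ _]; first exact: filterT.
by rewrite subrr (norm0 hN).
Qed.

Lemma ultra_cauchy_scale (V : lmodType R[i]) (N : V -> R) (f : nat -> R[i]^o) x :
  is_norm N -> ultra_cauchy (@nrm R R[i]^o) f -> ultra_cauchy N (fun i => f i *: x).
Proof.
move=> hN hf e e0; have N1 : 0 < N x + 1 by rewrite ltr_wpDl ?(norm_ge0 hN).
have [A FA hA] := hf _ (divr_gt0 e0 N1); exists A => // i j Ai Aj.
rewrite -scalerBl (norm_scale hN).
rewrite (@le_lt_trans _ _ (nrm (f i - f j) * (N x + 1)))//.
  by rewrite ler_wpM2l ?nrm_ge0// lerDl.
by rewrite -ltr_pdivlMr// hA.
Qed.

Lemma ultra_cauchy_real (r : nat -> R) (B : R) : (forall i, `|r i| <= B) ->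
  forall e : R, 0 < e -> exists2 A, F A & forall i j, A i -> A j -> `|r i - r j| < e.
Proof.
move=> rB e e0.
have PF : ProperFilter (r @ F) by exact: fmap_proper_filter.
have [|l [_ cl]] := @segment_compact R (- B) B (r @ F) PF.
  have -> : (r @ F) [set` `[(- B), B]] = F setT; last exact: filterT.
  congr F; apply/seteqP; split=> // i _ /=.
  by rewrite in_itv/= -ler_norml.
have e2 : 0 < e / 2 by rewrite divr_gt0.
pose A := [set i | `|l - r i| < e / 2].
exists A => [|i j]; last first.
  rewrite /A/= => Ai Aj.
  have -> : r i - r j = (l - r j) - (l - r i) by rewrite opprB [RHS]addrC [RHS]addrA subrK.
  by rewrite (le_lt_trans (ler_normB _ _))// [ltRHS](splitr e) ltrD.
(* If the complement of [A] belonged to the ultrafilter, [l] would not be a cluster point. *)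
have [//|FnA] := in_ultra_setVsetC A FU.
pose B0 := [set y : R | `|l - y| < e / 2].
have nl : nbhs (l : R^o) B0 by apply/nbhs_ballP; exists (e / 2).
by have [x [h1 h2]] := cl (~` B0) B0 FnA nl.
Qed.

Lemma ultra_cauchy_bounded (f : nat -> R[i]^o) (B : R) : (forall i, nrm (f i) <= B) ->
  ultra_cauchy (@nrm R R[i]^o) f.
Proof.
move=> fB e e0; have e2 : 0 < e / 2 by rewrite divr_gt0.
have reim (z : R[i]) : `|complex.Re z| <= ab z /\ `|complex.Im z| <= ab z.
  case: z => x y; have -> : ab (x +i* y) = Num.sqrt (x ^+ 2 + y ^+ 2).
    by apply: (@complexI R); rewrite abE normc_def.
  by split; rewrite -sqrtr_sqr ler_wsqrtr//= ?lerDl ?lerDr sqr_ge0.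
have [i|A FA hA] := @ultra_cauchy_real (fun i => complex.Re (f i)) B _ _ e2.
  by rewrite (le_trans (reim _).1).
have [i|A' FA' hA'] := @ultra_cauchy_real (fun i => complex.Im (f i)) B _ _ e2.
  by rewrite (le_trans (reim _).2).
exists (A `&` A') => [|i j [Ai Bi] [Aj Bj]]; first exact: filterI.
have := hA i j Ai Aj; have := hA' i j Bi Bj.
case: (f i) (f j) => [a b] [c d] /= h1 h2.
have -> : ((a +i* b) - (c +i* d) : R[i]^o) = ((a - c) +i* 0) + (0 +i* (b - d)) :> R[i].
  by simpc.
rewrite (le_lt_trans (norm_tri (nrm_is_norm R[i]^o) _ _))// [ltRHS](splitr e) ltrD//.
  by rewrite ab_real.
have -> : 0 +i* (b - d) = 'i * (b - d)%:C :> R[i] by simpc.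
rewrite abM ab_real (_ : ab 'i = 1) ?mul1r//.
by apply: (@complexI R); rewrite abE normc_def/= expr0n expr1n/= add0r sqrtr1.
Qed.

End Ultra.

Section Compact.
Variables (R : realType) (H : hilbertType R).
Local Notation N := (@nrm R H).
Let hN := nrm_is_norm H.

Variables (C C' : H -> H) (M : R).
Hypotheses (Cl : forall c x y, C (c *: x + y) = c *: C x + C y)
  (CM : forall x, N (C x) <= M * N x)
  (C'l : forall c x y, C' (c *: x + y) = c *: C' x + C' y)
  (adj : forall x y, dot (C x) y = dot x (C' y))
  (Ccpt : forall e : R, 0 < e -> exists n (p x : 'I_n -> H), forall xi,
     N (C xi - \sum_i dot xi (p i) *: x i) <= e * N xi).

Let linB (D : H -> H) : (forall c x y, D (c *: x + y) = c *: D x + D y) ->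
  forall x y, D (x - y) = D x - D y.
Proof.
by move=> Dl x y; have := Dl (-1) y x; rewrite !scaleN1r addrC => ->; rewrite addrC.
Qed.

Let linZ (D : H -> H) : (forall c x y, D (c *: x + y) = c *: D x + D y) ->
  forall c x, D (c *: x) = c *: D x.
Proof.
move=> Dl c x; have D0 : D 0 = 0.
  by have := Dl (-1) 0 0; rewrite scaler0 add0r scaleN1r addNr.
by have := Dl c x 0; rewrite !addr0 D0 addr0.
Qed.

(* A maximizing sequence for [|C xi|] on the unit ball of [W] satisfies
   [F xi_n - l xi_n --> 0] for [F = C' C], and [C xi_n] is Cauchy along an
   ultrafilter, hence so is [xi_n]. *)
Lemma compact_eigenvector (W : set H) :
  (forall c x y, W x -> W y -> W (c *: x + y)) ->
  (forall x, (forall e : R, 0 < e -> exists2 y, W y & N (x - y) < e) -> W x) ->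
  (forall x, W x -> W (C' (C x))) -> (exists2 x, W x & C x != 0) ->
  exists x (l : R), [/\ W x, x != 0, 0 < l & C' (C x) = l%:C *: x].
Proof.
move=> Wl Wc WF [x0 Wx0 Cx0].
have W0 : W 0 by have := Wl (-1) _ _ Wx0 Wx0; rewrite scaleN1r addNr.
have WZ c x : W x -> W (c *: x) by move=> Wx; rewrite -[_ *: _]addr0; exact: Wl.
pose D := [set N (C x) | x in [set x | W x /\ N x <= 1]].
have C0 : C 0 = 0 by rewrite -{1}(scale0r (0 : H)) (linZ Cl) scale0r.
have M0 : 0 <= M.
  have x00 : x0 != 0 by apply: contra_neq Cx0 => ->.
  have nx0 : 0 < N x0.
    by rewrite lt_neqAle nrm_ge0 andbT eq_sym; apply: contra_neq x00 => /nrm0_eq0.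
  by rewrite -(pmulr_lge0 _ nx0) (le_trans (nrm_ge0 _) (CM _)).
have hD : has_sup D.
  split; first by exists 0, 0; [split; rewrite ?nrm0|rewrite C0 nrm0].
  exists M => _ [x [_ x1] <-]; rewrite (le_trans (CM _))// ler_piMr//.
pose m := sup D.
have Dm x : W x -> N x <= 1 -> N (C x) <= m.
  by move=> Wx x1; apply: ub_le_sup; [case: hD|exists x].
have ab_inv (x : H) : x != 0 -> N (((N x)^-1)%:C *: x) = 1 /\ 0 < N x.
  move=> x_0; have nx : 0 < N x.
    by rewrite lt_neqAle nrm_ge0 andbT eq_sym; apply: contra_neq x_0 => /nrm0_eq0.
  by rewrite nrmZ ab_real ger0_norm ?invr_ge0 ?(ltW nx)// mulVf// gt_eqF.
have mP x : W x -> N (C x) <= m * N x.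
  have [->|x_0] := eqVneq x 0; first by rewrite C0 !nrm0 mulr0.
  have [n1 n0] := ab_inv _ x_0 => Wx.
  have := Dm _ (WZ ((N x)^-1)%:C _ Wx); rewrite n1 lexx => /(_ isT).
  rewrite (linZ Cl) nrmZ ab_real ger0_norm ?invr_ge0 ?(ltW n0)//.
  by rewrite mulrC ler_pdivrMr.
have m0 : 0 < m.
  have x00 : x0 != 0 by apply: contra_neq Cx0 => ->.
  have [n1 n0] := ab_inv _ x00.
  rewrite -(pmulr_lgt0 _ n0) (lt_le_trans _ (mP _ Wx0))//.
  by rewrite lt_neqAle nrm_ge0 andbT eq_sym; apply: contra_neq Cx0 => /nrm0_eq0.
have /choice[xi xiP] : forall n : nat, exists x, [/\ W x, N x <= 1 & m - n.+1%:R^-1 < N (C x)].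
  move=> n; have n0 : (0 : R) < n.+1%:R^-1 by rewrite invr_gt0.
  by have [_ [x [Wx x1] <-] xd] := sup_adherent n0 hD; exists x.
(* As [m] bounds [C] on [W] only, the stability of [W] under C' C enters here: |C' C x|^2 = <C (C' C
   x), C x>. *)
have FC x : W x -> N (C' (C x)) <= m * N (C x).
  move=> Wx; have [E|Fx0] := eqVneq (C' (C x)) 0.
    by rewrite E nrm0 mulr_ge0 ?nrm_ge0 ?(ltW m0).
  have [_ n0] := ab_inv _ Fx0.
  rewrite -(ler_pM2r n0) -expr2.
  have -> : N (C' (C x)) ^+ 2 = ab (dot (C' (C x)) (C' (C x))).
    by rewrite dotxx ab_real ger0_norm// sqr_ge0.
  rewrite -adj (le_trans (ab_dot _ _))// mulrAC ler_wpM2r ?nrm_ge0//.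
  by apply: mP; exact: WF.
have [l lE] : exists l : R, l = m ^+ 2 by exists (m ^+ 2).
have l0 : 0 < l by rewrite lE exprn_gt0.
(* The square expands to |C' C x|^2 - 2 l |C x|^2 + l^2 |x|^2, where l = m^2 and |C' C x| <= m |C
   x|. *)
have Fl x : W x -> N x <= 1 -> N (C' (C x) - l%:C *: x) ^+ 2 <= l * (l - N (C x) ^+ 2).
  move=> Wx x1; rewrite nrmB2 dotZr conj_real.
  have -> : dot (C' (C x)) x = (N (C x) ^+ 2)%:C.
    by rewrite dotC -adj -dotC dotxx.
  rewrite -rmorphM/= nrmZ ab_real ger0_norm ?(ltW l0)//.
  have h1 : N (C' (C x)) ^+ 2 <= l * N (C x) ^+ 2.
    by rewrite lE -exprMn ler_sqr ?nnegrE ?mulr_ge0 ?nrm_ge0 ?(ltW m0)// FC.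
  have h2 : (l * N x) ^+ 2 <= l ^+ 2.
    have lx : l * N x <= l by rewrite ler_piMr// ltW.
    by apply: lerXn2r; rewrite ?nnegrE ?mulr_ge0 ?nrm_ge0 ?(ltW l0).
  lra.
have small e : 0 < e -> exists k, forall n, (k <= n)%N -> N (C' (C (xi n)) - l%:C *: xi n) < e.
  move=> e0.
  have B0 : 0 < 2 * m * l by rewrite !mulr_gt0.
  have [k kP] := invS_lt (divr_gt0 (exprn_gt0 2 e0) B0).
  exists k => n kn; have [Wx x1 xm] := xiP n.
  rewrite -(@ltr_pXn2r _ 2)// ?nnegrE ?nrm_ge0 ?(ltW e0)//.
  rewrite (le_lt_trans (Fl _ Wx x1))//.
  have := kP n kn; rewrite ltr_pdivlMr//; set d := n.+1%:R^-1 => hd.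
  have d0 : 0 <= d by rewrite invr_ge0.
  rewrite (le_lt_trans _ hd)//.
  have hh : m - d <= N (C (xi n)) by rewrite ltW.
  have h3 : l - N (C (xi n)) ^+ 2 <= 2 * m * d.
    have hC := mP _ Wx; have hC2 : N (C (xi n)) <= m by rewrite Dm.
    have := nrm_ge0 (C (xi n)); rewrite lE; nra.
  have -> : d * (2 * m * l) = l * (2 * m * d) by ring.
  by rewrite ler_wpM2l// ltW.
have [F [FU Foo]] := @ultraFilterLemma nat \oo _.
have Cuc : ultra_cauchy F N (fun i => C (xi i)).
  move=> e e0; have e4 : 0 < e / 4 by rewrite divr_gt0.
  have [n [p [x px]]] := Ccpt e4.
  have : ultra_cauchy F N (fun i => \sum_k dot (xi i) (p k) *: x k).
    elim: (index_enum _) => [|k r IH].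
      have -> : (fun i => \sum_(k <- [::]) dot (xi i) (p k) *: x k) = fun=> 0.
        by apply/funext => i; rewrite big_nil.
      exact: ultra_cauchy_cst.
    have -> : (fun i => \sum_(j <- k :: r) dot (xi i) (p j) *: x j) =
        fun i => dot (xi i) (p k) *: x k + \sum_(j <- r) dot (xi i) (p j) *: x j.
      by apply/funext => i; rewrite big_cons.
    apply: ultra_cauchyD => //; apply: ultra_cauchy_scale => //.
    apply: (@ultra_cauchy_bounded _ _ _ _ (N (p k))) => i.
    have [_ x1 _] := xiP i.
    by rewrite (le_trans (ab_dot _ _))// ler_piMl ?nrm_ge0.
  move=> /(_ _ e4) [A FA hA]; exists A => // i j Ai Aj.
  have hi := px (xi i); have hj := px (xi j); have hij := hA i j Ai Aj.
  have [_ xi1 _] := xiP i; have [_ xj1 _] := xiP j.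
  have hi' := le_trans hi (ler_wpM2l (ltW e4) xi1).
  have hj' := le_trans hj (ler_wpM2l (ltW e4) xj1).
  set a := C (xi i) in hi' *; set b := C (xi j) in hj' *.
  set a' := \sum_k _ in hi' hij; set b' := \sum_k _ in hj' hij.
  have h1 := norm_tri3 hN a' a b; have h2 := norm_tri3 hN b' a' b.
  rewrite (normB hN b') in h2; lra.
have xuc : ultra_cauchy F N xi.
  move=> e e0.
  have K0 : 0 < 3 / l by rewrite divr_gt0.
  pose e' := e / (3 / l); have e'0 : 0 < e' by rewrite divr_gt0.
  have [k kP] := small _ e'0.
  have [A FA hA] := Cuc _ (divr_gt0 e'0 (ltr_wpDl (ltW m0) ltr01)).
  exists (A `&` [set n | (k <= n)%N]) => [|i j [Ai ki] [Aj kj]].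
    by apply: filterI => //; apply: Foo; exists k.
  have h1 := kP i ki; have h2 := kP j kj.
  have [Wi _ _] := xiP i; have [Wj _ _] := xiP j.
  have Wij : W (xi i - xi j) by rewrite -scaleN1r addrC; apply: Wl.
  have h3 := FC _ Wij; rewrite (linB Cl) in h3.
  have h4 := hA i j Ai Aj.
  rewrite ltr_pdivlMr ?ltr_wpDl// ?(ltW m0)// in h4.
  have h5 : m * N (C (xi i) - C (xi j)) <= e'.
    by rewrite (le_trans _ (ltW h4))// mulrC ler_wpM2l ?nrm_ge0// lerDl.
  have h6 := le_trans h3 h5; rewrite (linB C'l) in h6.
  have h7 : N (l%:C *: (xi i - xi j)) < 3 * e'.
    rewrite scalerBr.
    have g1 := norm_tri3 hN (C' (C (xi i))) (l%:C *: xi i) (l%:C *: xi j).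
    have g2 := norm_tri3 hN (C' (C (xi j))) (C' (C (xi i))) (l%:C *: xi j).
    rewrite (normB hN (l%:C *: xi i) (C' _)) in g1; lra.
  move: h7; rewrite nrmZ ab_real ger0_norm ?(ltW l0)// => h7.
  rewrite -(ltr_pM2l l0) (lt_le_trans h7)// /e' le_eqVlt; apply/orP; left.
  by apply/eqP; field; rewrite gt_eqF.
have : cvg (xi @ F).
  apply: cauchy_cvg; apply/cauchy_ballP => -[e ei] e0.
  have ei0 : ei = 0 by move: e0; rewrite ltcE/= => /andP[/eqP].
  subst ei; rewrite ltcR in e0.
  have [A FA hA] := xuc _ e0.
  have FxA : F (xi @^-1` (xi @` A)) by apply: filterS FA => n An; exists n.
  exists (xi @` A, xi @` A) => //.
  move=> -[_ _] [/= [i Ai <-] [j Aj <-]].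
  by rewrite -ball_normE/= nrmE ltcR hA.
move=> /cvg_ex[x xix].
have near e : 0 < e -> exists i, [/\ N (x - xi i) < e, N (C' (C (xi i)) - l%:C *: xi i) < e & m - e < N (C (xi i))].
  move=> e0; have e0' : (0 : R[i]) < e%:C by rewrite ltcR.
  have [k kP] := small _ e0; have [k' k'P] := invS_lt e0.
  have h1 : F [set i | N (x - xi i) < e].
    have hF : F (xi @^-1` ball x e%:C) by exact: (xix _ (nbhsx_ballx x _ e0')).
    by apply: filterS hF => i /=; rewrite -ball_normE/= nrmE ltcR.
  have h2 : F [set n | (maxn k k' <= n)%N] by apply: Foo; exists (maxn k k').
  have [i [/= xi1 ki]] := filter_ex (filterI h1 h2).
  exists i; split=> //; first by rewrite kP// (leq_trans (leq_maxl _ _) ki).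
  have [_ _ h] := xiP i; rewrite (le_lt_trans _ h)// lerD2l lerN2 ltW//.
  by rewrite k'P// (leq_trans (leq_maxr _ _) ki).
exists x, l; split=> //.
- by apply: Wc => e e0; have [i [h _ _]] := near e e0; exists (xi i) => //; case: (xiP i).
(* If the limit were 0, the bound |C xi_n| <= M |xi_n| would make |C xi_n| small, although it
   approaches m > 0. *)
- apply/eqP => x00; have m2 : 0 < m / 2 by rewrite divr_gt0.
  have e0 : 0 < m / 2 / (M + 1) by rewrite divr_gt0// ltr_wpDl.
  pose e := Num.min (m / 2) (m / 2 / (M + 1)).
  have e1 : 0 < e by rewrite lt_min m2.
  have [i [h1 _ h2]] := near e e1; rewrite x00 sub0r (normN hN) in h1.
  have h3 := CM (xi i).
  have h4 : M * N (xi i) <= m / 2.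
    rewrite (@le_trans _ _ ((M + 1) * N (xi i)))//.
      by rewrite ler_wpM2r ?nrm_ge0// lerDl.
    rewrite -ler_pdivlMl ?ltr_wpDl// mulrC ltW// (lt_le_trans h1)//.
    by rewrite ge_min lexx orbT.
  have h5 : e <= m / 2 by rewrite ge_min lexx.
  have := lt_le_trans h2 (le_trans h3 h4); rewrite ltrBlDr => h6.
  by have := lt_le_trans h6 (lerD (lexx (m / 2)) h5); rewrite -splitr ltxx.
- apply: (norm_eq hN) => e e0.
  (* [K] adds up the coefficients of three errors: m M for C' C (x - xi_i), 1 for the defect at
     xi_i, and l for l (x - xi_i). *)
  pose K := m * M + 1 + l.
  have mM : 0 <= m * M by rewrite mulr_ge0// ltW.
  have K0 : 0 < K by rewrite /K; lra.
  have [i [h1 h2 _]] := near _ (divr_gt0 e0 K0).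
  have Wx : W x by apply: Wc => d d0; have [k [hk _ _]] := near d d0; exists (xi k) => //; case: (xiP k).
  have [Wi _ _] := xiP i.
  have Wd : W (x - xi i) by rewrite -scaleN1r addrC; exact: Wl.
  have h3 := le_trans (FC _ Wd) (ler_wpM2l (ltW m0) (CM _)).
  have -> : C' (C x) - l%:C *: x = C' (C (x - xi i)) + (C' (C (xi i)) - l%:C *: xi i) - l%:C *: (x - xi i).
    rewrite (linB Cl) (linB C'l) scalerBr addrA subrK opprB addrA subrK.
    by [].
  rewrite (le_trans (norm_tri hN _ _))// (normN hN) nrmZ ab_real ger0_norm ?(ltW l0)//.
  have h4 := norm_tri hN (C' (C (x - xi i))) (C' (C (xi i)) - l%:C *: xi i).
  have -> : e = K * (e / K) by field; rewrite gt_eqF.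
  set d := e / K in h1 h2 *.
  have h5 : m * (M * N (x - xi i)) <= m * M * d by rewrite mulrA ler_wpM2l// ltW.
  have h6 : l * N (x - xi i) <= l * d by rewrite ler_wpM2l ?(ltW l0)// ltW.
  rewrite /K; lra.
Qed.

(** An eigenvector satisfies |C x|^2 = l |x|^2, so an operator of finite rank within sqrt(l) / 2 of
    C cannot annihilate it unless x = 0. Finite dimension is thus expressed as separation by
    finitely many functionals, the form expected by [fin_orthonormal_basis]. *)
Lemma eigenspace_separated (l : R) : 0 < l ->
  exists n (p : 'I_n -> H), forall x, C' (C x) = l%:C *: x ->
    (forall i, dot x (p i) = 0) -> x = 0.
Proof.
move=> l0.
pose e := Num.sqrt l / 2.
have sl0 : 0 < Num.sqrt l by rewrite sqrtr_gt0.
have e0 : 0 < e by rewrite divr_gt0.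
have [n [p [y py]]] := Ccpt e0; exists n, p => x Fx px.
have := py x; rewrite big1 ?subr0 => [|i _]; last by rewrite px scale0r.
move=> h; have [//|x0] := eqVneq x 0.
have nx : 0 < N x.
  by rewrite lt_neqAle nrm_ge0 andbT eq_sym; apply: contra_neq x0 => /nrm0_eq0.
have : N (C x) ^+ 2 = l * N x ^+ 2.
  apply: (@complexI R).
  by rewrite -dotxx adj Fx dotZr conj_real dotxx -rmorphM.
have : N (C x) ^+ 2 <= (e * N x) ^+ 2.
  by rewrite ler_sqr ?nnegrE ?mulr_ge0 ?nrm_ge0 ?(ltW e0).
rewrite exprMn => h1 h2; rewrite h2 ler_pM2r ?exprn_gt0// in h1.
by move: h1; rewrite /e exprMn sqr_sqrtr ?(ltW l0)// => h1; exfalso; lra.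
Qed.

End Compact.

(** * Orthonormal bases and complements of eigenspaces *)

Section Orthonormal.
Variables (R : realType) (H : hilbertType R).

(** By a rank count, an orthonormal family of more than n vectors has a nonzero combination
    annihilated by all <., p i>, which is impossible. Lengths are therefore bounded, and a family of
    maximal length is a basis. *)
Lemma fin_orthonormal_basis (K : set H) :
  (forall c x y, K x -> K y -> K (c *: x + y)) -> K 0 ->
  (exists n (p : 'I_n -> H), forall x, K x -> (forall i, dot x (p i) = 0) -> x = 0) ->
  exists m (e : 'I_m -> H), [/\ forall i, K (e i),
    forall i j, dot (e i) (e j) = (i == j)%:R &
    forall x, K x -> x = \sum_i dot x (e i) *: e i].
Proof.
move=> Kl K0 [n [p pP]].
have KZ c x : K x -> K (c *: x) by move=> Kx; rewrite -[_ *: _]addr0; exact: Kl.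
have Ksum m (c : 'I_m -> R[i]) (e : 'I_m -> H) : (forall i, K (e i)) ->
    K (\sum_i c i *: e i).
  by move=> Ke; apply: (big_ind K) => // [x y Kx Ky|i _]; [rewrite -[x]scale1r; exact: Kl|exact: KZ].
pose Q m := `[< exists e : 'I_m -> H, (forall i, K (e i)) /\
  forall i j, dot (e i) (e j) = (i == j)%:R >].
have onc m (e : 'I_m -> H) (c : 'I_m -> R[i]) j :
    (forall i j, dot (e i) (e j) = (i == j)%:R) ->
    dot (\sum_i c i *: e i) (e j) = c j.
  move=> on; rewrite dot_suml (bigD1 j)//= dotZl on eqxx mulr1 big1 ?addr0//.
  by move=> i ij; rewrite dotZl on (negbTE ij) mulr0.
have Qn m : Q m -> (m <= n)%N.
  move=> /asboolP[e [Ke on]]; rewrite leqNgt; apply/negP => nm.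
  pose A : 'M[R[i]]_(m, n) := \matrix_(i, k) dot (e i) (p k).
  have : kermx A != 0.
    rewrite -mxrank_eq0 mxrank_ker -lt0n subn_gt0.
    by rewrite (leq_ltn_trans (rank_leq_col A)).
  move=> /rowV0Pn[v /sub_kermxP vA v0].
  move: v0 => /eqP; apply; apply/rowP => j; rewrite mxE.
  pose x := \sum_i v 0 i *: e i.
  have x0 : x = 0.
    apply: pP; first exact: Ksum.
    move=> k; have E : \sum_i v 0 i * A i k = 0.
      by have := congr1 (fun B : 'rV_n => B 0 k) vA; rewrite [LHS]mxE [RHS]mxE.
    by rewrite dot_suml -[RHS]E; apply: eq_bigr => i _; rewrite mxE dotZl.
  by rewrite -(onc _ e (v 0) j on) -/x x0 dot0l.
have Q0 : exists m, Q m.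
  exists 0%N; apply/asboolP; exists (fun=> 0); split; first by [].
  by case.
have [m Qm mmax] := ex_maxnP Q0 Qn.
move: (Qm) => /asboolP[e [Ke on]].
exists m, e; split=> // x Kx.
apply/eqP; rewrite -subr_eq0; apply/eqP.
set z := x - _.
have [//|z0] := eqVneq z 0.
have Kz : K z by rewrite /z -scaleN1r addrC; apply: Kl => //; exact: Ksum.
have ze j : dot z (e j) = 0 by rewrite dotBl onc// subrr.
have nz : 0 < nrm z.
  by rewrite lt_neqAle nrm_ge0 andbT eq_sym; apply: contra_neq z0 => /nrm0_eq0.
pose w := ((nrm z)^-1)%:C *: z.
have we j : dot w (e j) = 0 by rewrite dotZl ze mulr0.
have ww : dot w w = 1.
  rewrite dotxx nrmZ ab_real ger0_norm ?invr_ge0 ?(ltW nz)// mulVf ?gt_eqF//.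
  by rewrite expr1n.
suff : Q m.+1 by move=> /mmax; rewrite ltnn.
apply/asboolP; exists (fun i => if unlift ord0 i is Some j then e j else w); split.
  by move=> i; case: (unlift ord0 i) => [j|]; [exact: Ke|exact: KZ].
move=> i j.
case: (unliftP ord0 i) => [i'|] ->; case: (unliftP ord0 j) => [j'|] ->.
- by rewrite on (inj_eq lift_inj).
- rewrite dotC we conjC0 [RHS](_ : _ = 0)//.
- by rewrite we.
- by rewrite ww eqxx.
Qed.

(** The component of eta orthogonal to the range of F - l is an eigenvector by self-adjointness. It
    is then orthogonal to eta as well as to the closure of the range, so it vanishes. *)
Lemma range_dense_orth (F : H -> H) (l : R) :
  (forall c x y, F (c *: x + y) = c *: F x + F y) ->
  (forall x y, dot (F x) y = dot x (F y)) ->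
  forall eta, (forall x, F x = l%:C *: x -> dot eta x = 0) ->
  forall e : R, 0 < e -> exists y, nrm (eta - (F y - l%:C *: y)) < e.
Proof.
move=> Fl Fs eta eo.
have [||m [mc mo]] := @projection R H [set z | exists y, z = F y - l%:C *: y] _ _ eta.
- exists 0; have F0 : F 0 = 0.
    by have := Fl (-1) 0 0; rewrite scaler0 add0r scaleN1r addNr.
  by rewrite F0 scaler0 subrr.
- move=> c _ _ [y ->] [z ->]; exists (c *: y + z).
  by rewrite Fl (scalerDr l%:C) opprD addrACA scalerBr !scalerA (mulrC c).
have Kd : F (eta - m) = l%:C *: (eta - m).
  apply: dot_extl => z; rewrite Fs dotZl.
  have := mo (F z - l%:C *: z) (ex_intro _ z erefl).
  by rewrite dotBr dotZr conj_real => /eqP; rewrite subr_eq0 => /eqP.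
have : dot (eta - m) (eta - m) = 0.
  rewrite dotBl (eo _ Kd) sub0r.
  suff -> : dot m (eta - m) = 0 by rewrite oppr0.
  rewrite dotC (_ : dot (eta - m) m = 0) ?conjC0//.
  apply: (norm_small (nrm_is_norm R[i]^o)) => e e0.
  have K0 : 0 < nrm (eta - m) + 1 by rewrite ltr_wpDl ?nrm_ge0.
  have [y My my] := mc _ (divr_gt0 e0 K0).
  have -> : dot (eta - m) m = dot (eta - m) (m - y) by rewrite dotBr (mo _ My) subr0.
  rewrite (le_trans (ab_dot _ _))//.
  rewrite (@le_trans _ _ ((nrm (eta - m) + 1) * nrm (m - y)))//.
    by rewrite ler_wpM2r ?nrm_ge0// lerDl.
  by rewrite -ler_pdivlMl// mulrC ltW.
move=> /dotxx_eq0/eqP; rewrite subr_eq0 => /eqP -> e e0.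
by have [_ [y ->] my] := mc e e0; exists y.
Qed.

End Orthonormal.

(** * Unitary representations and orthogonality relations *)

Section MatrixStar.
Variables (R : realType) (A : cstarType R).
Implicit Types c : R[i].

Definition adjmx m n (v : 'M[A]_(m, n)) : 'M[A]_(n, m) := (map_mx star v)^T.
Definition scmx m n (T : 'M[R[i]]_(m, n)) : 'M[A]_(m, n) := map_mx (in_alg A) T.

Lemma adjmxE m n (v : 'M[A]_(m, n)) i j : adjmx v i j = star (v j i).
Proof. by rewrite !mxE. Qed.

Lemma scmxE m n (T : 'M[R[i]]_(m, n)) i j : scmx T i j = (T i j)%:A.
Proof. by rewrite mxE. Qed.

Lemma adjmxM m n p (v : 'M[A]_(m, n)) (w : 'M[A]_(n, p)) :
  adjmx (v *m w) = adjmx w *m adjmx v.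
Proof.
apply/matrixP => i j; rewrite !mxE star_sum; apply: eq_bigr => k _.
by rewrite !mxE starM.
Qed.

Lemma adj_scmx m n (T : 'M[R[i]]_(m, n)) : adjmx (scmx T) = scmx (T ^t*)%sesqui.
Proof. by apply/matrixP => i j; rewrite !mxE starZ star1. Qed.

Lemma scmxM m n p (T : 'M[R[i]]_(m, n)) (S : 'M[R[i]]_(n, p)) :
  scmx (T *m S) = scmx T *m scmx S.
Proof. exact: map_mxM. Qed.

Lemma scmx1 n : scmx (1%:M : 'M[R[i]]_n) = 1%:M.
Proof. by rewrite /scmx map_scalar_mx rmorph1. Qed.

Lemma conj_entry m n (T T' : 'M[R[i]]_(m, n)) (v : 'M[A]_n) i j :
  (scmx T *m v *m scmx (T' ^t*)%sesqui) i j =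
  \sum_k \sum_l (T i k * Num.conj (T' j l)) *: v k l.
Proof.
rewrite mxE exchange_big; apply: eq_bigr => l _; rewrite !mxE mulr_suml.
apply: eq_bigr => k _; rewrite !mxE -scalerAr mulr1 -scalerAl mul1r scalerA.
by rewrite mulrC.
Qed.

End MatrixStar.

Section Reps.
Variables (R : realType) (G : compact_quantum_group R).
Local Notation AA := (CG2 G).
Local Notation t := (@tens R G).
Let tP : min_tensor t := tensP G.

Definition tmul m n p (v : 'M[G]_(m, n)) (w : 'M[G]_(n, p)) : 'M[AA]_(m, p) :=
  \matrix_(i, j) \sum_k t (v i k) (w k j).

Lemma tens_suml n (c : 'I_n -> R[i]) (s : 'I_n -> G) b :
  t (\sum_i c i *: s i) b = \sum_i c i *: t (s i) b.
Proof.
elim: n c s => [|n IH] c s; first by rewrite !big_ord0 (tens0l tP).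
by rewrite !big_ord_recl (tensDl tP) IH.
Qed.

Lemma tens_sumr n (c : 'I_n -> R[i]) (s : 'I_n -> G) b :
  t b (\sum_i c i *: s i) = \sum_i c i *: t b (s i).
Proof.
elim: n c s => [|n IH] c s; first by rewrite !big_ord0 (tens0r tP).
by rewrite !big_ord_recl (tensDr tP) IH.
Qed.

Lemma scmx_mull (B : cstarType R) m n p (T : 'M[R[i]]_(m, n)) (v : 'M[B]_(n, p)) i j :
  (scmx B T *m v) i j = \sum_k T i k *: v k j.
Proof. by rewrite mxE; apply: eq_bigr => k _; rewrite mxE -scalerAl mul1r. Qed.

Lemma scmx_mulr (B : cstarType R) m n p (T : 'M[R[i]]_(n, p)) (v : 'M[B]_(m, n)) i j :
  (v *m scmx B T) i j = \sum_k T k j *: v i k.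
Proof. by rewrite mxE; apply: eq_bigr => k _; rewrite mxE -scalerAr mulr1. Qed.

Lemma tmul_scl m n p q (T : 'M[R[i]]_(m, n)) (v : 'M[G]_(n, p)) (w : 'M[G]_(p, q)) :
  tmul (scmx G T *m v) w = scmx AA T *m tmul v w.
Proof.
apply/matrixP => i j; rewrite scmx_mull mxE.
under eq_bigr => k _ do rewrite scmx_mull tens_suml.
rewrite exchange_big; apply: eq_bigr => k _; rewrite mxE scaler_sumr.
by [].
Qed.

Lemma tmul_scr m n p q (T : 'M[R[i]]_(p, q)) (v : 'M[G]_(m, n)) (w : 'M[G]_(n, p)) :
  tmul v (w *m scmx G T) = tmul v w *m scmx AA T.
Proof.
apply/matrixP => i j; rewrite scmx_mulr mxE.
under eq_bigr => k _ do rewrite scmx_mulr tens_sumr.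
rewrite exchange_big; apply: eq_bigr => k _; rewrite mxE scaler_sumr.
by [].
Qed.

Lemma tmul_scm m n p q (T : 'M[R[i]]_(n, p)) (v : 'M[G]_(m, n)) (w : 'M[G]_(p, q)) :
  tmul (v *m scmx G T) w = tmul v (scmx G T *m w).
Proof.
apply/matrixP => i j; rewrite !mxE.
under eq_bigr => k _ do rewrite scmx_mulr tens_suml.
rewrite exchange_big; apply: eq_bigr => k _; rewrite scmx_mull tens_sumr.
by [].
Qed.

Lemma comul_scmx m n p q (T : 'M[R[i]]_(m, n)) (v : 'M[G]_(n, p)) (S : 'M[R[i]]_(p, q)) :
  map_mx (comul G) (scmx G T *m v *m scmx G S) =
  scmx AA T *m map_mx (comul G) v *m scmx AA S.
Proof.
rewrite !map_mxM; congr (_ *m _ *m _); apply/matrixP => i j; rewrite !mxE;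
  exact: rmorph_alg.
Qed.

Lemma unitary_repE n (v : 'M[G]_n) : unitary_rep v <->
  [/\ v *m adjmx v = 1%:M, adjmx v *m v = 1%:M & map_mx (comul G) v = tmul v v].
Proof.
split=> -[h1 h2 h3]; split=> //.
  by apply/matrixP => i j; rewrite !mxE h3.
by move=> i j; have := congr1 (fun M : 'M[AA]_n => M i j) h3; rewrite !mxE.
Qed.

Lemma unitary_rep_conj n (T : 'M[R[i]]_n) (v : 'M[G]_n) :
  T *m (T ^t*)%sesqui = 1%:M -> unitary_rep v ->
  unitary_rep (scmx G T *m v *m scmx G (T ^t*)%sesqui).
Proof.
move=> TT; have T'T := mulmx1C TT; move=> /unitary_repE[h1 h2 h3].
have sTT : scmx G T *m scmx G (T ^t*)%sesqui = 1%:M by rewrite -scmxM TT scmx1.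
have sT'T : scmx G (T ^t*)%sesqui *m scmx G T = 1%:M by rewrite -scmxM T'T scmx1.
apply/unitary_repE; split.
- rewrite !adjmxM !adj_scmx trmxCK !mulmxA -(mulmxA _ _ (scmx G T)) sT'T mulmx1.
  by rewrite -(mulmxA _ v) h1 mulmx1.
- rewrite !adjmxM !adj_scmx trmxCK !mulmxA -(mulmxA _ _ (scmx G T)) sT'T mulmx1.
  by rewrite -(mulmxA _ _ v) h2 mulmx1.
- rewrite comul_scmx h3 -tmul_scl -tmul_scr [RHS]tmul_scm !mulmxA sT'T.
  by rewrite mul1mx.
Qed.

Lemma intertwinerE m n (v : 'M[G]_m) (w : 'M[G]_n) (T : 'M[R[i]]_(m, n)) :
  intertwiner v w T = (v *m scmx G T = scmx G T *m w).
Proof. by []. Qed.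

Lemma intertwiner_adj m n (v : 'M[G]_m) (w : 'M[G]_n) (T : 'M[R[i]]_(m, n)) :
  unitary_rep v -> unitary_rep w -> intertwiner v w T ->
  intertwiner w v (T ^t*)%sesqui.
Proof.
move=> /unitary_repE[v1 v2 _] /unitary_repE[w1 w2 _].
rewrite !intertwinerE => E.
have := congr1 (@adjmx R G m n) E; rewrite !adjmxM adj_scmx => E'.
have : w *m (scmx G (T ^t*)%sesqui *m adjmx v) *m v =
       w *m (adjmx w *m scmx G (T ^t*)%sesqui) *m v by rewrite E'.
by rewrite !mulmxA w1 mul1mx -!mulmxA v2 mulmx1 => ->.
Qed.

Lemma intertwiner_comp m n p (u : 'M[G]_m) (v : 'M[G]_n) (w : 'M[G]_p)
    (T : 'M[R[i]]_(m, n)) (S : 'M[R[i]]_(n, p)) :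
  intertwiner u v T -> intertwiner v w S -> intertwiner u w (T *m S).
Proof.
rewrite !intertwinerE => E1 E2.
by rewrite scmxM mulmxA E1 -mulmxA E2 mulmxA.
Qed.

Lemma intertwinerD m n (v : 'M[G]_m) (w : 'M[G]_n) (T S : 'M[R[i]]_(m, n)) c :
  intertwiner v w T -> intertwiner v w S -> intertwiner v w (c *: T + S).
Proof.
rewrite !intertwinerE => E1 E2; apply/matrixP => i j.
have e1 := congr1 (fun M : 'M[G]_(m, n) => M i j) E1.
have e2 := congr1 (fun M : 'M[G]_(m, n) => M i j) E2.
rewrite !scmx_mull !scmx_mulr in e1 e2 *.
under eq_bigr => k _ do rewrite !mxE scalerDl -scalerA.
under [RHS]eq_bigr => k _ do rewrite !mxE scalerDl -scalerA.
by rewrite !big_split/= -!scaler_sumr e1 e2.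
Qed.

(* Every unitary representation is a sum of pieces [T u T^*], [u] irreducible:
   a non-scalar self-intertwiner can be taken hermitian, and its spectral
   projections cut the representation into smaller ones. *)
Lemma unitary_rep_ind (I : irr_family G) (Q : forall n, 'M[G]_n -> Prop) :
  (forall v : 'M[G]_0, Q 0%N v) ->
  (forall pi : I, Q _ (irr pi)) ->
  (forall m n (T : 'M[R[i]]_(m, n)) (v : 'M[G]_n), Q n v ->
     Q m (scmx G T *m v *m scmx G (T ^t*)%sesqui)) ->
  (forall n (v w : 'M[G]_n), Q n v -> Q n w -> Q n (v + w)) ->
  forall n (v : 'M[G]_n), unitary_rep v -> Q n v.
Proof.
move=> Q0 Qirr Qconj QD n; elim/ltn_ind: n => n IH v uv.
have [n0|n0] := posnP n; first by move: v uv; rewrite n0 => v _; exact: Q0.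
have [iv|niv] := pselect (irreducible_rep v).
  have [pi [T [TT T'T E]]] := irr_surj I iv.
  have := Qconj _ _ T _ (Qirr pi); congr Q.
  move: E; rewrite !intertwinerE => <-.
  by rewrite -mulmxA -scmxM TT scmx1 mulmx1.
have [T [Tv nT]] : exists T : 'M[R[i]]_n, intertwiner v v T /\ ~ is_scalar_mx T.
  apply: contrapT => nex; apply: niv; split=> // T Tv; apply: contrapT => nT.
  by apply: nex; exists T.
have Tv' := intertwiner_adj uv uv Tv.
have [S [Sv nS hS]] : exists S : 'M[R[i]]_n, [/\ intertwiner v v S, ~ is_scalar_mx S &
    S = (S ^t*)%sesqui].
  (* Up to real factors, the real and imaginary parts of T; if both were scalar, T would be
     scalar. *)
  pose S1 : 'M[R[i]]_n := T + (T ^t*)%sesqui.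
  pose S2 : 'M[R[i]]_n := 'i *: (T - (T ^t*)%sesqui).
  have iD (X Y : 'M[R[i]]_n) c : intertwiner v v X -> intertwiner v v Y ->
    intertwiner v v (c *: X + Y) by exact: intertwinerD.
  have zv : intertwiner v v 0 by have := iD T T (-1) Tv Tv; rewrite scaleN1r addNr.
  have S1v : intertwiner v v S1 by have := iD T _ 1 Tv Tv'; rewrite scale1r.
  have S2v : intertwiner v v S2.
    have := iD _ 0 'i (iD _ _ (-1) Tv' Tv) zv.
    by rewrite addr0 scaleN1r (addrC (- _)).
  have [s1|s1] := pselect (is_scalar_mx S1); last first.
    exists S1; split=> //; apply/matrixP => i j; rewrite !mxE rmorphD/= conjCK.
    by rewrite addrC.
  have [s2|s2] := pselect (is_scalar_mx S2); last first.
    exists S2; split=> //; apply/matrixP => i j; rewrite !mxE rmorphM rmorphB/= conjCK.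
    by rewrite conjCi mulNr -mulrN opprB.
  case: nT; move: s1 s2 => /is_scalar_mxP[a aE] /is_scalar_mxP[b bE].
  apply/is_scalar_mxP; exists (2^-1 * (a - 'i * b)).
  have -> : T = 2^-1 *: (S1 - 'i *: S2).
    rewrite /S1 /S2 scalerA -expr2 sqrCi scaleN1r opprK addrACA subrr addr0.
    by apply/matrixP => i j; rewrite !mxE; field.
  rewrite aE bE; apply/matrixP => i j; rewrite !mxE.
  by case: (i == j); rewrite ?mulr1n ?mulr0n ?mulr0 ?subrr ?mulr0.
have Sh : S \is hermsymmx.
  by rewrite qualifE /= expr0 scale1r; apply/eqP.
have /hermitian_normalmx/orthomx_spectralP := Sh.
set P := spectralmx S; set d := spectral_diag S.
have PU : P \is unitarymx by exact: spectral_unitarymx.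
have PP : P *m (P ^t*)%sesqui = 1%:M by apply/unitarymxP.
rewrite invmx_unitary// => SE.
have P'P := mulmx1C PP.
pose w := scmx G P *m v *m scmx G (P ^t*)%sesqui.
have uw : unitary_rep w by exact: unitary_rep_conj.
suff Qw : Q n w.
  have := Qconj _ _ (P ^t*)%sesqui _ Qw; congr Q.
  rewrite /w trmxCK !mulmxA -scmxM P'P scmx1 mul1mx -mulmxA -scmxM P'P.
  by rewrite scmx1 mulmx1.
(* [w] commutes with the diagonal matrix of [d], so (d_i - d_j) w_ij = 0. *)
have wd i j : d 0 i != d 0 j -> w i j = 0.
  move=> dij.
  have E : w *m scmx G (diag_mx d) = scmx G (diag_mx d) *m w.
    have dE : diag_mx d = P *m S *m (P ^t*)%sesqui.
      by rewrite SE !mulmxA PP mul1mx -mulmxA PP mulmx1.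
    move: Sv; rewrite !intertwinerE => Sv.
    have P'Pm (X : 'M[G]_n) : X *m scmx G (P ^t*)%sesqui *m scmx G P = X.
      by rewrite -mulmxA -scmxM P'P scmx1 mulmx1.
    by rewrite dE !scmxM /w !mulmxA !P'Pm -(mulmxA _ v) Sv mulmxA.
  have := congr1 (fun M : 'M[G]_n => M i j) E.
  rewrite scmx_mull scmx_mulr (bigD1 j)//= big1 => [|k kj]; last first.
    by rewrite !mxE (negbTE kj) mulr0n scale0r.
  rewrite (bigD1 i)//= big1 => [|k ki]; last first.
    by rewrite !mxE eq_sym (negbTE ki) mulr0n scale0r.
  rewrite !mxE !eqxx !mulr1n !addr0 => /eqP.
  rewrite eq_sym -subr_eq0 -scalerBl => /eqP h.
  apply: (@cnorm0_eq0 R G); apply/eqP.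
  have := congr1 (@cnorm R G) h; rewrite cnormZ (norm0 (cnorm_is_norm G)) => /eqP.
  rewrite mulf_eq0 => /orP[/eqP/nrm0_eq0/eqP|//].
  by rewrite subr_eq0 (negbTE dij).
pose i0 := Ordinal n0.
(* The indices of one eigenvalue: nonempty, and not everything because S is not scalar. Both
   diagonal blocks are therefore smaller than [w]. *)
pose A := [set i : 'I_n | d 0 i == d 0 i0]%SET.
have AC i j : i \in A -> j \notin A -> w i j = 0 /\ w j i = 0.
  rewrite !inE => /eqP di dj; split; apply: wd; rewrite di; first by rewrite eq_sym.
  by [].
have A1 : (#|A| < n)%N.
  rewrite -[X in (_ < X)%N]card_ord; apply: proper_card; apply/properP; split.
    by apply/fintype.subsetP.
  apply: contrapT => h; apply: nS; apply/is_scalar_mxP; exists (d 0 i0).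
  have dE : diag_mx d = (d 0 i0)%:M.
    apply/matrixP => i j; rewrite !mxE; congr (_ *+ _).
    apply/eqP/negPn/negP => dj; apply: h; exists i => //.
    by rewrite inE.
  by rewrite SE dE mul_mx_scalar -scalemxAl P'P scalemx1.
have A2 : (#|~: A| < n)%N.
  rewrite cardsCs finset.setCK card_ord ltn_subrL n0 andbT.
  by apply/card_gt0P; exists i0; rewrite inE.
pose piece (B : {set 'I_n}) : 'M[R[i]]_(n, #|B|) := \matrix_(i, j) (i == enum_val j)%:R.
pose wB (B : {set 'I_n}) : 'M[G]_(#|B|) := \matrix_(i, j) w (enum_val i) (enum_val j).
have closedB (B : {set 'I_n}) : (forall i j, i \in B -> j \notin B -> w i j = 0 /\ w j i = 0) ->
    unitary_rep (wB B).
  move=> hB; move: uw => [w1 w2 w3].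
  have sumB (V : nmodType) (F : 'I_n -> V) : (forall k, k \notin B -> F k = 0) ->
      \sum_k F k = \sum_(k < #|B|) F (enum_val k).
    move=> F0; rewrite (bigID (mem B))/= [X in _ + X]big1 ?addr0.
      by rewrite big_enum_val.
    by move=> k kB; rewrite F0.
  have in_en (k : 'I_#|B|) : enum_val k \in B by exact: enum_valP.
  split.
  - apply/matrixP => i j; have := congr1 (fun M : 'M[G]_n => M (enum_val i) (enum_val j)) w1.
    rewrite !mxE (inj_eq enum_val_inj) => <-.
    rewrite sumB => [|k kB]; first by apply: eq_bigr => k _; rewrite !mxE.
    by rewrite (hB _ _ (in_en i) kB).1 mul0r.
  - apply/matrixP => i j; have := congr1 (fun M : 'M[G]_n => M (enum_val i) (enum_val j)) w2.
    rewrite !mxE (inj_eq enum_val_inj) => <-.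
    rewrite sumB => [|k kB]; first by apply: eq_bigr => k _; rewrite !mxE.
    by rewrite (hB _ _ (in_en j) kB).2 mulr0.
  - have wBE i j : wB B i j = w (enum_val i) (enum_val j) by rewrite mxE.
    move=> i j; rewrite wBE w3 sumB => [|k kB].
      by apply: eq_bigr => k _; rewrite !wBE.
    by rewrite (hB _ _ (in_en i) kB).1 (tens0l tP).
have pieceE (B : {set 'I_n}) i j : (scmx G (piece B) *m wB B *m scmx G ((piece B) ^t*)%sesqui) i j =
    if (i \in B) && (j \in B) then w i j else 0.
  have pE i' (k : 'I_#|B|) : piece B i' k = (i' == enum_val k)%:R by rewrite mxE.
  have wBE i' j' : wB B i' j' = w (enum_val i') (enum_val j') by rewrite mxE.
  rewrite conj_entry; case: ifPn => [/andP[iB jB]|].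
    have rk x (xB : x \in B) (k : 'I_#|B|) : k != enum_rank_in xB x -> (x == enum_val k) = false.
      move=> h; apply/eqP => E; move: h => /eqP; apply; apply: enum_val_inj.
      by rewrite enum_rankK_in.
    rewrite (bigD1 (enum_rank_in iB i))//= (bigD1 (enum_rank_in jB j))//=.
    rewrite !pE wBE !enum_rankK_in// !eqxx conjC1 mulr1 scale1r.
    rewrite [X in _ + X + _]big1 ?addr0 => [|l lj]; last first.
      by rewrite pE (rk _ _ _ lj) conjC0 mulr0 scale0r.
    rewrite big1 ?addr0// => k ki; rewrite big1// => l _.
    by rewrite pE (rk _ _ _ ki) mul0r scale0r.
  move=> h; rewrite big1// => k _; rewrite big1// => l _; rewrite !pE.
  case: eqP => [E1|_]; last by rewrite mul0r scale0r.
  case: eqP => [E2|_]; last by rewrite conjC0 mulr0 scale0r.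
  by move: h; rewrite E1 E2 !enum_valP.
have -> : w = scmx G (piece A) *m wB A *m scmx G ((piece A) ^t*)%sesqui +
    scmx G (piece (~: A)) *m wB (~: A) *m scmx G ((piece (~: A)) ^t*)%sesqui.
  apply/matrixP => i j; rewrite [RHS]mxE !pieceE !finset.in_setC.
  have [iA|iA] := boolP (i \in A); have [jA|jA] := boolP (j \in A).
  - by rewrite addr0.
  - by rewrite (AC _ _ iA jA).1 addr0.
  - by rewrite (AC _ _ jA iA).2 addr0.
  - by rewrite add0r.
apply: QD; apply: Qconj; apply: IH => //; apply: closedB => i j.
  exact: AC.
rewrite !finset.in_setC negbK => iA jA; have [h1 h2] := AC j i jA iA.
by split.
Qed.

End Reps.

Lemma lin_span_sub (K : pzRingType) (V : lmodType K) (S T : set V) :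
  (forall s, S s -> lin_span T s) -> forall x, lin_span S x -> lin_span T x.
Proof.
move=> ST x; apply: (lin_span_ind (P := lin_span T)); first exact: lin_span0.
by move=> c s y Ss Ty; apply: lin_spanD => //; exact: ST.
Qed.

Lemma lin_span_sum (K : pzRingType) (V : lmodType K) (S : set V) (I : Type)
    (r : seq I) (P : pred I) (c : I -> K) (f : I -> V) :
  (forall i, lin_span S (f i)) -> lin_span S (\sum_(i <- r | P i) c i *: f i).
Proof.
move=> Sf; elim: r => [|i r IH]; first by rewrite big_nil; exact: lin_span0.
by rewrite big_cons; case: ifP => // _; exact: lin_spanD.
Qed.

Section Schur.
Variables (R : realType) (G : compact_quantum_group R) (I : irr_family G).

Lemma irr_unitary (pi : I) : unitary_rep (irr pi).
Proof. by have [_ u _] := irrP pi. Qed.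

Lemma coeff_Pol n (v : 'M[G]_n) i j : unitary_rep v -> Pol I (v i j).
Proof.
move=> uv; move: n v uv i j.
apply: (@unitary_rep_ind R G I (fun n v => forall i j, Pol I (v i j))).
- by move=> v [].
- by move=> pi i j; apply: lin_span_in; exists pi, i, j.
- move=> m n T v Pv i j; rewrite conj_entry.
  rewrite (eq_bigr (fun k => 1 *: (\sum_l (T i k * Num.conj (T j l)) *: v k l))).
    by apply: lin_span_sum => k; apply: lin_span_sum => l; exact: Pv.
  by move=> k _; rewrite scale1r.
- move=> n v w Pv Pw i j; rewrite mxE -[v i j]scale1r.
  by apply: lin_spanD; [exact: Pv|exact: Pw].
Qed.

(** T T^* and T^* T are self-intertwiners of irreducible representations, hence scalars, and the
    same scalar c if T is nonzero. Then c > 0, and T / sqrt(c) would be an equivalence. *)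
Lemma schur (pi rho : I) (T : 'M[R[i]]_(irr_dim pi, irr_dim rho)) :
  intertwiner (irr pi) (irr rho) T -> pi <> rho -> T = 0.
Proof.
move=> hT npr; have hT' := intertwiner_adj (irr_unitary pi) (irr_unitary rho) hT.
have [n0 _ sc] := irrP pi; have [m0 _ sc'] := irrP rho.
have /is_scalar_mxP[c cE] := sc _ (intertwiner_comp hT hT').
have /is_scalar_mxP[c' cE'] := sc' _ (intertwiner_comp hT' hT).
have cc' : c *: T = c' *: T.
  by rewrite -mul_scalar_mx -cE -mulmxA cE' mul_mx_scalar.
have [//|T0] := eqVneq T 0.
have ecc : c = c'.
  apply/eqP; rewrite -subr_eq0; apply: contra_neqT T0 => h.
  have : (c - c') *: T = 0 by rewrite scalerBl cc' subrr.
  by move=> /eqP; rewrite scaler_eq0 (negbTE h) => /eqP.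
pose i0 := Ordinal n0.
have csum : c = \sum_k T i0 k * Num.conj (T i0 k).
  have := congr1 (fun M : 'M[R[i]]_(irr_dim pi) => M i0 i0) cE.
  by rewrite !mxE eqxx mulr1n => <-; apply: eq_bigr => k _; rewrite !mxE.
have c0 : 0 <= c by rewrite csum sumr_ge0// => k _; exact: mul_conjC_ge0.
have cn0 : c != 0.
  apply: contra_neq T0 => c00; apply/matrixP => i k; rewrite [RHS]mxE.
  have : \sum_k T i k * Num.conj (T i k) = 0.
    have := congr1 (fun M : 'M[R[i]]_(irr_dim pi) => M i i) cE.
    rewrite c00 [RHS]mxE mul0rn => E0; rewrite -[RHS]E0 mxE.
    by apply: eq_bigr => l _; rewrite !mxE.
  move=> /eqP; rewrite psumr_eq0 => [/allP/(_ k)|l _]; last exact: mul_conjC_ge0.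
  by rewrite mem_index_enum => /(_ isT); rewrite mul_conjC_eq0 => /eqP.
case: npr; apply: irr_inj.
have sc0 : sqrtC c != 0 by rewrite sqrtC_eq0.
have scr : Num.conj (sqrtC c) = sqrtC c by apply/CrealP; rewrite ger0_real// sqrtC_ge0.
have h1 : (sqrtC c)^-1 * (sqrtC c)^-1 * c = 1.
  by rewrite -expr2 exprVn sqrtCK mulVf.
have adjE : (((sqrtC c)^-1 *: T) ^t*)%sesqui = (sqrtC c)^-1 *: (T ^t*)%sesqui.
  by apply/matrixP => i j; rewrite !mxE rmorphM fmorphV/= scr.
exists ((sqrtC c)^-1 *: T); rewrite adjE -!scalemxAl -!scalemxAr !scalerA cE cE' -ecc.
rewrite !scale_scalar_mx h1; split=> //.
have := intertwinerD (sqrtC c)^-1 hT (S := 0); rewrite addr0; apply.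
by have := intertwinerD (-1) hT hT; rewrite scaleN1r addNr.
Qed.

End Schur.

Lemma slice_sum (R : realType) (A B T : cstarType R) (t : A -> B -> T) phi K s :
  is_slice t phi K s -> forall n (F : 'I_n -> T), s (\sum_i F i) = \sum_i s (F i).
Proof.
move=> hs; elim=> [|n IH] F; first by rewrite !big_ord0 (slice0 hs).
by rewrite !big_ord_recl -IH -[F ord0]scale1r (sliceD hs) !scale1r.
Qed.

(** * Orthogonality relations for matrix coefficients *)

Section Orthogonality.
Variables (R : realType) (G : compact_quantum_group R) (h : {scalar G}).
Hypothesis hh : haar_state h.
Local Notation t := (@tens R G).
Let tP : min_tensor t := tensP G.

(** The invariance (id (x) h) Delta(x y) = h(x y) 1, expanded along the given decompositions of
    Delta(x) and Delta(y). *)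
Lemma haar_prod_r n m (x y : G) (x1 x2 : 'I_n -> G) (y1 y2 : 'I_m -> G) :
  comul G x = \sum_a t (x1 a) (x2 a) -> comul G y = \sum_b t (y1 b) (y2 b) ->
  \sum_a \sum_b h (x2 a * y2 b) *: (x1 a * y1 b) = h (x * y) *: 1.
Proof.
move=> xE yE; have [K [s [hs sc]]] := haar_slice_r hh.
rewrite -sc comulM xE yE mulr_suml (slice_sum hs); apply: eq_bigr => a _.
rewrite mulr_sumr (slice_sum hs); apply: eq_bigr => b _.
by rewrite (tensM tP) (slice_tens hs).
Qed.

Lemma haar_prod_l n m (x y : G) (x1 x2 : 'I_n -> G) (y1 y2 : 'I_m -> G) :
  comul G x = \sum_a t (x1 a) (x2 a) -> comul G y = \sum_b t (y1 b) (y2 b) ->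
  \sum_a \sum_b h (x1 a * y1 b) *: (x2 a * y2 b) = h (x * y) *: 1.
Proof.
move=> xE yE; have [K [s [hs _ sc]]] := haar_slice_l hh.
rewrite -sc comulM xE yE mulr_suml (slice_sum hs); apply: eq_bigr => a _.
rewrite mulr_sumr (slice_sum hs); apply: eq_bigr => b _.
by rewrite (tensM tP) (slice_tens hs).
Qed.

Lemma comul_rep n (v : 'M[G]_n) i j : unitary_rep v ->
  comul G (v i j) = \sum_k t (v i k) (v k j).
Proof. by move=> [_ _ ->]. Qed.

Lemma comul_rep_star n (v : 'M[G]_n) i j : unitary_rep v ->
  comul G (star (v i j)) = \sum_k t (star (v i k)) (star (v k j)).
Proof.
move=> uv; rewrite comul_star (comul_rep _ _ uv) star_sum.
by apply: eq_bigr => k _; rewrite (tens_star tP).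
Qed.

(** The matrices Q govern coefficients within one class. Between classes, for fixed j and m,
    invariance gives T = pi T rho^* for the matrix T of these values; T is then an intertwiner and
    Schur's lemma applies. *)
Lemma irr_orth (I : irr_family G) (pi rho : I) i j l m :
  pi <> rho -> h (irr pi i j * star (irr rho l m)) = 0.
Proof.
move=> npr; have u := irr_unitary pi; have v := irr_unitary rho.
pose T := \matrix_(i, l) h (irr pi i j * star (irr rho l m)).
suff : T = 0 by move=> /matrixP/(_ i l); rewrite !mxE.
apply: (schur (I := I)) => //.
have E : scmx G T = irr pi *m scmx G T *m adjmx (irr rho).
  apply/matrixP => a b; rewrite scmxE mxE.
  rewrite -(haar_prod_r (comul_rep a j u) (comul_rep_star b m v)).
  rewrite mxE exchange_big; apply: eq_bigr => c _; rewrite scmx_mulr mulr_suml.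
  by apply: eq_bigr => d _; rewrite !mxE -scalerAl.
rewrite intertwinerE {2}E -mulmxA.
by have [_ -> _] := (unitary_repE (irr rho)).1 v; rewrite mulmx1.
Qed.

Variables (I : irr_family G) (Q : forall pi : I, 'M[R[i]]_(irr_dim pi)).
Hypothesis hQ : modular_matrices h Q.
Local Notation C := R[i].

Lemma irr_dim_gt0 (pi : I) : (0 < irr_dim pi)%N.
Proof. by have [] := irrP pi. Qed.

Definition eigU (pi : I) : 'M[C]_(irr_dim pi) := spectralmx (Q pi).
Definition eigQ (pi : I) (i : 'I_(irr_dim pi)) : R :=
  complex.Re (spectral_diag (Q pi) 0 i).

Lemma eigU1 pi : eigU pi *m ((eigU pi) ^t*)%sesqui = 1%:M.
Proof. exact/unitarymxP/spectral_unitarymx. Qed.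

Lemma eigU2 pi : ((eigU pi) ^t*)%sesqui *m eigU pi = 1%:M.
Proof. exact: mulmx1C (eigU1 pi). Qed.

Lemma modular_spectral pi :
  Q pi = ((eigU pi) ^t*)%sesqui *m diag_mx (spectral_diag (Q pi)) *m eigU pi.
Proof.
have [[Qh _] _ _ _] := hQ pi.
have /hermitian_normalmx/orthomx_spectralP := Qh.
by rewrite invmx_unitary ?spectral_unitarymx.
Qed.

Lemma modular_diag pi :
  eigU pi *m Q pi *m ((eigU pi) ^t*)%sesqui = diag_mx (spectral_diag (Q pi)).
Proof.
rewrite [X in _ *m X *m _]modular_spectral !mulmxA eigU1 mul1mx -mulmxA.
by rewrite eigU1 mulmx1.
Qed.

Lemma spectral_gt0 pi i : 0 < spectral_diag (Q pi) 0 i.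
Proof.
have [[_ Qp] _ _ _] := hQ pi.
pose v : 'cV[C]_(irr_dim pi) := ((eigU pi) ^t*)%sesqui *m delta_mx i 0.
have v0 : v != 0.
  apply/eqP => /(congr1 (mulmx (eigU pi))).
  rewrite mulmxA eigU1 mul1mx mulmx0 => /matrixP/(_ i 0); rewrite !mxE !eqxx/=.
  by move=> /eqP; rewrite oner_eq0.
have := Qp v v0.
have -> : (v ^t*)%sesqui = (delta_mx 0 i : 'rV_(irr_dim pi)) *m eigU pi.
  apply/matrixP => a b; rewrite !mxE rmorph_sum; apply: eq_bigr => k _.
  rewrite !mxE rmorphM/= conjCK mulrC (ord1 a) !eqxx/= andbT.
  by rewrite rmorph_nat.
rewrite !mulmxA -(mulmxA _ (eigU pi)) -(mulmxA _ (eigU pi *m Q pi)) modular_diag.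
rewrite -rowE -colE !mxE eqxx mulr1n.
by [].
Qed.

Lemma eigQE pi i : (eigQ i)%:C = spectral_diag (Q pi) 0 i.
Proof.
by rewrite /eigQ RRe_real// gtr0_real// spectral_gt0.
Qed.

Lemma eigQ_gt0 pi (i : 'I_(irr_dim pi)) : 0 < eigQ i.
Proof. by rewrite -ltcR eigQE spectral_gt0. Qed.

Lemma spectral_diagE pi : spectral_diag (Q pi) = \row_i (eigQ i)%:C.
Proof. by apply/rowP => i; rewrite mxE eigQE. Qed.

Definition qtr pi : R := \sum_i eigQ (pi := pi) i.

Lemma qtrE pi : \tr (Q pi) = (qtr pi)%:C.
Proof.
rewrite {1}modular_spectral mxtrace_mulC mulmxA eigU1 mul1mx mxtrace_diag.
by rewrite /qtr rmorph_sum; apply: eq_bigr => i _; rewrite -eigQE.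
Qed.

Lemma qtr_gt0 pi : 0 < qtr pi.
Proof.
pose i0 := Ordinal (irr_dim_gt0 pi).
rewrite /qtr (bigD1 i0)//= ltr_pwDl ?eigQ_gt0// sumr_ge0// => i _.
by rewrite ltW ?eigQ_gt0.
Qed.

Lemma modular_inv_diag pi :
  eigU pi *m invmx (Q pi) *m ((eigU pi) ^t*)%sesqui =
  diag_mx (\row_i ((eigQ i)^-1)%:C).
Proof.
have dd : diag_mx (\row_i (eigQ (pi := pi) i)%:C) *m diag_mx (\row_i ((eigQ i)^-1)%:C) = 1%:M.
  rewrite mulmx_diag; apply/matrixP => i j; rewrite !mxE -rmorphM.
  by rewrite (mulfV (lt0r_neq0 (eigQ_gt0 i))).
have Qi : Q pi *m (((eigU pi) ^t*)%sesqui *m diag_mx (\row_i ((eigQ i)^-1)%:C) *m eigU pi) = 1%:M.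
  rewrite {1}modular_spectral spectral_diagE !mulmxA -(mulmxA _ (eigU pi)) eigU1 mulmx1.
  by rewrite -(mulmxA _ (diag_mx _) (diag_mx _)) dd mulmx1 eigU2.
have Qu : Q pi \in unitmx by case: (mulmx1_unit Qi).
have -> : invmx (Q pi) = ((eigU pi) ^t*)%sesqui *m diag_mx (\row_i ((eigQ i)^-1)%:C) *m eigU pi.
  by rewrite -[LHS]mulmx1 -Qi mulKmx.
by rewrite !mulmxA eigU1 mul1mx -mulmxA eigU1 mulmx1.
Qed.

(* The irreducible representations in an orthonormal basis of eigenvectors of
   [Q], where [Q] becomes the diagonal matrix of [eigQ]. *)
Definition eirr (pi : I) : 'M[G]_(irr_dim pi) :=
  scmx G (eigU pi) *m irr pi *m scmx G ((eigU pi) ^t*)%sesqui.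

Lemma eirr_unitary pi : unitary_rep (eirr pi).
Proof. exact: unitary_rep_conj (eigU1 pi) (irr_unitary pi). Qed.

Lemma irr_eirr pi :
  irr pi = scmx G ((eigU pi) ^t*)%sesqui *m eirr pi *m scmx G (((eigU pi) ^t*) ^t*)%sesqui.
Proof.
rewrite /eirr trmxCK !mulmxA -scmxM eigU2 scmx1 mul1mx -mulmxA -scmxM eigU2.
by rewrite scmx1 mulmx1.
Qed.

Lemma hsum2 n m (c : 'I_n -> 'I_m -> C) (s : 'I_n -> 'I_m -> G) :
  h (\sum_k \sum_l c k l *: s k l) = \sum_k \sum_l c k l * h (s k l).
Proof.
rewrite linear_sum/=; apply: eq_bigr => k _; rewrite linear_sum/=.
by apply: eq_bigr => l _; rewrite hZ.
Qed.

Lemma eirrE pi i j : eirr pi i j =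
  \sum_k \sum_l (eigU pi i k * Num.conj (eigU pi j l)) *: irr pi k l.
Proof. exact: conj_entry. Qed.

Lemma eirr_starE pi i j : star (eirr pi i j) =
  \sum_k \sum_l (Num.conj (eigU pi i k) * eigU pi j l) *: star (irr pi k l).
Proof.
rewrite eirrE star_sum; apply: eq_bigr => k _; rewrite star_sum.
by apply: eq_bigr => l _; rewrite starZ rmorphM/= conjCK.
Qed.

Lemma mulsum2 n m (c : 'I_n -> 'I_m -> C) (s : 'I_n -> 'I_m -> G) (x : G) :
  (\sum_k \sum_l c k l *: s k l) * x = \sum_k \sum_l c k l *: (s k l * x).
Proof.
rewrite mulr_suml; apply: eq_bigr => k _; rewrite mulr_suml.
by apply: eq_bigr => l _; rewrite -scalerAl.
Qed.

Lemma mul2sum n m (c : 'I_n -> 'I_m -> C) (s : 'I_n -> 'I_m -> G) (x : G) :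
  x * (\sum_k \sum_l c k l *: s k l) = \sum_k \sum_l c k l *: (x * s k l).
Proof.
rewrite mulr_sumr; apply: eq_bigr => k _; rewrite mulr_sumr.
by apply: eq_bigr => l _; rewrite -scalerAr.
Qed.

Lemma eirr_orth pi rho i j l m : pi <> rho -> h (eirr pi i j * star (eirr rho l m)) = 0.
Proof.
move=> npr; rewrite eirrE mulsum2 hsum2 big1// => a _; rewrite big1// => b _.
rewrite eirr_starE mul2sum hsum2 [X in _ * X]big1 ?mulr0// => c _.
by rewrite big1// => d _; rewrite irr_orth ?mulr0.
Qed.

Lemma eirr_haar pi i j l m : h (eirr pi i j * star (eirr pi l m)) =
  (i == l)%:R * (m == j)%:R * (eigQ j / qtr pi)%:C.
Proof.
have [_ _ o1 _] := hQ pi.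
have t0 : (qtr pi)%:C != 0 :> C by rewrite (inj_eq (@complexI R)) gt_eqF ?qtr_gt0.
rewrite eirrE mulsum2 hsum2.
have F a b : h (irr pi a b * star (eirr pi l m)) =
    Num.conj (eigU pi l a) * ((eigU pi *m Q pi) m b / (qtr pi)%:C).
  rewrite eirr_starE mul2sum hsum2 (bigD1 a)//= [X in _ + X]big1 ?addr0 => [|c ca].
    rewrite mxE mulr_suml mulr_sumr; apply: eq_bigr => d _.
    by rewrite o1 eqxx mul1r qtrE -!mulrA.
  by rewrite big1// => d _; rewrite o1 eq_sym (negbTE ca) !mul0r mulr0.
under eq_bigr => a _ do under eq_bigr => b _ do rewrite F.
have -> : \sum_a \sum_b eigU pi i a * Num.conj (eigU pi j b) *
     (Num.conj (eigU pi l a) * ((eigU pi *m Q pi) m b / (qtr pi)%:C)) =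
   (eigU pi *m ((eigU pi) ^t*)%sesqui) i l *
   ((eigU pi *m Q pi *m ((eigU pi) ^t*)%sesqui) m j / (qtr pi)%:C).
  rewrite [X in _ = X * _]mxE [X in _ = _ * (X / _)]mxE !mulr_suml.
  apply: eq_bigr => a _; rewrite mulr_sumr; apply: eq_bigr => b _.
  by rewrite !mxE; ring.
rewrite eigU1 modular_diag spectral_diagE !mxE.
have [<-|mj] := eqVneq m j; last by rewrite mulr0n mul0r !mulr0 mul0r.
by rewrite mulr1n mulr1 fmorph_div.
Qed.

Lemma eirr_haar_star pi i j l m : h (star (eirr pi i j) * eirr pi l m) =
  (j == m)%:R * (l == i)%:R * ((eigQ i)^-1 / qtr pi)%:C.
Proof.
have [_ _ _ o2] := hQ pi.
rewrite eirr_starE mulsum2 hsum2.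
have F a b : h (star (irr pi a b) * eirr pi l m) =
    Num.conj (eigU pi m b) * ((eigU pi *m invmx (Q pi)) l a / (qtr pi)%:C).
  rewrite eirrE mul2sum hsum2 exchange_big (bigD1 b)//= [X in _ + X]big1 ?addr0 => [|d db].
    rewrite mxE mulr_suml mulr_sumr; apply: eq_bigr => c _.
    by rewrite o2 eqxx mul1r qtrE; ring.
  by rewrite big1// => c _; rewrite o2 eq_sym (negbTE db) !mul0r mulr0.
under eq_bigr => a _ do under eq_bigr => b _ do rewrite F.
have -> : \sum_a \sum_b Num.conj (eigU pi i a) * eigU pi j b *
     (Num.conj (eigU pi m b) * ((eigU pi *m invmx (Q pi)) l a / (qtr pi)%:C)) =
   (eigU pi *m ((eigU pi) ^t*)%sesqui) j m *
   ((eigU pi *m invmx (Q pi) *m ((eigU pi) ^t*)%sesqui) l i / (qtr pi)%:C).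
  rewrite exchange_big [X in _ = X * _]mxE [X in _ = _ * (X / _)]mxE !mulr_suml.
  apply: eq_bigr => a _; rewrite mulr_sumr; apply: eq_bigr => b _.
  by rewrite !mxE; ring.
rewrite eigU1 modular_inv_diag !mxE.
have [->|mj] := eqVneq l i; last by rewrite mulr0n mul0r !mulr0 mul0r.
by rewrite mulr1n mulr1 fmorph_div.
Qed.

(** Left invariance at e_jj e_jm^*, where the values of [h] reduce the double sum to its diagonal.
    With [eirr_sum_star_mul], this is the unitarity of the conjugate representation up to
    weights. *)
Lemma eirr_sum_mul_star pi j m :
  \sum_k (eigQ k)%:C *: (eirr pi k j * star (eirr pi k m)) =
  ((m == j)%:R * (eigQ j)%:C) *: 1.
Proof.
have u := eirr_unitary pi.
have t0 : (qtr pi)%:C != 0 :> C by rewrite (inj_eq (@complexI R)) gt_eqF ?qtr_gt0.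
have := haar_prod_l (comul_rep j j u) (comul_rep_star j m u).
rewrite eirr_haar eqxx mul1r.
rewrite (eq_bigr (fun k => (qtr pi)%:C^-1 *:
    ((eigQ k)%:C *: (eirr pi k j * star (eirr pi k m))))) => [|a _]; last first.
  rewrite (bigD1 a)//= eirr_haar !eqxx !mul1r big1 ?addr0 => [|b ba]; last first.
    by rewrite eirr_haar eqxx (negbTE ba) mul1r mul0r scale0r.
  by rewrite scalerA fmorph_div mulrC.
rewrite -scaler_sumr fmorph_div => /(congr1 (fun z => (qtr pi)%:C *: z)).
by rewrite !scalerA mulfV// scale1r mulrC mulrA mulfVK.
Qed.

Lemma eirr_sum_star_mul pi i l :
  \sum_k ((eigQ k)^-1)%:C *: (star (eirr pi i k) * eirr pi l k) =
  ((l == i)%:R * ((eigQ i)^-1)%:C) *: 1.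
Proof.
have u := eirr_unitary pi.
have t0 : (qtr pi)%:C != 0 :> C by rewrite (inj_eq (@complexI R)) gt_eqF ?qtr_gt0.
have := haar_prod_r (comul_rep_star i i u) (comul_rep l i u).
rewrite eirr_haar_star eqxx mul1r.
rewrite (eq_bigr (fun k => (qtr pi)%:C^-1 *:
    (((eigQ k)^-1)%:C *: (star (eirr pi i k) * eirr pi l k)))) => [|a _]; last first.
  rewrite (bigD1 a)//= eirr_haar_star !eqxx !mul1r big1 ?addr0 => [|b ba]; last first.
    by rewrite eirr_haar_star eqxx (negbTE ba) mul1r mul0r scale0r.
  by rewrite scalerA fmorph_div mulrC.
rewrite -scaler_sumr fmorph_div => /(congr1 (fun z => (qtr pi)%:C *: z)).
by rewrite !scalerA mulfV// scale1r mulrC mulrA mulfVK.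
Qed.

End Orthogonality.

(** * Tensor products and conjugates of representations *)

Section ProductReps.
Variables (R : realType) (G : compact_quantum_group R).
Local Notation t := (@tens R G).
Let tP : min_tensor t := tensP G.

Definition tensor_rep n m (v : 'M[G]_n) (w : 'M[G]_m) : 'M[G]_#|{: 'I_n * 'I_m}| :=
  \matrix_(a, b) (v (enum_val a).1 (enum_val b).1 * w (enum_val a).2 (enum_val b).2).

Lemma sum_enum_val_pair n m (V : nmodType) (F : 'I_n * 'I_m -> V) :
  \sum_(a < #|{: 'I_n * 'I_m}|) F (enum_val a) = \sum_k \sum_l F (k, l).
Proof.
rewrite -(big_enum_val (fun x => F x)) pair_bigA.
by apply: eq_bigr => -[].
Qed.

Lemma tensor_repE n m (v : 'M[G]_n) (w : 'M[G]_m) i j k l :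
  tensor_rep v w (enum_rank (i, k)) (enum_rank (j, l)) = v i j * w k l.
Proof. by rewrite mxE !enum_rankK. Qed.

Lemma tensor_rep_unitary n m (v : 'M[G]_n) (w : 'M[G]_m) :
  unitary_rep v -> unitary_rep w -> unitary_rep (tensor_rep v w).
Proof.
move=> /unitary_repE[v1 v2 v3] /unitary_repE[w1 w2 w3].
have e1 (p : nat) (x y : 'M[G]_p) i j : x *m y = 1%:M ->
    \sum_k x i k * y k j = (i == j)%:R.
  by move=> /(congr1 (fun M : 'M[G]_p => M i j)); rewrite !mxE.
have pe (a b : 'I_#|{: 'I_n * 'I_m}|) :
    ((enum_val a).1 == (enum_val b).1) && ((enum_val a).2 == (enum_val b).2) = (a == b).
  rewrite -(inj_eq enum_val_inj).
  by case: (enum_val a) => ? ?; case: (enum_val b) => ? ?.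
apply/unitary_repE; split; apply/matrixP => a b; rewrite !mxE.
- under eq_bigr => c _ do rewrite !mxE starM.
  rewrite (sum_enum_val_pair (fun c => v (enum_val a).1 c.1 * w (enum_val a).2 c.2 *
    (star (w (enum_val b).2 c.2) * star (v (enum_val b).1 c.1)))).
  rewrite (eq_bigr (fun k => ((enum_val a).2 == (enum_val b).2)%:R *
      (v (enum_val a).1 k * star (v (enum_val b).1 k)))) => [|k _]; last first.
    rewrite -(e1 _ _ _ _ _ w1) mulr_suml.
    transitivity (v (enum_val a).1 k * (\sum_l w (enum_val a).2 l * adjmx w l (enum_val b).2)
      * star (v (enum_val b).1 k)).
      rewrite mulr_sumr mulr_suml; apply: eq_bigr => l _.
      by rewrite adjmxE !mulrA.
    rewrite -mulr_suml (e1 _ _ _ _ _ w1).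
    by case: eqP => _; rewrite !(mulr1, mul1r, mulr0, mul0r).
  rewrite -mulr_sumr.
  under eq_bigr => k _ do rewrite -adjmxE.
  by rewrite (e1 _ _ _ _ _ v1) -natrM mulnb andbC pe.
- under eq_bigr => c _ do rewrite !mxE starM.
  rewrite (sum_enum_val_pair (fun c => star (w c.2 (enum_val a).2) * star (v c.1 (enum_val a).1) *
    (v c.1 (enum_val b).1 * w c.2 (enum_val b).2))).
  rewrite exchange_big (eq_bigr (fun l => ((enum_val a).1 == (enum_val b).1)%:R *
      (star (w l (enum_val a).2) * w l (enum_val b).2))) => [|l _]; last first.
    transitivity (star (w l (enum_val a).2) *
      (\sum_k adjmx v (enum_val a).1 k * v k (enum_val b).1) * w l (enum_val b).2).
      rewrite mulr_sumr mulr_suml; apply: eq_bigr => k _.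
      by rewrite adjmxE !mulrA.
    rewrite (e1 _ _ _ _ _ v2).
    by case: eqP => _; rewrite !(mulr1, mul1r, mulr0, mul0r).
  rewrite -mulr_sumr.
  under eq_bigr => l _ do rewrite -adjmxE.
  by rewrite (e1 _ _ _ _ _ w2) -natrM mulnb pe.
rewrite rmorphM/=.
under [RHS]eq_bigr => c _ do rewrite !mxE.
rewrite (sum_enum_val_pair (fun c => t (v (enum_val a).1 c.1 * w (enum_val a).2 c.2)
    (v c.1 (enum_val b).1 * w c.2 (enum_val b).2))).
have c3 (p : nat) (x : 'M[G]_p) i j : map_mx (comul G) x = tmul x x ->
    comul G (x i j) = \sum_k t (x i k) (x k j).
  by move=> /(congr1 (fun M : 'M[CG2 G]_p => M i j)); rewrite !mxE.
rewrite (c3 _ v)// (c3 _ w)// mulr_suml; apply: eq_bigr => k _.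
by rewrite mulr_sumr; apply: eq_bigr => l _; rewrite (tensM tP).
Qed.

Lemma trivial_rep : unitary_rep (1%:M : 'M[G]_1).
Proof.
apply/unitary_repE; split; apply/matrixP => i j; rewrite !mxE big_ord1 !mxE ?ord1 ?eqxx.
- by rewrite star1 mulr1.
- by rewrite star1 mulr1.
- by rewrite rmorph1 (tens11 tP).
Qed.

Variables (h : {scalar G}) (I : irr_family G).
Hypothesis hh : haar_state h.
Variables (Q : forall pi : I, 'M[R[i]]_(irr_dim pi)).
Hypothesis hQ : modular_matrices h Q.

(** The entrywise adjoint of [eirr], conjugated by Q^(1/2) so as to become unitary. It puts adjoints
    of coefficients into [Pol] and determines [kappa] on them. *)
Definition conj_rep (pi : I) : 'M[G]_(irr_dim pi) :=
  \matrix_(i, j) ((Num.sqrt (eigQ Q i / eigQ Q j))%:C *: star (eirr Q pi i j)).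

Lemma conj_repE pi i j : conj_rep pi i j =
  (Num.sqrt (eigQ Q i / eigQ Q j))%:C *: star (eirr Q pi i j).
Proof. by rewrite mxE. Qed.

Lemma eigQ_ne0 (pi : I) (i : 'I_(irr_dim pi)) : eigQ Q i != 0.
Proof. by rewrite gt_eqF ?(eigQ_gt0 hQ). Qed.

Lemma conj_rep_unitary pi : unitary_rep (conj_rep pi).
Proof.
have uE := eirr_unitary Q pi; have q0 (k : 'I_(irr_dim pi)) := ltW (eigQ_gt0 hQ k).
apply/unitary_repE; split; apply/matrixP => i j; rewrite [LHS]mxE [RHS]mxE.
- rewrite (eq_bigr (fun k => (Num.sqrt (eigQ Q i * eigQ Q j))%:C *:
     (((eigQ Q k)^-1)%:C *: (star (eirr Q pi i k) * eirr Q pi j k)))) => [|k _]; last first.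
    rewrite adjmxE !conj_repE starZ starK conj_real -scalerAl -scalerAr !scalerA -!rmorphM/=.
    congr (_%:C *: _).
    rewrite !sqrtrM ?mulr_ge0 ?invr_ge0// mulrACA -expr2 sqr_sqrtr ?invr_ge0//.
  rewrite -scaler_sumr (eirr_sum_star_mul hh hQ) scalerA eq_sym.
  have [->|_] := eqVneq i j; last by rewrite mul0r mulr0 scale0r.
  rewrite mul1r -rmorphM -expr2 sqrtr_sqr ger0_norm// divff ?eigQ_ne0//.
  by rewrite scale1r.
- rewrite (eq_bigr (fun k => (Num.sqrt ((eigQ Q i)^-1 / eigQ Q j))%:C *:
     ((eigQ Q k)%:C *: (eirr Q pi k i * star (eirr Q pi k j))))) => [|k _]; last first.
    rewrite adjmxE !conj_repE starZ starK conj_real -scalerAl -scalerAr !scalerA -!rmorphM/=.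
    congr (_%:C *: _).
    rewrite !sqrtrM ?mulr_ge0 ?invr_ge0//.
    by rewrite -[X in _ = _ * X](sqr_sqrtr (q0 k)); ring.
  rewrite -scaler_sumr (eirr_sum_mul_star hh hQ) scalerA eq_sym.
  have [->|_] := eqVneq i j; last by rewrite mul0r mulr0 scale0r.
  rewrite mul1r -rmorphM -expr2 sqrtr_sqr ger0_norm ?invr_ge0// mulVf ?eigQ_ne0//.
  by rewrite scale1r.
rewrite conj_repE linearZ/= (comul_rep_star _ _ uE) scaler_sumr.
apply: eq_bigr => k _; rewrite !conj_repE (tensZl tP) (tensZr tP) scalerA -rmorphM.
congr (_%:C *: _); rewrite -sqrtrM ?divr_ge0//.
by congr Num.sqrt; rewrite mulrA mulfVK ?eigQ_ne0.
Qed.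

End ProductReps.

(** * The antilinear automorphism *)

Section Coordinates.
Variables (R : realType) (G : compact_quantum_group R) (h : {scalar G}).
Hypothesis hh : haar_state h.
Variables (I : irr_family G) (Q : forall pi : I, 'M[R[i]]_(irr_dim pi)).
Hypothesis hQ : modular_matrices h Q.
Local Notation C := R[i].

(** The indices of the basis e_ij of [Pol] over all classes; [{classic _}] provides the equality
    test that finite supports require. *)
Definition coeff_idx := {classic (sigT (fun pi : I => ('I_(irr_dim pi) * 'I_(irr_dim pi))%type))}.
Definition coeff_at (pi : I) i j : coeff_idx := existT _ pi (i, j).
Definition coeff_flip (m : coeff_idx) : coeff_idx := coeff_at (projT2 m).2 (projT2 m).1.
Definition coeff (m : coeff_idx) : G := eirr Q (projT1 m) (projT2 m).1 (projT2 m).2.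
(** [coeff_norm m] is the value of [h] at e_m e_m^*, [coeff_wt m] will be the eigenvalue at e_m of
    the square of the antipode, and [coord m] is the coordinate along e_m in this orthogonal
    family. *)
Definition coeff_norm (m : coeff_idx) : R := eigQ Q (projT2 m).2 / qtr Q (projT1 m).
Definition coeff_wt (m : coeff_idx) : R := eigQ Q (projT2 m).1 / eigQ Q (projT2 m).2.
Definition coord (m : coeff_idx) (x : G) : C := h (x * star (coeff m)) / (coeff_norm m)%:C.

Lemma coeff_flipK m : coeff_flip (coeff_flip m) = m.
Proof. by case: m => pi [i j]. Qed.

Lemma coeff_wt_gt0 m : 0 < coeff_wt m.
Proof. by rewrite divr_gt0// (eigQ_gt0 hQ). Qed.

Lemma coeff_norm_neq0 m : (coeff_norm m)%:C != 0 :> C.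
Proof.
by rewrite (inj_eq (@complexI R)) gt_eqF// divr_gt0 ?(eigQ_gt0 hQ) ?(qtr_gt0 hQ).
Qed.

Lemma coeff_orth m n : h (coeff m * star (coeff n)) = (m == n)%:R * (coeff_norm m)%:C.
Proof.
have [->|] := eqVneq m n; first by rewrite (eirr_haar hQ) !eqxx !mul1r.
case: m n => pi [i j] [rho [k l]] => /eqP ne; rewrite mul0r.
have [E|npr] := pselect (pi = rho); last exact: eirr_orth.
subst rho; rewrite (eirr_haar hQ)/=.
have [ik|] := eqVneq i k; last by rewrite !mul0r.
have [lj|] := eqVneq l j; last by rewrite mulr0 mul0r.
by case: ne; rewrite ik lj.
Qed.

Lemma coordD m c x y : coord m (c *: x + y) = c * coord m x + coord m y.
Proof. by rewrite /coord mulrDl -scalerAl hD mulrDl mulrA. Qed.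

Lemma coord0 m : coord m 0 = 0.
Proof. by rewrite /coord mul0r linear0 mul0r. Qed.

Lemma coord_coeff m n : coord m (coeff n) = (n == m)%:R.
Proof.
rewrite /coord coeff_orth; have [->|_] := eqVneq n m; last by rewrite !mul0r.
by rewrite mul1r mulfV ?coeff_norm_neq0.
Qed.

Lemma coord_sum m (r : seq coeff_idx) (c : coeff_idx -> C) : uniq r ->
  coord m (\sum_(n <- r) c n *: coeff n) = if m \in r then c m else 0.
Proof.
elim: r => [|n r IH]; first by rewrite big_nil coord0.
rewrite big_cons coordD coord_coeff /= => /andP[nr ur]; rewrite IH// in_cons eq_sym.
have [->|_] /= := eqVneq m n; last by rewrite mulr0 add0r.
by rewrite (negbTE nr) mulr1 addr0.
Qed.

Lemma PolE x : Pol I x <-> lin_span (range coeff) x.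
Proof.
split; apply: lin_span_sub => s [].
- move=> pi [i [j ->]]; rewrite (irr_eirr Q) conj_entry.
  rewrite (eq_bigr (fun k => 1 *: (\sum_l
      (((eigU Q pi) ^t*)%sesqui i k * Num.conj (((eigU Q pi) ^t*)%sesqui j l)) *:
      eirr Q pi k l))).
    apply: lin_span_sum => k; apply: lin_span_sum => l; apply: lin_span_in.
    by exists (coeff_at k l).
  by move=> k _; rewrite scale1r.
- by move=> m _ <-; apply: coeff_Pol; exact: eirr_unitary.
Qed.

Lemma coeff_in_Pol m : Pol I (coeff m).
Proof. by apply/PolE/lin_span_in; exists m. Qed.

Lemma PolD c x y : Pol I x -> Pol I y -> Pol I (c *: x + y).
Proof. exact: lin_spanD. Qed.

Lemma Pol0 : Pol I 0.
Proof. exact: lin_span0. Qed.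

Lemma PolZ c x : Pol I x -> Pol I (c *: x).
Proof. by move=> px; rewrite -[_ *: _]addr0; apply: PolD => //; exact: Pol0. Qed.

Lemma Pol_ind (P : G -> Prop) : P 0 ->
  (forall c m y, Pol I y -> P y -> P (c *: coeff m + y)) -> forall x, Pol I x -> P x.
Proof.
move=> P0 PD x /PolE px.
suff [] : Pol I x /\ P x by [].
apply: (lin_span_ind (P := [set x | Pol I x /\ P x])) px => /=.
  by split=> //; exact: Pol0.
move=> c _ y [m _ <-] [py Py]; split; last exact: PD.
by apply: PolD => //; exact: coeff_in_Pol.
Qed.

Lemma Pol_support x : Pol I x ->
  exists r : seq coeff_idx, uniq r /\ x = \sum_(m <- r) coord m x *: coeff m.
Proof.
move=> px.
suff [r [ur [c xE]]] : exists r : seq coeff_idx, uniq r /\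
    exists c, x = \sum_(m <- r) c m *: coeff m.
  exists r; split=> //; rewrite {1}xE big_seq [RHS]big_seq.
  by apply: eq_bigr => m mr; rewrite xE coord_sum// mr.
elim/Pol_ind: x / px.
  by exists [::]; split=> //; exists (fun=> 0); rewrite big_nil.
move=> b m _ _ [r [ur [c ->]]].
exists (if m \in r then r else m :: r); split; first by case: ifPn => //= ->.
exists (fun n => (n == m)%:R * b + (if n \in r then c n else 0)).
have E : \sum_(n <- r) c n *: coeff n =
    \sum_(n <- r) (if n \in r then c n else 0) *: coeff n.
  by rewrite big_seq [RHS]big_seq; apply: eq_bigr => n ->.
rewrite E; under [RHS]eq_bigr => n _ do rewrite scalerDl.
rewrite big_split/=; congr (_ + _).
  under eq_bigr => n _ do rewrite -scalerA.
  case: ifPn => mr.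
    rewrite (bigD1_seq m)//= eqxx scale1r big1 ?addr0// => n nm.
    by rewrite (negbTE nm) scale0r.
  rewrite big_cons eqxx scale1r big_seq big1 ?addr0// => n nr.
  case: eqVneq => [nm|_]; last by rewrite scale0r.
  by move: mr; rewrite -nm nr.
by case: ifPn => // mr; rewrite big_cons (negbTE mr) scale0r add0r.
Qed.

Lemma Pol_ext x y : Pol I x -> Pol I y -> (forall m, coord m x = coord m y) -> x = y.
Proof.
move=> px py xy; apply/eqP; rewrite -subr_eq0; apply/eqP.
have [|r [_ ->]] := @Pol_support (x - y).
  by rewrite addrC -scaleN1r; exact: PolD.
rewrite big1// => m _; rewrite addrC -scaleN1r coordD xy mulN1r addNr.
by rewrite scale0r.
Qed.

(** A chosen finite list of indices that carries [x], empty outside [Pol]: maps defined by summation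
    over it are total, with value 0 outside [Pol]. *)
Definition csupp (x : G) : seq coeff_idx :=
  if pselect (Pol I x) is left px then projT1 (cid (Pol_support px)) else [::].

Lemma csupp_uniq x : uniq (csupp x).
Proof.
by rewrite /csupp; case: pselect => // px; case: cid => r [].
Qed.

Lemma csuppE x : Pol I x -> x = \sum_(m <- csupp x) coord m x *: coeff m.
Proof.
by rewrite /csupp; case: pselect => // px _; case: cid => r [].
Qed.

Lemma csupp_out x m : Pol I x -> m \notin csupp x -> coord m x = 0.
Proof.
move=> px mr; rewrite {1}(csuppE px) coord_sum ?csupp_uniq//.
by rewrite (negbTE mr).
Qed.

(* The antilinear map [e_m |-> s_m e_(m^T)]. *)
Definition flip_map (s : coeff_idx -> C) (x : G) : G :=
  \sum_(m <- csupp x) (s m * Num.conj (coord m x)) *: coeff (coeff_flip m).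

Lemma flip_map_Pol s x : Pol I (flip_map s x).
Proof.
rewrite /flip_map; elim: (csupp x) => [|m r IH]; first by rewrite big_nil; exact: Pol0.
by rewrite big_cons; apply: PolD => //; exact: coeff_in_Pol.
Qed.

Lemma coord_flip s x m : Pol I x ->
  coord m (flip_map s x) = s (coeff_flip m) * Num.conj (coord (coeff_flip m) x).
Proof.
move=> px.
have E (r : seq coeff_idx) (c : coeff_idx -> C) : uniq r ->
    coord m (\sum_(n <- r) c n *: coeff (coeff_flip n)) = if coeff_flip m \in r then c (coeff_flip m) else 0.
  elim: r => [|n r IH]; first by rewrite big_nil coord0.
  rewrite big_cons coordD coord_coeff /= => /andP[nr ur]; rewrite IH// in_cons.
  rewrite -(inj_eq (can_inj coeff_flipK) (coeff_flip n)) coeff_flipK eq_sym.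
  have [->|_] /= := eqVneq (coeff_flip m) n; last by rewrite mulr0 add0r.
  by rewrite (negbTE nr) mulr1 addr0.
rewrite /flip_map E ?csupp_uniq//; case: ifPn => // mr.
by rewrite (csupp_out px mr) conjC0 mulr0.
Qed.

End Coordinates.

(** * The maps [kappa] and [theta] and their algebraic properties *)

Section Theta.
Variables (R : realType) (G : compact_quantum_group R) (h : {scalar G}).
Hypothesis hh : haar_state h.
Variables (I : irr_family G) (Q : forall pi : I, 'M[R[i]]_(irr_dim pi)).
Hypothesis hQ : modular_matrices h Q.
Local Notation C := R[i].
Local Notation Pol := (Pol I).
Local Notation coeff := (coeff Q).
Local Notation coord := (coord h Q).
Local Notation flip_map := (flip_map hh hQ).
Local Notation wt := (coeff_wt Q).

Definition antilin (f : G -> G) := forall c x y, Pol x -> Pol y ->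
  f (c *: x + y) = Num.conj c *: f x + f y.

Lemma antilin0 f : antilin f -> f 0 = 0.
Proof.
move=> fl; have := fl (-1) 0 0 (Pol0 I) (Pol0 I).
by rewrite scaler0 addr0 rmorphN1 scaleN1r addNr.
Qed.

Lemma antilinZ f c x : antilin f -> Pol x -> f (c *: x) = Num.conj c *: f x.
Proof.
by move=> fl px; have := fl c x 0 px (Pol0 I); rewrite addr0 (antilin0 fl) addr0.
Qed.

Lemma flip_mapD s : antilin (flip_map s).
Proof.
move=> c x y px py; apply: (Pol_ext hh hQ).
- exact: flip_map_Pol.
- by apply: PolD; exact: flip_map_Pol.
move=> m; rewrite coordD !coord_flip//; last exact: PolD.
by rewrite coordD rmorphD rmorphM/= mulrDr mulrCA.
Qed.

Lemma flip_map_coeff s m : flip_map s (coeff m) = s m *: coeff (coeff_flip m).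
Proof.
apply: (Pol_ext hh hQ).
- exact: flip_map_Pol.
- by apply: PolZ; exact: coeff_in_Pol.
move=> n; rewrite coord_flip; last exact: coeff_in_Pol.
rewrite -[s m *: _]addr0 coordD coord0 addr0 !(coord_coeff hh hQ) rmorph_nat.
rewrite -(inj_eq (can_inj (@coeff_flipK _ _ I)) (coeff_flip m)) coeff_flipK.
by have [->|_] := eqVneq m (coeff_flip n); last rewrite !mulr0.
Qed.

(** Products of coefficients are coefficients of tensor products, and every unitary representation
    has its coefficients in [Pol]. *)
Lemma PolM x y : Pol x -> Pol y -> Pol (x * y).
Proof.
move=> px py; elim/(Pol_ind (Q := Q)) : x / px => [|c m x _ pxy].
  by rewrite mul0r; exact: Pol0.
rewrite mulrDl -scalerAl; apply: PolD => //.
elim/(Pol_ind (Q := Q)) : y / py {pxy} => [|d n y _ pxy].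
  by rewrite mulr0; exact: Pol0.
rewrite mulrDr -scalerAr; apply: PolD => //.
have um := eirr_unitary Q (projT1 m); have un := eirr_unitary Q (projT1 n).
have := coeff_Pol I (enum_rank ((projT2 m).1, (projT2 n).1))
  (enum_rank ((projT2 m).2, (projT2 n).2)) (tensor_rep_unitary um un).
by rewrite tensor_repE.
Qed.

(** A nonzero multiple of the adjoint of a coefficient is a coefficient of [conj_rep]. *)
Lemma Pol_star x : Pol x -> Pol (star x).
Proof.
elim/(Pol_ind (Q := Q)) => [|c m y _ py]; first by rewrite star0; exact: Pol0.
rewrite starD starZ; apply: PolD => //.
have := coeff_Pol I (projT2 m).1 (projT2 m).2 (conj_rep_unitary hh hQ (projT1 m)).
rewrite mxE; set a := _%:C => pa.
have a0 : a != 0.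
  by rewrite (inj_eq (@complexI R)) gt_eqF// sqrtr_gt0; exact: (coeff_wt_gt0 hQ m).
by rewrite -[star _]scale1r -(mulVf a0) -scalerA; apply: PolZ.
Qed.

Lemma Pol1 : Pol 1.
Proof. by have := coeff_Pol I 0 0 (trivial_rep G); rewrite mxE eqxx. Qed.

Definition kappa := flip_map (fun=> 1).

Lemma kappaD : antilin kappa. Proof. exact: flip_mapD. Qed.

Lemma kappa_coeff m : kappa (coeff m) = coeff (coeff_flip m).
Proof. by rewrite /kappa flip_map_coeff scale1r. Qed.

Lemma antilin_sum f (J : Type) (r : seq J) (c : J -> C) (x : J -> G) : antilin f ->
  (forall j, Pol (x j)) ->
  f (\sum_(j <- r) c j *: x j) = \sum_(j <- r) Num.conj (c j) *: f (x j).
Proof.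
move=> fl px.
suff [] : Pol (\sum_(j <- r) c j *: x j) /\ f (\sum_(j <- r) c j *: x j) =
  \sum_(j <- r) Num.conj (c j) *: f (x j) by [].
elim: r => [|j r [IH1 IH2]].
  by rewrite !big_nil antilin0//; split=> //; exact: Pol0.
by rewrite !big_cons fl// IH2; split=> //; exact: PolD.
Qed.

(** Antilinearity conjugates T_ik conj(T_jl), which amounts to exchanging i and j, so the rule v_ij
    |-> v_ji survives the change of basis. In particular [kappa] does not depend on the eigenbasis
    of Q through which it is defined. *)
Lemma kappa_conj m n (T : 'M[C]_(m, n)) (v : 'M[G]_n) i j :
  (forall k l, Pol (v k l) /\ kappa (v k l) = v l k) ->
  kappa ((scmx G T *m v *m scmx G (T ^t*)%sesqui) i j) =
  (scmx G T *m v *m scmx G (T ^t*)%sesqui) j i.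
Proof.
move=> hv; rewrite !conj_entry.
rewrite (eq_bigr (fun k => 1 *: \sum_l (T i k * Num.conj (T j l)) *: v k l))
  => [|k _]; last by rewrite scale1r.
rewrite (antilin_sum _ _ kappaD) => [|k]; last first.
  by apply: lin_span_sum => l; exact: (hv k l).1.
rewrite [RHS]exchange_big; apply: eq_bigr => k _; rewrite conjC1 scale1r.
rewrite (antilin_sum _ _ kappaD) => [|l]; last exact: (hv k l).1.
apply: eq_bigr => l _; rewrite rmorphM/= conjCK mulrC.
by congr (_ *: _); exact: (hv k l).2.
Qed.

Lemma kappa_rep n (v : 'M[G]_n) i j : unitary_rep v -> kappa (v i j) = v j i.
Proof.
move=> uv.
suff : forall i j, Pol (v i j) /\ kappa (v i j) = v j i by move=> /(_ i j)[].
move: n v uv {i j}; apply: (@unitary_rep_ind R G I (fun n v =>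
  forall i j, Pol (v i j) /\ kappa (v i j) = v j i)).
- by move=> v [].
- move=> pi i j; split; first by apply: lin_span_in; exists pi, i, j.
  rewrite (irr_eirr Q); apply: kappa_conj => k l; split.
    exact: (coeff_in_Pol Q (coeff_at k l)).
  exact: (kappa_coeff (coeff_at k l)).
- move=> m n T v hv i j; split; last exact: kappa_conj.
  rewrite conj_entry (eq_bigr (fun k => 1 *: \sum_l (T i k * Num.conj (T j l)) *: v k l))
    => [|k _]; last by rewrite scale1r.
  by apply: lin_span_sum => k; apply: lin_span_sum => l; exact: (hv k l).1.
- move=> n v w hv hw i j; rewrite !mxE -[v i j]scale1r; split.
    by apply: PolD; [exact: (hv i j).1|exact: (hw i j).1].
  rewrite kappaD; [|exact: (hv i j).1|exact: (hw i j).1].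
  by rewrite conjC1 scale1r (hv i j).2 (hw i j).2.
Qed.

Lemma kappa_Pol x : Pol (kappa x).
Proof. exact: flip_map_Pol. Qed.

Definition mul_on_Pol (f : G -> G) :=
  forall x y, Pol x -> Pol y -> f (x * y) = f x * f y.

Lemma antilin_mul f : antilin f ->
  (forall m n, f (coeff m * coeff n) = f (coeff m) * f (coeff n)) -> mul_on_Pol f.
Proof.
move=> fl fM x y px py; elim/(Pol_ind (Q := Q)) : x / px => [|c m x px fxy].
  by rewrite mul0r antilin0// mul0r.
have pm := coeff_in_Pol Q m.
rewrite mulrDl -scalerAl !fl// ?fxy; [|exact: PolM|exact: PolM].
rewrite mulrDl -scalerAl; congr (_ *: _ + _).
elim/(Pol_ind (Q := Q)) : y / py {fxy} => [|d n y py fy].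
  by rewrite mulr0 antilin0// mulr0.
have pn := coeff_in_Pol Q n.
rewrite mulrDr -scalerAr !fl// ?fy; [|exact: PolM|exact: PolM].
by rewrite mulrDr -scalerAr fM.
Qed.

Lemma kappaM : mul_on_Pol kappa.
Proof.
apply: antilin_mul; first exact: kappaD.
move=> m n.
have um := eirr_unitary Q (projT1 m); have un := eirr_unitary Q (projT1 n).
have := kappa_rep (enum_rank ((projT2 m).1, (projT2 n).1))
  (enum_rank ((projT2 m).2, (projT2 n).2)) (tensor_rep_unitary um un).
by rewrite !tensor_repE -!/(coeff _) => ->; rewrite !kappa_coeff.
Qed.

Lemma kappa1 : kappa 1 = 1.
Proof. by have := kappa_rep 0 0 (trivial_rep G); rewrite mxE eqxx. Qed.

Lemma coeff_wt_flip m : wt (coeff_flip m) = (wt m)^-1.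
Proof. by rewrite invf_div. Qed.

(** [kappa] transposes the unitary representation [conj_rep], whose weights at [m] and at the
    transposed index are the square roots of [wt m] and of its inverse; their quotient is the
    factor. *)
Lemma kappa_star_coeff m : kappa (star (coeff m)) = ((wt m)^-1)%:C *: star (coeff (coeff_flip m)).
Proof.
have := kappa_rep (projT2 m).1 (projT2 m).2 (conj_rep_unitary hh hQ (projT1 m)).
rewrite !conj_repE.
rewrite -[eirr _ _ _ _]/(coeff m) -[X in _ = _ *: star X]/(coeff (coeff_flip m)).
rewrite -[eigQ _ _ / eigQ _ _]/(wt m) -[X in _ = (Num.sqrt X)%:C *: _]/(wt (coeff_flip m)).
have w0 := coeff_wt_gt0 hQ m.
have s0 : Num.sqrt (wt m) != 0 by rewrite gt_eqF ?sqrtr_gt0.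
rewrite coeff_wt_flip (antilinZ _ kappaD); last by apply: Pol_star; exact: coeff_in_Pol.
rewrite conj_real => /(congr1 (fun z => ((Num.sqrt (wt m))^-1)%:C *: z)).
rewrite !scalerA -!rmorphM mulVf// scale1r => ->; congr (_%:C *: _).
by rewrite sqrtrV ?ltW// -expr2 exprVn sqr_sqrtr// ltW.
Qed.

Definition scaling x := star (kappa (star (kappa x))).

Lemma scalingD c x y : Pol x -> Pol y -> scaling (c *: x + y) = c *: scaling x + scaling y.
Proof.
move=> px py; rewrite /scaling kappaD// starD starZ conjCK kappaD ?starD ?starZ ?conjCK//.
- by apply: Pol_star; exact: kappa_Pol.
- by apply: Pol_star; exact: kappa_Pol.
Qed.

Lemma scalingM x y : Pol x -> Pol y -> scaling (x * y) = scaling x * scaling y.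
Proof.
move=> px py; rewrite /scaling kappaM// starM kappaM ?starM//.
- by apply: Pol_star; exact: kappa_Pol.
- by apply: Pol_star; exact: kappa_Pol.
Qed.

Lemma scaling_coeff m : scaling (coeff m) = (wt m)%:C *: coeff m.
Proof.
rewrite /scaling kappa_coeff kappa_star_coeff coeff_flipK starZ starK conj_real coeff_wt_flip.
by rewrite invrK.
Qed.

Lemma scaling_star_coeff m : scaling (star (coeff m)) = ((wt m)^-1)%:C *: star (coeff m).
Proof.
rewrite /scaling kappa_star_coeff starZ starK conj_real.
rewrite (antilinZ _ kappaD); last exact: coeff_in_Pol.
by rewrite -/kappa kappa_coeff coeff_flipK starZ conjCK.
Qed.

Lemma coord_scaling m x : Pol x -> coord m (scaling x) = (wt m)%:C * coord m x.
Proof.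
elim/(Pol_ind (Q := Q)) => [|c n y py IH].
  by rewrite /scaling (antilin0 kappaD) star0 (antilin0 kappaD) star0 coord0 mulr0.
rewrite scalingD//; last exact: coeff_in_Pol.
rewrite coordD IH coordD scaling_coeff -[_ *: coeff n]addr0 coordD coord0 addr0.
rewrite (coord_coeff hh hQ) mulrDr; congr (_ + _).
by have [->|_] := eqVneq n m; [ring|rewrite !mulr0].
Qed.

Definition theta := flip_map (fun m => ((Num.sqrt (wt m))^-1)%:C).

Lemma thetaD : antilin theta. Proof. exact: flip_mapD. Qed.

Lemma theta_Pol x : Pol (theta x). Proof. exact: flip_map_Pol. Qed.

Lemma theta_coeff m : theta (coeff m) = ((Num.sqrt (wt m))^-1)%:C *: coeff (coeff_flip m).
Proof. exact: flip_map_coeff. Qed.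

(* On the spectral subspaces of [scaling], [theta] is a multiple of [kappa]. *)
Lemma theta_weight (w : R) x : Pol x -> scaling x = w%:C *: x ->
  theta x = ((Num.sqrt w)^-1)%:C *: kappa x.
Proof.
move=> px tx; apply: (Pol_ext hh hQ); [exact: theta_Pol|by apply: PolZ; exact: kappa_Pol|].
move=> m; rewrite -[_ *: kappa x]addr0 coordD coord0 addr0 !coord_flip// mul1r.
have := coord_scaling (coeff_flip m) px; rewrite tx -[_ *: x]addr0 coordD coord0 addr0.
have [->|x0 /(mulIf x0)/complexI -> //] := eqVneq (coord (coeff_flip m) x) 0.
by rewrite conjC0 !mulr0.
Qed.

(** A product of two coefficients is in general not a multiple of one, but it is an eigenvector of
    [scaling] for the product of the eigenvalues; there [theta_weight] reduces the claim to
    [kappaM]. *)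
Lemma thetaM : mul_on_Pol theta.
Proof.
apply: antilin_mul; first exact: thetaD.
move=> m n; have pm := coeff_in_Pol Q m; have pn := coeff_in_Pol Q n.
rewrite (@theta_weight (wt m * wt n)); [|exact: PolM|]; last first.
  by rewrite scalingM// !scaling_coeff -scalerAl -scalerAr scalerA -rmorphM.
rewrite kappaM// !theta_coeff !kappa_coeff -[in RHS]scalerAl -[in RHS]scalerAr.
rewrite [in RHS]scalerA -[in RHS]rmorphM.
by rewrite sqrtrM ?invfM// ltW// (coeff_wt_gt0 hQ).
Qed.

Lemma theta1 : theta 1 = 1.
Proof.
rewrite (@theta_weight 1); [|exact: Pol1|].
  by rewrite sqrtr1 invr1 scale1r kappa1.
by rewrite /scaling kappa1 star1 kappa1 star1 scale1r.
Qed.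

Lemma theta_star x : Pol x -> theta (star x) = star (theta x).
Proof.
elim/(Pol_ind (Q := Q)) => [|c m y py IH].
  by rewrite star0 antilin0 ?star0//; exact: thetaD.
have pm := coeff_in_Pol Q m.
rewrite starD starZ !thetaD//; [|exact: Pol_star|exact: Pol_star].
rewrite IH starD starZ; congr (_ *: _ + _).
rewrite (@theta_weight (wt m)^-1); [|exact: Pol_star|]; last exact: scaling_star_coeff.
have w0 := ltW (coeff_wt_gt0 hQ m).
rewrite kappa_star_coeff theta_coeff starZ conj_real scalerA -rmorphM.
rewrite sqrtrV// invrK -{2}(sqr_sqrtr w0) expr2 invfM mulrA divff ?mul1r//.
by rewrite gt_eqF// sqrtr_gt0 (coeff_wt_gt0 hQ).
Qed.

Lemma thetaK x : Pol x -> theta (theta x) = x.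
Proof.
elim/(Pol_ind (Q := Q)) => [|c m y py IH].
  by rewrite !antilin0//; exact: thetaD.
have pm := coeff_in_Pol Q m.
rewrite !thetaD//; [|exact: theta_Pol|exact: theta_Pol].
rewrite IH conjCK; congr (_ *: _ + _).
rewrite theta_coeff (antilinZ _ thetaD); last exact: coeff_in_Pol.
rewrite theta_coeff coeff_flipK scalerA conj_real -rmorphM coeff_wt_flip.
rewrite sqrtrV ?invrK ?mulVf ?scale1r//; last by rewrite ltW// (coeff_wt_gt0 hQ).
by rewrite gt_eqF// sqrtr_gt0 (coeff_wt_gt0 hQ).
Qed.

(** On the basis, the squared factor q_j / q_i of [theta] turns q_i / Tr(Q), the value of [h] at
    e_ji e_ji^*, into q_j / Tr(Q), its value at e_ij e_ij^*. *)
Lemma haar_theta_mul x y : Pol x -> Pol y ->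
  h (theta x * star (theta y)) = Num.conj (h (x * star y)).
Proof.
move=> px py; elim/(Pol_ind (Q := Q)) : x / px => [|c m x px IH].
  by rewrite antilin0 ?mul0r ?linear0 ?conjC0//; exact: thetaD.
have pm := coeff_in_Pol Q m.
rewrite thetaD// !mulrDl -!scalerAl !hD rmorphD rmorphM/= IH; congr (_ * _ + _).
elim/(Pol_ind (Q := Q)) : y / py {IH} => [|d n y py IH].
  by rewrite antilin0 ?star0 ?mulr0 ?linear0 ?conjC0//; exact: thetaD.
have pn := coeff_in_Pol Q n.
rewrite thetaD// !starD !starZ !mulrDr -!scalerAr !hD rmorphD rmorphM/= IH; congr (_ * _ + _).
rewrite !theta_coeff starZ conj_real -scalerAl -scalerAr scalerA hZ !(coeff_orth hh hQ).
rewrite (inj_eq (can_inj (@coeff_flipK _ _ I))).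
have [->|_] := eqVneq m n; last by rewrite !mul0r mulr0 conjC0.
rewrite !mul1r conj_real -!rmorphM; congr (_%:C).
rewrite -invfM -expr2 sqr_sqrtr; last by rewrite ltW// (coeff_wt_gt0 hQ).
rewrite /coeff_wt /coeff_norm invf_div /= mulrA divfK//.
exact: (eigQ_ne0 hQ).
Qed.

Lemma haar_theta x : Pol x -> h (theta x) = Num.conj (h x).
Proof.
move=> px; have := haar_theta_mul px Pol1.
by rewrite theta1 star1 !mulr1.
Qed.

End Theta.

(** * The Peter-Weyl theorem *)

Lemma blin_tw_fun0 (R : realType) (tau : R[i] -> R[i]) (X B : lmodType R[i])
    (NX : X -> R) (NB : B -> R) (f : X -> B) : is_norm NX -> is_norm NB ->
  blin_tw tau NX NB f -> f 0 = 0.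
Proof.
move=> hX hB [_ [M M0 fM]]; apply: (norm_eq0 hB).
by apply/eqP; rewrite eq_le (norm_ge0 hB) andbT (le_trans (fM _))// (norm0 hX) mulr0.
Qed.

Lemma blin_tw_closed0 (R : realType) (tau : R[i] -> R[i]) (X B : lmodType R[i])
    (NX : X -> R) (NB : B -> R) (f : X -> B) x : is_norm NX -> is_norm NB ->
  blin_tw tau NX NB f ->
  (forall e : R, 0 < e -> exists2 y, f y = 0 & NX (x - y) < e) -> f x = 0.
Proof.
move=> hX hB fb hx; apply: (norm_small hB) => e e0.
have f0 := blin_tw_fun0 hX hB fb.
have [fl [M M0 fM]] := fb.
have M1 : 0 < M + 1 by rewrite ltr_wpDl.
have [y fy xy] := hx _ (divr_gt0 e0 M1).
have fxy : f (x - y) = f x.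
  have h1 := fl 1 (x - y) y; rewrite scale1r subrK fy addr0 in h1.
  have h5 := fl 1 y (x - y).
  rewrite fy scaler0 add0r scale1r addrC subrK in h5.
  by [].
rewrite -fxy (le_trans (fM _))//.
rewrite (le_trans (ler_wpM2l M0 (ltW xy)))//.
have -> : M * (e / (M + 1)) = e * (M / (M + 1)) by rewrite mulrCA mulrA.
by rewrite ler_piMr ?(ltW e0)// ler_pdivrMr// mul1r lerDl.
Qed.

Section PeterWeyl.
Variables (R : realType) (G : compact_quantum_group R) (h : {scalar G}).
Hypothesis hh : haar_state h.
Variable L2 : gns_triple h.
Variables (I : irr_family G) (Q : forall pi : I, 'M[R[i]]_(irr_dim pi)).
Hypothesis hQ : modular_matrices h Q.
Local Notation C := R[i].
Local Notation H := (gns_space L2).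
Local Notation AA := (CG2 G).
Local Notation N := (@cnorm R G).
Local Notation N2 := (@cnorm R AA).
Local Notation NH := (@nrm R H).
Local Notation t := (@tens R G).
Local Notation iota := (gns_map L2).
Local Notation U := (reg_coeff hh (L2 := L2)).
Local Notation Om := (vec_slice hh (L2 := L2)).
Local Notation conv := (convop hh (L2 := L2)).
Local Notation conv2 := (convop2 hh (L2 := L2)).
Let tP : min_tensor t := tensP G.

Lemma blin_h : blin_tw id N (@nrm R R[i]^o) h.
Proof. by split; [exact: hD|exists 1 => // x; rewrite mul1r (h_le hh L2)]. Qed.

(** Both sides are (h (x) h)((a (x) b) Z). *)
Lemma haar_fubini K s K' s' : is_slice t h K s ->
  is_slice (fun b a => t a b) h K' s' -> forall a b Z,
  h (b * s (t a 1 * Z)) = h (a * s' (t 1 b * Z)).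
Proof.
move=> hs hs' a b.
have b1 := blin_tw_comp blin_h (blin_tw_comp (blin_tw_mull b)
  (blin_tw_comp (blin_tw_slice hs) (blin_tw_mull (t a 1)))).
have b2 := blin_tw_comp blin_h (blin_tw_comp (blin_tw_mull a)
  (blin_tw_comp (blin_tw_slice hs') (blin_tw_mull (t 1 b)))).
apply: (blin_tw_eq (cnorm_is_norm _) (nrm_is_norm _) b1 b2 (tens_dense tP)).
move=> _ [x [y ->]] /=; rewrite !(tensM tP) !mul1r (slice_tens hs) (slice_tens hs').
by rewrite -!scalerAr !hZ mulrC.
Qed.

(** A Fourier coefficient of a convolution depends on y only through inner products with
    coefficients of the same class. Right invariance at e_kj^* y gives h(e_kj^* y) 1 = sum_l e_kl^*
    r_l, and [eirr_sum_mul_star] solves this system for r_i. *)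
Lemma coeff_U_iota pi i j c y :
  (eigQ Q i)%:C * h (star (eirr Q pi i j) * U (iota c) (iota y)) =
  \sum_k ((eigQ Q k)%:C * h (star c * eirr Q pi k i)) *
    dot (iota y) (iota (eirr Q pi k j)).
Proof.
have uE := eirr_unitary Q pi.
have [K [s [hs _ sc]]] := haar_slice_l hh.
have [K' [s' [hs' sc']]] := haar_slice_r hh.
pose r l := s' (t 1 (star (eirr Q pi l j)) * comul G y).
rewrite U_iota (Om_iota _ _ hs) (haar_fubini hs hs') -/(r i).
have sr k : h (star (eirr Q pi k j) * y) *: 1 = \sum_l star (eirr Q pi k l) * r l.
  rewrite -sc' comulM (comul_rep_star k j uE) mulr_suml (slice_sum hs').
  apply: eq_bigr => l _.
  rewrite -[t (star _) _]mulr1 -(mul1r (star (eirr Q pi l j))) -[X in t X _]mulr1.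
  rewrite -(tensM tP) mulr1 -mulrA.
  exact: (sliceMl (min_tensor_flip tP) hs').
have -> : \sum_k ((eigQ Q k)%:C * h (star c * eirr Q pi k i)) *
    dot (iota y) (iota (eirr Q pi k j)) =
  h (star c * \sum_k (eigQ Q k)%:C *: (eirr Q pi k i * (h (star (eirr Q pi k j) * y) *: 1))).
  rewrite mulr_sumr linear_sum/=; apply: eq_bigr => k _.
  by rewrite -scalerAr hZ -scalerAr mulr1 -scalerAr hZ dot_iota; ring.
rewrite -hZ scalerAr; congr (h (star c * _)).
under eq_bigr => k _ do rewrite sr mulr_sumr scaler_sumr.
rewrite exchange_big (bigD1 i)//= [X in _ + X]big1 ?addr0 => [|l li].
  under eq_bigr => k _ do rewrite mulrA scalerAl.
  by rewrite -mulr_suml (eirr_sum_mul_star hh hQ) eqxx mul1r -scalerAl mul1r.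
under eq_bigr => k _ do rewrite mulrA scalerAl.
rewrite -mulr_suml (eirr_sum_mul_star hh hQ) (negbTE li) mul0r scale0r.
by rewrite mul0r.
Qed.

(** The condition bears on the coefficients U eta xi rather than on xi. It is then stable under
    [conv2] by [U_conv2], and it can be tested against coefficients of xi that are themselves found
    to lie in [Pol]. *)
Definition orthPol : set H :=
  [set xi | forall eta p, Pol I p -> h (star p * U eta xi) = 0].

Lemma blin_hU eta p : blin_tw id NH (@nrm R R[i]^o) (fun xi => h (star p * U eta xi)).
Proof. exact: (blin_tw_comp blin_h (blin_tw_comp (blin_tw_mull _) (blin_U hh eta))). Qed.

Lemma coeff_U m c : exists2 p, Pol I p &
  forall xi, h (star (coeff Q m) * U (iota c) xi) = dot xi (iota p).
Proof.
case: m => pi [i j].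
pose a k := (eigQ Q k)%:C * h (star c * eirr Q pi k i) / (eigQ Q i)%:C.
exists (\sum_k Num.conj (a k) *: eirr Q pi k j).
  by apply: lin_span_sum => k; exact: (coeff_in_Pol Q (coeff_at k j)).
apply: (iota_eq (nrm_is_norm _) (blin_hU _ _) (blin_tw_dotl _)) => y.
have q0 : (eigQ Q i)%:C != 0 :> C by rewrite (inj_eq (@complexI R)) (eigQ_ne0 hQ).
apply: (mulfI q0); rewrite coeff_U_iota.
have iS n (b : 'I_n -> C) (x : 'I_n -> G) :
    iota (\sum_k b k *: x k) = \sum_k b k *: iota (x k).
  elim: n b x => [|n IH] b x; first by rewrite !big_ord0 iota0.
  by rewrite !big_ord_recl iotaD IH.
rewrite iS dot_sumr mulr_sumr; apply: eq_bigr => k _.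
by rewrite dotZr conjCK /a; field.
Qed.

(** By [coeff_U], orthogonality to [Pol] in L^2 passes to the coefficients U (iota c) xi; density of
    the vectors iota c gives all eta. *)
Lemma orthPolP xi : (forall p, Pol I p -> dot xi (iota p) = 0) -> orthPol xi.
Proof.
move=> xo eta p pp.
move: p pp; apply: (Pol_ind (Q := Q)) => [|c m y py IH].
  by rewrite star0 mul0r linear0.
rewrite starD starZ mulrDl -scalerAl hD IH addr0.
suff -> : h (star (coeff Q m) * U eta xi) = 0 by rewrite mulr0.
have b1 : blin_tw (id \o (id \o Num.conj)) NH (@nrm R R[i]^o)
    (fun eta => h (star (coeff Q m) * U eta xi)).
  exact: blin_tw_comp blin_h (blin_tw_comp (blin_tw_mull _) (blin_Ul hh xi)).
apply: (blin_tw_closed0 (nrm_is_norm _) (nrm_is_norm _) b1) => e e0.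
have [_ [c' _ <-] d] := @iota_dense _ _ _ L2 eta _ e0.
by exists (iota c') => //; have [p' pp' ->] := coeff_U m c'; rewrite xo.
Qed.

Lemma orthPolD c x y : orthPol x -> orthPol y -> orthPol (c *: x + y).
Proof.
move=> hx hy eta p pp; have [bl _] := blin_hU eta p.
by rewrite bl hx// hy// scaler0 addr0.
Qed.

Lemma orthPol_closed x :
  (forall e : R, 0 < e -> exists2 y, orthPol y & NH (x - y) < e) -> orthPol x.
Proof.
move=> hx eta p pp.
apply: (blin_tw_closed0 (nrm_is_norm _) (nrm_is_norm _) (blin_hU eta p)) => e e0.
by have [y yo xy] := hx e e0; exists y => //; exact: yo.
Qed.

Lemma orthPol_conv2 c x : orthPol x -> orthPol (conv2 c x).
Proof. by move=> xo eta p pp; rewrite -U_conv2 xo. Qed.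

(** The number <xi, iota y> is [h] of the operator [S] at Delta(y)^*. Replacing Delta(y) by an
    elementary tensor c (x) w gives <conv c xi, iota w> = 0, and these tensors are total. *)
Lemma conv_eq0 xi : (forall c, conv c xi = 0) -> xi = 0.
Proof.
move=> c0; apply: (dot0_norm_dense (@iota_dense _ _ _ L2)) => _ [y _ <-].
have b1 := blin_tw_comp blin_h (blin_tw_comp (blin_Sl hh xi) (@blin_tw_star R AA)).
have b0 : blin_tw (id \o (id \o Num.conj)) N2 (@nrm R R[i]^o) (fun=> 0).
  exact: (blin_tw0 _ _ (nrm_is_norm R[i]^o)).
have E := blin_tw_eq (cnorm_is_norm _) (nrm_is_norm _) b1 b0 (tens_dense tP).
have /= := E _ (comul G y); rewrite S_star_comul hZ (haar1 hh) mulr1; apply.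
move=> _ [c [w ->]] /=; rewrite S_star_tens -(dot_iota L2).
by have := c0 c; rewrite /convop => ->; rewrite dot0l.
Qed.

(* [(phi (x) id) D (U eta xi) = U (theta eta) xi] where the functional
   [xi |-> phi (U eta xi)] is represented by the vector [theta eta]: this is
   coassociativity. *)
Lemma slice_comul_U phi K s : is_slice t phi K s ->
  exists theta : H -> H, (forall eta xi, phi (U eta xi) = dot xi (theta eta)) /\
    forall eta xi, s (comul G (U eta xi)) = U (theta eta) xi.
Proof.
move=> hs; have [K0 _ _ _] := hs.
have phiE a : s (t a 1) = phi a *: 1 by rewrite (slice_tens hs).
have phiD c x y : phi (c *: x + y) = c * phi x + phi y.
  apply/eqP; rewrite -subr_eq0; apply/eqP; apply: (nrm0_eq0 (V := R[i]^o)).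
  rewrite -[nrm _]mulr1 -(cnorm1 G) -cnormZ scalerBl scalerDl -scalerA -!phiE.
  by rewrite (tensDl tP) (sliceD hs) subrr (norm0 (cnorm_is_norm G)).
have phiM x : ab (phi x) <= K * N x.
  rewrite -[ab _]mulr1 -(cnorm1 G) -cnormZ -phiE (le_trans (slice_le hs _))//.
  by rewrite ler_wpM2l// (tens_lel tP).
have bphi : blin_tw id N (@nrm R R[i]^o) phi by split; [exact: phiD|exists K].
have /choice[theta thE] : forall eta, exists th, forall xi, phi (U eta xi) = dot xi th.
  move=> eta; have [fl [M M0 fM]] := blin_tw_comp bphi (blin_U hh eta).
  exact: (riesz fl fM).
exists theta; split=> // eta xi.
have bth : blin_tw id NH NH theta.
  split=> [c x y|].
    apply: dot_extr => z; rewrite -thE UDl phiD !thE dotDr dotZr.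
    by [].
  exists K => // x; apply: nrm_le_dot => [|y]; first by rewrite mulr_ge0 ?nrm_ge0.
  rewrite dotC abJ -thE (le_trans (phiM _))// -mulrA ler_wpM2l//.
  exact: U_le.
have bs := blin_tw_slice hs.
have b1 (z : H) := blin_tw_comp bs (blin_tw_comp (blin_comul G) (blin_Ul hh z)).
have b2 z := blin_tw_comp (blin_Ul hh z) bth.
apply: (iota_eq (f := fun eta => s (comul G (U eta xi))) (cnorm_is_norm _) (b1 xi) (b2 xi)) => c /=.
have b3 := blin_tw_comp bs (blin_tw_comp (blin_comul G) (blin_U hh (iota c))).
apply: (iota_eq (cnorm_is_norm _) b3 (blin_U hh _)) => y /=.
rewrite -(Lam_comul hh L2) U_iota.
have b4 := blin_tw_comp bs (blin_Lam hh L2 c).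
apply: (blin_tw_eq (cnorm_is_norm _) (cnorm_is_norm _) b4
  (blin_tw_slice (OmP hh _)) (tens_dense tP)).
move=> _ [a [b ->]] /=; rewrite Lam_tens (slice_tens hs) (slice_tens (OmP hh _)).
by rewrite thE.
Qed.

Lemma UZr eta c x : U eta (c *: x) = c *: U eta x.
Proof.
have := UDr hh eta c x 0; rewrite !addr0.
by rewrite (blin_tw_fun0 (nrm_is_norm _) (cnorm_is_norm _) (blin_U hh eta)) addr0.
Qed.

Lemma UZl xi c x : U (c *: x) xi = Num.conj c *: U x xi.
Proof.
have := UDl hh c x 0 xi; rewrite !addr0.
by rewrite (blin_tw_fun0 (nrm_is_norm _) (cnorm_is_norm _) (blin_Ul hh xi)) addr0.
Qed.

(** * The representation carried by an eigenspace *)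

Section Eigenspace.
Variables (c : G) (l : R).
Variables (m : nat) (e : 'I_m -> H).
Hypotheses (eK : forall i, conv2 c (e i) = l%:C *: e i)
  (eon : forall i j, dot (e i) (e j) = (i == j)%:R)
  (ebasis : forall x, conv2 c x = l%:C *: x -> x = \sum_i dot x (e i) *: e i).

(** Both maps vanish on the range of conv2 - l, which is dense in the orthogonal complement of the
    eigenspace; on the eigenspace itself they are compared on a basis. *)
Lemma eigenspace_ext (tau : C -> C) (f g : H -> G) :
  blin_tw tau NH N f -> blin_tw tau NH N g ->
  (forall y, f (conv2 c y) = f (l%:C *: y)) ->
  (forall y, g (conv2 c y) = g (l%:C *: y)) -> (forall i, f (e i) = g (e i)) ->
  forall x, f x = g x.
Proof.
move=> bf bg ff gg fg x; apply/eqP; rewrite -subr_eq0; apply/eqP.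
have bn : blin_tw tau NH N (fun x => f x - g x).
  have [gl [M M0 gM]] := bg.
  apply: blin_twD => //; first exact: cnorm_is_norm.
  split=> [a y z|]; first by rewrite gl opprD scalerN.
  by exists M => // y; rewrite (normN (cnorm_is_norm G)).
have [nl _] := bn.
pose x0 := x - \sum_i dot x (e i) *: e i.
have nx0 : f x0 - g x0 = 0.
  apply: (blin_tw_closed0 (nrm_is_norm _) (cnorm_is_norm _) bn) => d d0.
  have xo y : conv2 c y = l%:C *: y -> dot x0 y = 0.
    move=> /ebasis ->; rewrite dot_sumr big1// => i _; rewrite dotZr.
    rewrite dotBl dot_suml (bigD1 i)//= big1 => [|j ji]; last first.
      by rewrite dotZl eon (negbTE ji) mulr0.
    by rewrite addr0 dotZl eon eqxx mulr1 subrr mulr0.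
  have [cl _] := blin_conv2 hh L2 c.
  have [y yd] := range_dense_orth cl (conv2_sa hh c) xo d0.
  exists (conv2 c y - l%:C *: y) => //.
  have sub (k : H -> G) : blin_tw tau NH N k -> k (conv2 c y) = k (l%:C *: y) ->
      k (conv2 c y - l%:C *: y) = 0.
    move=> bk ky; have [kl _] := bk.
    have k0 := blin_tw_fun0 (nrm_is_norm _) (cnorm_is_norm _) bk.
    have h1 := kl (-1) (l%:C *: y) (conv2 c y).
    have h2 := kl (-1) (l%:C *: y) (l%:C *: y).
    by rewrite addrC -scaleN1r h1 ky -h2 scaleN1r addNr.
  by rewrite (sub _ bf (ff y)) (sub _ bg (gg y)) subrr.
have -> : x = \sum_i dot x (e i) *: e i + x0 by rewrite addrC subrK.
have : forall (r : seq 'I_m) z, f z - g z = 0 ->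
    f (\sum_(i <- r) dot x (e i) *: e i + z) - g (\sum_(i <- r) dot x (e i) *: e i + z) = 0.
  elim=> [|i r IH] z hz; first by rewrite big_nil add0r.
  by rewrite big_cons -addrA nl IH// fg subrr scaler0 addr0.
exact.
Qed.

(* The matrix of the regular representation restricted to the eigenspace. *)
Definition eig_rep : 'M[G]_m := \matrix_(i, j) U (e i) (e j).

Let conjl : Num.conj l%:C = l%:C. Proof. exact: conj_real. Qed.

Let e_sum (f : 'I_m -> G) j :
  \sum_k dot (e j) (e k) *: f k = f j.
Proof.
rewrite (bigD1 j)//= eon eqxx scale1r big1 ?addr0// => k kj.
by rewrite eon eq_sym (negbTE kj) scale0r.
Qed.

(** As [conv2] passes from one argument of U to the other, U eta (e j) sees only the component of
    eta in the eigenspace. *)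
Lemma U_eig_r eta j : U eta (e j) = \sum_k Num.conj (dot eta (e k)) *: eig_rep k j.
Proof.
have b2 : blin_tw Num.conj NH N (fun eta => \sum_k Num.conj (dot eta (e k)) *: eig_rep k j).
  apply: blin_tw_sum => [|k]; first exact: cnorm_is_norm.
  apply: blin_tw_scale; first exact: cnorm_is_norm.
  split=> [a x y|]; first by rewrite dotDl dotZl rmorphD rmorphM.
  exists (nrm (e k)) => [|x]; first exact: nrm_ge0.
  by rewrite abJ mulrC ab_dot.
apply: (eigenspace_ext (blin_Ul hh (e j)) b2) => [y|y|i].
- by rewrite U_conv2 eK UZl UZr conjl.
- apply: eq_bigr => k _; rewrite conv2_sa eK dotZr dotZl.
  by rewrite conjl.
- under eq_bigr => k _ do rewrite -dotC.
  rewrite (bigD1 i)//= eon eqxx scale1r big1 ?addr0 ?mxE// => k ki.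
  by rewrite eon (negbTE ki) scale0r.
Qed.

Lemma U_eig_l i xi : U (e i) xi = \sum_k dot xi (e k) *: eig_rep i k.
Proof.
have b2 : blin_tw id NH N (fun xi => \sum_k dot xi (e k) *: eig_rep i k).
  apply: blin_tw_sum => [|k]; first exact: cnorm_is_norm.
  by apply: blin_tw_scale; [exact: cnorm_is_norm|exact: blin_tw_dotl].
apply: (eigenspace_ext (blin_U hh (e i)) b2) => [y|y|j].
- by rewrite -U_conv2 eK UZl UZr conjl.
- by apply: eq_bigr => k _; rewrite conv2_sa eK dotZr dotZl conjl.
- by rewrite e_sum mxE.
Qed.

(** At xi = iota y the right side is formally (h (x) id)(Delta(y)^* Delta(e j)). In this form
    Delta(y) can be replaced by any element of C(G) (x) C(G), and elementary tensors suffice. *)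
Lemma eig_rep_star_mul xi j :
  \sum_k star (U (e k) xi) * eig_rep k j = dot (e j) xi *: 1.
Proof.
have b1 : blin_tw Num.conj NH N (fun xi => \sum_k star (U (e k) xi) * eig_rep k j).
  apply: blin_tw_sum => [|k]; first exact: cnorm_is_norm.
  exact: blin_tw_comp (blin_tw_mulr _) (blin_tw_comp (@blin_tw_star R G) (blin_U hh _)).
have b2 : blin_tw Num.conj NH N (fun xi => dot (e j) xi *: 1).
  by apply: blin_tw_scale; [exact: cnorm_is_norm|exact: blin_tw_dotr].
apply: (iota_eq (cnorm_is_norm _) b1 b2) => y.
rewrite -(S_star_comul hh); under eq_bigr => k _ do rewrite U_iota.
have b3 : blin_tw Num.conj N2 N (fun Z => \sum_k star (Om (e k) Z) * eig_rep k j).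
  apply: blin_tw_sum => [|k]; first exact: cnorm_is_norm.
  exact: blin_tw_comp (blin_tw_mulr _)
    (blin_tw_comp (@blin_tw_star R G) (blin_tw_slice (OmP hh _))).
have b4 := blin_tw_comp (blin_Sl hh (e j)) (@blin_tw_star R AA).
apply: (blin_tw_eq (cnorm_is_norm _) (cnorm_is_norm _) b3 b4 (tens_dense tP)).
move=> _ [a [w ->]] /=; rewrite S_star_tens U_eig_r mulr_sumr.
apply: eq_bigr => k _; rewrite (slice_tens (OmP hh _)) starZ.
by rewrite -scalerAl -scalerAr.
Qed.

Lemma eig_rep_unitary : unitary_rep eig_rep.
Proof.
have vE i j : eig_rep i j = U (e i) (e j) by rewrite mxE.
have h2 : adjmx eig_rep *m eig_rep = 1%:M.
  apply/matrixP => i j; rewrite [RHS]mxE [LHS]mxE eq_sym.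
  have := eig_rep_star_mul (e i) j; rewrite eon.
  under eq_bigr => k _ do rewrite -vE -adjmxE.
  by move=> ->; case: eqP; rewrite ?scale1r ?scale0r.
apply/unitary_repE; split=> //.
(* Over C(G), v^* v = 1 does not formally give v v^* = 1. But P = v v^* fixes v, hence by [U_eig_l]
   the columns U (e i) xi, hence by cancellation the slices of every element of C(G) (x) C(G), so P
   = 1. *)
- pose P := eig_rep *m adjmx eig_rep.
  have Pv : P *m eig_rep = eig_rep by rewrite /P -mulmxA h2 mulmx1.
  have PE i Z : \sum_j P i j * Om (e j) Z = Om (e i) Z.
    have b1 : blin_tw id N2 N (fun Z => \sum_j P i j * Om (e j) Z).
      apply: blin_tw_sum => [|k]; first exact: cnorm_is_norm.
      exact: blin_tw_comp (blin_tw_mull _) (blin_tw_slice (OmP hh _)).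
    apply: (blin_tw_eq (cnorm_is_norm _) (cnorm_is_norm _) b1
      (blin_tw_slice (OmP hh (e i))) (@cancel_dense_star _ G)).
    move=> _ [x [y ->]] /=.
    under eq_bigr => j _ do rewrite (sliceMr tP (OmP hh _)) -U_iota mulrA.
    rewrite -mulr_suml (sliceMr tP (OmP hh _)) -U_iota; congr (_ * _).
    under eq_bigr => j _ do rewrite U_eig_l mulr_sumr.
    rewrite U_eig_l exchange_big; apply: eq_bigr => k _.
    under eq_bigr => j _ do rewrite -scalerAr.
    rewrite -scaler_sumr; congr (_ *: _).
    by have := congr1 (fun M : 'M[G]_m => M i k) Pv; rewrite mxE.
  have PH i xi : \sum_j dot xi (e j) *: P i j = dot xi (e i) *: 1.
    have b1 : blin_tw id NH N (fun xi => \sum_j dot xi (e j) *: P i j).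
      apply: blin_tw_sum => [|k]; first exact: cnorm_is_norm.
      by apply: blin_tw_scale; [exact: cnorm_is_norm|exact: blin_tw_dotl].
    have b2 : blin_tw id NH N (fun xi => dot xi (e i) *: 1).
      by apply: blin_tw_scale; [exact: cnorm_is_norm|exact: blin_tw_dotl].
    apply: (iota_eq (cnorm_is_norm _) b1 b2) => a.
    have := PE i (t a 1); rewrite (slice_tens (OmP hh _)) => <-.
    by apply: eq_bigr => j _; rewrite (slice_tens (OmP hh _)) -scalerAr mulr1.
  apply/matrixP => i j; have := PH i (e j); rewrite e_sum eon -/P => ->.
  by rewrite mxE eq_sym; case: eqP; rewrite ?scale1r ?scale0r.
apply/matrixP => i j; rewrite mxE [RHS]mxE.
(* Slices separate the elements of C(G) (x) C(G), and [slice_comul_U] computes those of Delta(U eta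
   xi). *)
apply/eqP; rewrite -subr_eq0; apply/eqP; apply: (slice_sep tP) => phi K s hs.
have [th [th1 th2]] := slice_comul_U hs.
rewrite addrC -scaleN1r (sliceD hs) (slice_sum hs) vE th2 U_eig_r scaleN1r.
apply/eqP; rewrite addrC subr_eq0; apply/eqP; apply: eq_bigr => k _.
by rewrite (slice_tens hs) [in RHS](vE i k) th1 [in RHS]dotC.
Qed.

End Eigenspace.

Lemma orthPol_eq0 xi : orthPol xi -> xi = 0.
Proof.
move=> xio; have [//|xi0] := eqVneq xi 0; exfalso.
have [c cxi] : exists c, conv c xi != 0.
  apply: contrapT => hn; move/eqP: xi0; apply; apply: conv_eq0 => c.
  by apply/eqP; apply: contrapT => cxi; apply: hn; exists c; apply/negP.
have [Cl [M M0 CM]] := blin_conv hh L2 c.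
have [C'l _] := blin_conv_adj hh L2 c.
have [x [l [xo x0 l0 xl]]] := compact_eigenvector Cl CM C'l (conv_adjP hh c)
  (@conv_compact _ _ _ hh L2 c) orthPolD orthPol_closed (@orthPol_conv2 c)
  (ex_intro2 _ _ xi xio cxi).
have [Fl _] := blin_conv2 hh L2 c.
have [m [e [eK eon eb]]] : exists m (e : 'I_m -> H),
  [/\ forall i, conv2 c (e i) = l%:C *: e i,
      forall i j, dot (e i) (e j) = (i == j)%:R &
      forall x, conv2 c x = l%:C *: x -> x = \sum_i dot x (e i) *: e i].
  apply: (@fin_orthonormal_basis R H [set x | conv2 c x = l%:C *: x]) => /=.
  - by move=> a y z hy hz; rewrite Fl hy hz scalerDr !scalerA mulrC.
  - by rewrite scaler0; have := Fl (-1) 0 0; rewrite scaler0 addr0 scaleN1r addNr.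
  - have [n [p hp]] := eigenspace_separated (conv_adjP hh c)
      (@conv_compact _ _ _ hh L2 c) l0.
    by exists n, p.
have uv := eig_rep_unitary eK eon eb.
(* Each U (e k) x is a combination of entries of [eig_rep], thus in [Pol]; since x is in [orthPol],
   applying [h] annihilates every term on the left and gives <x, x> = 0. *)
have : \sum_k star (U (e k) x) * U (e k) x = dot x x *: 1.
  under eq_bigr => k _ do rewrite {2}(U_eig_l eK eon eb) mulr_sumr.
  rewrite exchange_big {3}(eb x xl) dot_suml scaler_suml; apply: eq_bigr => j _.
  rewrite dotZl -scalerA -(eig_rep_star_mul eK eon eb) scaler_sumr.
  by apply: eq_bigr => k _; rewrite -scalerAr.
move=> /(congr1 h); rewrite hZ (haar1 hh) mulr1 linear_sum/= big1 => [/esym/dotxx_eq0 x00|k _].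
  by rewrite x00 eqxx in x0.
apply: xo; rewrite (U_eig_l eK eon eb); apply: lin_span_sum => j.
exact: coeff_Pol.
Qed.

Lemma Pol_dense : norm_dense NH (iota @` Pol I).
Proof.
move=> x e e0.
have M0 : (iota @` Pol I) 0 by exists 0; [exact: Pol0|exact: iota0].
have MD c y z : (iota @` Pol I) y -> (iota @` Pol I) z -> (iota @` Pol I) (c *: y + z).
  move=> [p pp <-] [q pq <-]; exists (c *: p + q); [exact: PolD|exact: iotaD].
have [m [ma mo]] := projection M0 MD x.
have xm : x - m = 0.
  by apply/orthPol_eq0/orthPolP => p pp; apply: mo; exists p.
by have [y yM my] := ma e e0; exists y => //; move/subr0_eq: xm => ->.
Qed.

End PeterWeyl.

(** * Transport of the interpolation norms *)

Lemma nrm_conj (R : realType) (c : R[i]^o) : nrm (Num.conj c : R[i]^o) = nrm c.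
Proof. exact: abJ. Qed.

Definition anti_isometry (R : realType) (X Y : normedModType R[i]) (A : X -> Y) : Prop :=
  (forall c x y, A (c *: x + y) = Num.conj c *: A x + A y) /\
  forall x, nrm (A x) = nrm x.

Section AntiIsometry.
Variables (R : realType) (X Y : normedModType R[i]) (A : X -> Y).
Hypothesis hA : anti_isometry A.

Lemma anti0 : A 0 = 0.
Proof. by apply: nrm0_eq0; rewrite hA.2 nrm0. Qed.

Lemma antiZ c x : A (c *: x) = Num.conj c *: A x.
Proof. by have := hA.1 c x 0; rewrite anti0 !addr0. Qed.

Lemma antiD x y : A (x + y) = A x + A y.
Proof. by have := hA.1 1 x y; rewrite conjC1 !scale1r. Qed.

Lemma antiB x y : A (x - y) = A x - A y.
Proof. by rewrite antiD -scaleN1r antiZ rmorphN1 scaleN1r. Qed.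

Lemma anti_norm x : `|A x| = `|x|.
Proof. by rewrite !nrmE hA.2. Qed.

Lemma anti_cvg x : A z @[z --> x] --> A x.
Proof.
apply/cvgrPdist_lt => e e0.
have := @cvgr_dist_lt _ _ _ (nbhs x) (nbhs_filter x) id x (@cvg_id _ _) e e0.
by apply: filterS => z; rewrite -antiB anti_norm.
Qed.

End AntiIsometry.

Lemma anti_isometry_conj (R : realType) :
  anti_isometry (fun c : R[i]^o => Num.conj c : R[i]^o).
Proof. by split=> [c x y|x]; [rewrite rmorphD rmorphM|exact: nrm_conj]. Qed.

Lemma conj_within (R : realType) (A B : set R[i]^o) (x : R[i]^o) :
  (forall z, A z -> B (Num.conj z)) ->
  (Num.conj z : R[i]^o) @[z --> within A (nbhs x)] -->
  within B (nbhs (Num.conj x : R[i]^o)).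
Proof.
move=> AB P; have := @anti_cvg _ _ _ _ (anti_isometry_conj R) x; rewrite /within/=.
move=> h BP; change (nbhs x (fun z => A z -> P (Num.conj z : R[i]^o))).
have hb : nbhs x (fun z : R[i]^o => B (Num.conj z) -> P (Num.conj z)) := h _ BP.
by apply: filterS hb => z hz Az; exact/hz/AB.
Qed.

Section Transport.
Variables (R : realType) (X0 X1 : normedModType R[i]) (j : X0 -> X1).
Variables (A0 : X0 -> X0) (A1 : X1 -> X1).
Hypotheses (h0 : anti_isometry A0) (h1 : anti_isometry A1)
  (jA : forall x, j (A0 x) = A1 (j x)).

Lemma Re_conj (z : R[i]) : complex.Re (Num.conj z) = complex.Re z.
Proof. by case: z. Qed.

Lemma conj_line (a t : R) : Num.conj (a +i* t) = a +i* (- t) :> R[i].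
Proof. by []. Qed.

Definition anti_transport (f : R[i]^o -> X1) (z : R[i]^o) : X1 := A1 (f (Num.conj z)).

(** An antilinear map composed with conjugation of the variable preserves complex differentiability.
    Conjugation preserves the strip and reverses its two boundary lines: [g] is read at -t, and the
    limits at both infinities are exchanged. *)
Lemma calderon_transport f g :
  calderon j f g -> calderon j (anti_transport f) (fun t => A0 (g (- t))).
Proof.
have c0 x := anti_cvg h0 (x := x); have c1 x := anti_cvg h1 (x := x).
have c00 : A0 z @[z --> 0] --> 0 by rewrite -[X in _ --> X](anti0 h0); exact: c0.
have c10 : A1 z @[z --> 0] --> 0 by rewrite -[X in _ --> X](anti0 h1); exact: c1.
case=> fc [M fM] fa fl gc gp gn fp fn; split.
- apply/subspace_continuousP => x sx; apply: (cvg_comp _ _ _ (c1 _)).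
  move/subspace_continuousP : fc => /(_ (Num.conj x)).
  rewrite /strip/= Re_conj => /(_ sx); apply: cvg_comp.
  by apply: conj_within => z; rewrite /strip/= Re_conj.
- by exists M => z sz; rewrite h1.2 fM// /strip/= Re_conj.
- move=> z zs; have : derivable f (Num.conj z) 1 by apply: fa; rewrite Re_conj.
  rewrite /derivable => /cvg_ex[l fl']; apply/cvg_ex; exists (A1 l).
  have -> : (fun h : R[i]^o => h^-1 *: ((anti_transport f \o shift z) (h *: 1) - anti_transport f z))
     = A1 \o ((fun h => h^-1 *: ((f \o shift (Num.conj z)) (h *: 1) - f (Num.conj z))) \o Num.conj).
    apply/funext => h /=; rewrite (antiZ h1) (antiB h1) /anti_transport.
    rewrite (_ : Num.conj (Num.conj h)^-1 = h^-1); last by rewrite fmorphV/= conjCK.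
    rewrite rmorphD/=; congr (_ *: (A1 (f (_ + _)) - _)).
    by rewrite -[h *: 1]/(h * 1) -[_ *: 1]/(_ * 1) !mulr1.
  apply: (cvg_comp _ _ _ (c1 l)); apply: cvg_comp fl'.
  have := @conj_within R (fun y => y != 0) (fun y => y != 0) 0.
  by rewrite conjC0; apply => y; rewrite conjC_eq0.
- move=> t; rewrite /anti_transport conj_line fl jA.
  by [].
- move=> t; have ot : - x @[x --> t] --> - t by apply: (@cvgN R R^o); exact: cvg_id.
  exact: (cvg_comp _ _ (cvg_comp _ _ ot (gc _)) (c0 _)).
- by apply: (cvg_comp _ _ _ c00); apply/(cvgNy_compNP g).
- by apply: (cvg_comp _ _ _ c00); apply/(cvgy_compNP g).
- apply: (cvg_comp _ _ _ c10).
  by apply/(cvgNy_compNP (fun t => f (1 +i* t))).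
- apply: (cvg_comp _ _ _ c10).
  by apply/(cvgy_compNP (fun t => f (1 +i* t))).
Qed.

Lemma calderon_norm_transport f g :
  calderon_norm (anti_transport f) (fun t => A0 (g (- t))) = calderon_norm f g.
Proof.
have E (F F' : R -> \bar R) : (forall t, F t = F' (- t)) -> range F = range F'.
  move=> FF; apply/seteqP; split=> _ [t _ <-]; exists (- t) => //.
  by rewrite FF opprK.
by rewrite /calderon_norm; congr (Order.max (ereal_sup _) (ereal_sup _));
  apply: E => t; rewrite ?h0.2// h1.2.
Qed.

Lemma interpolation_norm_transport (s : R) x :
  (interpolation_norm j s (A1 x) <= interpolation_norm j s x)%E.
Proof.
apply/ereal_infP => _ [f [g [fg fx ->]]].
apply: ereal_inf_lbound; exists (anti_transport f), (fun t => A0 (g (- t))).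
split; [exact: calderon_transport| |by rewrite calderon_norm_transport].
by rewrite /anti_transport conj_real fx.
Qed.

End Transport.

(** * Conjugation by an antiunitary involution on operators and on the predual *)

Section AntiUnitary.
Variables (R : realType) (H : hilbertType R) (V : H -> H).
Hypotheses (VD : forall c x y, V (c *: x + y) = Num.conj c *: V x + V y)
  (Vdot : forall x y, dot (V x) (V y) = Num.conj (dot x y))
  (VK : forall x, V (V x) = x).

Lemma antiunitary_isometry : anti_isometry V.
Proof.
split=> // x; apply: (@pexpIrn _ 2) => //; rewrite ?nnegrE ?nrm_ge0//.
by apply: (@complexI R); rewrite -!dotxx Vdot dotxx conj_real.
Qed.
Let hV := antiunitary_isometry.

Lemma antiunitary_dot x y : dot (V x) y = Num.conj (dot x (V y)).
Proof. by rewrite -Vdot VK. Qed.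

Lemma anti_conj_bounded (T : blin H H) :
  (fun x => V (T (V x))) \in @blin_pred R H H.
Proof.
have [Tl [M TM]] := blinP T.
apply/asboolP; split=> [c x y|]; first by rewrite VD Tl VD conjCK.
by exists M => x; rewrite hV.2 (le_trans (TM _))// hV.2.
Qed.

Definition anti_conj (T : blin H H) : blin H H := BLin (anti_conj_bounded T).

Lemma anti_conjE T x : anti_conj T x = V (T (V x)). Proof. by []. Qed.

Lemma anti_conjK T : anti_conj (anti_conj T) = T.
Proof. by apply: blin_ext => x; rewrite !anti_conjE !VK. Qed.

Lemma anti_conjD c T U : anti_conj (c *: T + U) = Num.conj c *: anti_conj T + anti_conj U.
Proof.
apply: blin_ext => x; rewrite anti_conjE.
have E a (A B : blin H H) y : (a *: A + B) y = a *: A y + B y by [].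
by rewrite !E VD.
Qed.

Lemma anti_conj_opnorm_le T : opnorm (anti_conj T) <= opnorm T.
Proof.
by apply: opnorm_le => x x1; rewrite anti_conjE hV.2 opnorm_ball// hV.2.
Qed.

Lemma anti_conj_opnorm T : opnorm (anti_conj T) = opnorm T.
Proof.
apply/eqP; rewrite eq_le anti_conj_opnorm_le/=.
by rewrite -{1}(anti_conjK T) anti_conj_opnorm_le.
Qed.

(** Used twice: to pass from the image of [Pol] to its commutant, and from the commutant to the
    bicommutant [Linf]. *)
Lemma anti_conj_commutant (S : set (blin H H)) :
  (forall s, S s -> S (anti_conj s)) ->
  forall T, commutant S T -> commutant S (anti_conj T).
Proof.
move=> hS T cT s Ss x; rewrite !anti_conjE.
have := cT _ (hS _ Ss) (V x); rewrite !anti_conjE !VK => ->.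
by rewrite VK.
Qed.

Variable S : set (blin H H).
Hypothesis hS : forall s, S s -> S (anti_conj s).
Local Notation M := (commutant_type S).

Lemma anti_commutant_in (T : M) : anti_conj (val T) \in commutant_pred S.
Proof.
apply/asboolP; apply: anti_conj_commutant => //.
by apply/asboolP; exact: commutant_valP.
Qed.

Definition anti_commutant (T : M) : M := CommutantType (anti_commutant_in T).

Lemma anti_commutantE (T : M) x : anti_commutant T x = V (T (V x)). Proof. by []. Qed.

Lemma nrm_commutant (T : M) : nrm T = opnorm (val T). Proof. by []. Qed.

Lemma anti_commutant_isometry : anti_isometry anti_commutant.
Proof.
split=> [c T U|T]; last by rewrite !nrm_commutant anti_conj_opnorm.
by apply: val_inj; exact: anti_conjD.
Qed.

Lemma anti_commutantK T : anti_commutant (anti_commutant T) = T.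
Proof. by apply: val_inj; exact: anti_conjK. Qed.

Definition anti_functional_fun (phi : blin M R[i]^o) (T : M) : R[i]^o :=
  Num.conj (phi (anti_commutant T)).

Lemma anti_functional_bounded phi :
  anti_functional_fun phi \in @blin_pred R M R[i]^o.
Proof.
have [pl [K pK]] := blinP phi; have [al an] := anti_commutant_isometry.
apply/asboolP; split=> [c T U|].
  by rewrite /anti_functional_fun al pl rmorphD rmorphM/= conjCK.
by exists K => T; rewrite /anti_functional_fun nrm_conj (le_trans (pK _))// an.
Qed.

Definition anti_functional phi : blin M R[i]^o := BLin (anti_functional_bounded phi).

Lemma anti_functional_normal phi :
  phi \in @normal_pred R H S -> anti_functional phi \in @normal_pred R H S.
Proof.
move=> /asboolP[xi [eta [hx he hphi]]]; apply/asboolP.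
exists (V \o xi), (V \o eta); split.
- by under [X in series X]funext => n do rewrite /= hV.2.
- by under [X in series X]funext => n do rewrite /= hV.2.
move=> T; have := hphi (anti_commutant T) => hT.
have := cvg_comp _ _ hT (@anti_cvg _ _ _ _ (anti_isometry_conj R) (phi (anti_commutant T))).
apply: cvg_trans; apply: near_eq_cvg; apply: nearW => n /=.
rewrite /series/= rmorph_sum; apply: eq_bigr => k _ /=.
by rewrite antiunitary_dot conjCK.
Qed.

Definition anti_predual (phi : predual S) : predual S :=
  Predual (anti_functional_normal (predual_valP phi)).

Lemma anti_predualE phi T : anti_predual phi T = Num.conj (phi (anti_commutant T)).
Proof. by []. Qed.

Lemma nrm_predual (phi : predual S) : nrm phi = opnorm (val phi). Proof. by []. Qed.

Lemma anti_predualK phi : anti_predual (anti_predual phi) = phi.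
Proof.
apply: val_inj; apply: blin_ext => T.
by rewrite -[LHS]/(anti_predual (anti_predual phi) T) !anti_predualE conjCK anti_commutantK.
Qed.

Lemma anti_predual_isometry : anti_isometry anti_predual.
Proof.
have le phi : nrm (anti_predual phi) <= nrm phi.
  rewrite !nrm_predual; apply: opnorm_le => T T1.
  by rewrite -[X in nrm X]/(Num.conj _) nrm_conj opnorm_ball// anti_commutant_isometry.2.
split=> [c phi psi|phi].
  apply: val_inj; apply: blin_ext => T.
  rewrite -[LHS]/(anti_predual (c *: phi + psi) T) anti_predualE.
  have E a (A B : predual S) y : (a *: A + B) y = a *: A y + B y by [].
  by rewrite E rmorphD rmorphM.
by apply/eqP; rewrite eq_le le/= -{1}(anti_predualK phi) le.
Qed.

Lemma anti_predual_vec xi eta :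
  anti_predual (vec_functional S xi eta) = vec_functional S (V xi) (V eta).
Proof.
apply: val_inj; apply: blin_ext => T.
rewrite -[LHS]/(anti_predual (vec_functional S xi eta) T) anti_predualE.
rewrite -[vec_functional S xi eta _]/(dot _ _) -[RHS]/(dot _ _).
by rewrite anti_commutantE antiunitary_dot conjCK.
Qed.

End AntiUnitary.

(** * Invariance of the norms of L^p under [theta] *)

Section ThetaLp.
Variables (R : realType) (G : compact_quantum_group R) (h : {scalar G}).
Hypothesis hh : haar_state h.
Variable L2 : gns_triple h.
Variables (I : irr_family G) (Q : forall pi : I, 'M[R[i]]_(irr_dim pi)).
Hypothesis hQ : modular_matrices h Q.
Local Notation H := (gns_space L2).
Local Notation iota := (gns_map L2).
Local Notation theta := (theta hh hQ).
Let hr : star_rep (gns_rep L2) := gns_repP L2.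

Lemma dot_iota_theta x y : Pol I x -> Pol I y ->
  dot (iota (theta x)) (iota (theta y)) = Num.conj (dot (iota x) (iota y)).
Proof.
move=> px py; rewrite !dot_iota -theta_star// -thetaM//; last exact: (Pol_star hh hQ).
by rewrite haar_theta//; apply: (PolM Q) => //; exact: (Pol_star hh hQ).
Qed.

Lemma antiunitary_exists : exists V : H -> H,
  [/\ forall c x y, V (c *: x + y) = Num.conj c *: V x + V y,
      forall x y, dot (V x) (V y) = Num.conj (dot x y),
      forall x, V (V x) = x &
      forall x, Pol I x -> V (iota x) = iota (theta x)].
Proof.
have PD := Pol_dense hh (L2 := L2) hQ.
pose gr x b := exists p, [/\ Pol I p, x = iota p & b = iota (theta p)].
have nE p : Pol I p -> nrm (iota (theta p)) = nrm (iota p).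
  move=> pp; apply: (@pexpIrn _ 2) => //; rewrite ?nnegrE ?nrm_ge0//.
  by apply: (@complexI R); rewrite -!dotxx dot_iota_theta// dotxx conj_real.
have [||||V [VE VD VM]] := @dense_ext R H H (@nrm R H) (@nrm R H) (nrm_is_norm _)
    (nrm_is_norm _) Num.conj 1 ler01 (@hilbert_complete R H) (@abJ R) (rmorphN1 _) gr.
- exists 0; split; [exact: Pol0|by rewrite iota0|].
  by rewrite (antilin0 (thetaD hh hQ)) iota0.
- move=> c _ _ _ _ [p [pp -> ->]] [q [pq -> ->]]; exists (c *: p + q).
  by split; [exact: PolD|rewrite iotaD|rewrite thetaD// iotaD].
- by move=> _ _ [p [pp -> ->]]; rewrite mul1r nE.
- move=> x e e0; have [_ [p pp <-] d] := PD x e e0; exists (iota p) => //.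
  by exists (iota (theta p)), p.
exists V.
have Vi p : Pol I p -> V (iota p) = iota (theta p) by move=> pp; apply: VE; exists p.
have hn := nrm_is_norm H.
have bV : blin_tw Num.conj (@nrm R H) (@nrm R H) V by split=> //; exists 1.
have sp := norm_dense_span PD.
have bC : blin_tw Num.conj (@nrm R R[i]^o) (@nrm R R[i]^o) (fun c => Num.conj c).
  by split=> [c x y|]; [rewrite rmorphD rmorphM|exists 1 => // x; rewrite mul1r abJ].
have hC := nrm_is_norm R[i]^o.
split=> // [x y|x].
- have b1 z : blin_tw Num.conj (@nrm R H) (@nrm R R[i]^o) (fun x => dot (V x) z).
    exact: (blin_tw_comp (blin_tw_dotl z) bV).
  have b2 z : blin_tw Num.conj (@nrm R H) (@nrm R R[i]^o) (fun x => Num.conj (dot x z)).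
    exact: (blin_tw_comp bC (blin_tw_dotl z)).
  apply: (blin_tw_eq hn hC (b1 _) (b2 y) sp) => _ [p pp <-]; rewrite Vi//.
  have b3 := blin_tw_comp (blin_tw_dotr (iota (theta p))) bV.
  have b4 := blin_tw_comp bC (blin_tw_dotr (iota p)).
  apply: (blin_tw_eq hn hC b3 b4 sp) => _ [q pq <-] /=.
  by rewrite Vi// dot_iota_theta.
- have b1 : blin_tw id (@nrm R H) (@nrm R H) (fun x => V (V x)).
    by split=> [c z w|]; [rewrite !VD conjCK|exists 1 => // z; rewrite mul1r;
      have := VM (V z); have := VM z; rewrite !mul1r => h1 h2; exact: le_trans h2 h1].
  have b2 : blin_tw id (@nrm R H) (@nrm R H) id.
    by split=> //; exists 1 => // z; rewrite mul1r.
  apply: (blin_tw_eq hn hn b1 b2 sp) => _ [p pp <-].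
  by rewrite !Vi ?thetaK//; exact: theta_Pol.
Qed.

Lemma Lp_norm_theta_le (p : \bar R) x : Pol I x ->
  (Lp_norm I L2 p (theta x) <= Lp_norm I L2 p x)%E.
Proof.
move=> px; have [V [VD Vdot VK Vi]] := antiunitary_exists.
have iotaM a b : iota (a * b) = gns_rep L2 a (iota b) by exact: (repM hr).
have bV : blin_tw Num.conj (@nrm R H) (@nrm R H) V.
  split=> //; exists 1 => // z.
  by rewrite (antiunitary_isometry VD Vdot).2 mul1r.
(* The cyclic vector is iota 1 and [theta] fixes 1; this makes V compatible with both embeddings
   into L^1. *)
have VO : V (gns_vec L2) = gns_vec L2.
  have E : iota 1 = gns_vec L2 by exact: (rep1 hr).
  by rewrite -E Vi ?theta1//; exact: Pol1.
(* On iota b with b in [Pol], V a V gives iota (theta (a theta(b))) = iota (theta(a) b), and such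
   vectors are dense. *)
have Vrep a : Pol I a -> anti_conj VD Vdot (gns_rep L2 a) = gns_rep L2 (theta a).
  move=> pa; apply: blin_ext => xi; rewrite anti_conjE.
  have brep (b : G) : blin_tw id (@nrm R H) (@nrm R H) (gns_rep L2 b).
    have [bl [M bM]] := blinP (gns_rep L2 b); split=> //.
    exists `|M| => // z; rewrite (le_trans (bM z))// ler_wpM2r ?nrm_ge0//.
    exact: ler_norm.
  have b1 : blin_tw id (@nrm R H) (@nrm R H) (fun xi => V (gns_rep L2 a (V xi))).
    have := blin_tw_comp bV (blin_tw_comp (brep a) bV).
    rewrite (_ : _ \o _ = id)//.
    by apply/funext => c /=; rewrite conjCK.
  apply: (blin_tw_eq (nrm_is_norm H) (nrm_is_norm H) b1 (brep _)
    (norm_dense_span (Pol_dense hh (L2 := L2) hQ))) => _ [b pb <-].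
  rewrite Vi// -iotaM Vi; last by apply: (PolM Q) => //; exact: theta_Pol.
  by rewrite thetaM ?thetaK ?iotaM//; exact: theta_Pol.
have hS s : [set gns_rep L2 x | x in Pol I] s ->
    [set gns_rep L2 x | x in Pol I] (anti_conj VD Vdot s).
  by move=> [a pa <-]; exists (theta a); [exact: theta_Pol|rewrite Vrep].
have hS' := anti_conj_commutant VK hS.
have h0 := anti_commutant_isometry VK hS'.
have h1 := anti_predual_isometry VK hS'.
rewrite /Lp_norm.
have -> : Pol_to_L1 I L2 (theta x) = anti_predual VK hS' (Pol_to_L1 I L2 x).
  by rewrite anti_predual_vec VO -[gns_rep L2 x _]/(iota x) Vi.
apply: (interpolation_norm_transport h0 h1) => T.
by rewrite anti_predual_vec VO /Linf_to_L1 anti_commutantE VO.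
Qed.

Lemma Lp_norm_theta (p : \bar R) x : Pol I x ->
  Lp_norm I L2 p (theta x) = Lp_norm I L2 p x.
Proof.
move=> px; apply/eqP; rewrite eq_le Lp_norm_theta_le//=.
rewrite -{1}(thetaK hh hQ px) Lp_norm_theta_le//; exact: theta_Pol.
Qed.

End ThetaLp.

(** * The multipliers *)

Section Main.
Variables (R : realType) (G : compact_quantum_group R) (h : {scalar G}).
Hypothesis hh : haar_state h.
Variables (I : irr_family G) (Q : forall pi : I, 'M[R[i]]_(irr_dim pi)).
Hypothesis hQ : modular_matrices h Q.
Local Notation C := R[i].
Local Notation theta := (theta hh hQ).
Local Notation U := (eigU Q).

(** [theta] permutes the e_ij of a single class up to scalars and commutes with the involution,
    while passing to the eigenbasis of Q stays inside the span of the class. *)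
Lemma theta_irr_span (E : set I) (pi : I) i j : E pi ->
  coeff_span E (theta (irr pi i j)) /\ coeff_span E (theta (star (irr pi i j))).
Proof.
move=> Epi.
have pe k l : Pol I (eirr Q pi k l) := coeff_in_Pol Q (coeff_at k l).
have irrE k l : irr pi k l = \sum_a \sum_b
    (((U pi) ^t*)%sesqui k a * Num.conj (((U pi) ^t*)%sesqui l b)) *: eirr Q pi a b.
  by rewrite {1}(irr_eirr Q) conj_entry.
have eE k l : coeff_span E (eirr Q pi k l) /\ coeff_span E (star (eirr Q pi k l)).
  split; [rewrite eirrE|rewrite eirr_starE].
    rewrite (eq_bigr (fun a => 1 *: \sum_b (U pi k a * Num.conj (U pi l b)) *: irr pi a b))
      => [|a _]; last by rewrite scale1r.
    apply: lin_span_sum => a; apply: lin_span_sum => b; apply: lin_span_in.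
    by exists pi, a, b; split=> //; left.
  rewrite (eq_bigr (fun a => 1 *: \sum_b (Num.conj (U pi k a) * U pi l b) *: star (irr pi a b)))
    => [|a _]; last by rewrite scale1r.
  apply: lin_span_sum => a; apply: lin_span_sum => b; apply: lin_span_in.
  by exists pi, a, b; split=> //; right.
have pirr : Pol I (irr pi i j) by apply: lin_span_in; exists pi, i, j.
rewrite theta_star// irrE.
rewrite (eq_bigr (fun a => 1 *: \sum_b
    (((U pi) ^t*)%sesqui i a * Num.conj (((U pi) ^t*)%sesqui j b)) *: eirr Q pi a b))
    => [|a _]; last by rewrite scale1r.
have tD := thetaD hh hQ.
rewrite (antilin_sum _ _ tD) => [|a]; last first.
  by apply: lin_span_sum => b; exact: pe.
have te a b : theta (eirr Q pi a b) = ((Num.sqrt (coeff_wt Q (coeff_at a b)))^-1)%:C *: eirr Q pi b a.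
  exact: (theta_coeff hh hQ (coeff_at a b)).
split.
  apply: lin_span_sum => a; rewrite (antilin_sum _ _ tD)//; apply: lin_span_sum => b.
  by rewrite te -[_ *: _]addr0; apply: lin_spanD; [exact: (eE b a).1|exact: lin_span0].
rewrite star_sum (eq_bigr (fun a => 1 *: star (theta (\sum_b
    (((U pi) ^t*)%sesqui i a * Num.conj (((U pi) ^t*)%sesqui j b)) *: eirr Q pi a b))))
    => [|a _]; last by rewrite conjC1 !scale1r.
apply: lin_span_sum => a; rewrite (antilin_sum _ _ tD)// star_sum.
under eq_bigr => b _ do rewrite te starZ conjCK starZ conj_real.
apply: lin_span_sum => b.
by rewrite -[_ *: _]addr0; apply: lin_spanD; [exact: (eE b a).2|exact: lin_span0].
Qed.

Lemma coeff_span_Pol (E : set I) x : coeff_span E x -> Pol I x.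
Proof.
apply: lin_span_sub => s [pi [i [j [_ sE]]]].
have p : Pol I (irr pi i j) by apply: lin_span_in; exists pi, i, j.
by case: sE => ->//; exact: (Pol_star hh hQ).
Qed.

Lemma theta_coeff_span (E : set I) x : coeff_span E x -> coeff_span E (theta x).
Proof.
move=> xE; suff [] : Pol I x /\ coeff_span E (theta x) by [].
move: x xE; apply: (lin_span_ind (P := [set x | Pol I x /\ coeff_span E (theta x)])).
  split; first exact: Pol0.
  by rewrite (antilin0 (thetaD hh hQ)); exact: lin_span0.
move=> c s y [pi [i [j [Epi sE]]]] [py ty] /=.
have [t1 t2] := theta_irr_span i j Epi.
have ps : Pol I s.
  by apply: (@coeff_span_Pol E); apply: lin_span_in; exists pi, i, j.
split; first exact: PolD.
by rewrite thetaD//; apply: lin_spanD => //; case: sE => ->.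
Qed.

Variables (a : forall pi : I, 'M[C]_(irr_dim pi)) (mR mL : G -> G).
Hypothesis hmR : right_mult a mR.
Hypothesis hmL : left_mult (fun pi : I =>
   invmx (sqrtmx (Q pi)) *m ((a pi) ^t*)%sesqui *m sqrtmx (Q pi)) mL.

Lemma linear_on_Pol0 (m : G -> G) : linear_on_Pol I m -> m 0 = 0.
Proof.
move=> ml; have := ml (-1) 0 0 (Pol0 I) (Pol0 I).
by rewrite scaler0 addr0 scaleN1r addNr.
Qed.

Lemma linear_on_Pol_sum (m : G -> G) n (c : 'I_n -> C) (x : 'I_n -> G) :
  linear_on_Pol I m -> (forall k, Pol I (x k)) ->
  m (\sum_k c k *: x k) = \sum_k c k *: m (x k).
Proof.
move=> ml; elim: n c x => [|n IH] c x px; first by rewrite !big_ord0 linear_on_Pol0.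
by rewrite !big_ord_recl ml ?IH//; apply: lin_span_sum => k; exact: px.
Qed.

Lemma map_mx_eirr (m : G -> G) pi : linear_on_Pol I m ->
  map_mx m (eirr Q pi) = scmx G (U pi) *m map_mx m (irr pi) *m scmx G ((U pi) ^t*)%sesqui.
Proof.
move=> ml; have pirr k l : Pol I (irr pi k l) by apply: lin_span_in; exists pi, k, l.
apply/matrixP => i j; rewrite mxE eirrE conj_entry.
rewrite (eq_bigr (fun k => 1 *: \sum_l (U pi i k * Num.conj (U pi j l)) *: irr pi k l))
  => [|k _]; last by rewrite scale1r.
rewrite linear_on_Pol_sum// => [|k]; last first.
  by apply: lin_span_sum => l; exact: pirr.
apply: eq_bigr => k _; rewrite scale1r linear_on_Pol_sum//.
by apply: eq_bigr => l _; rewrite mxE.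
Qed.

Lemma scmx_eigU pi : scmx G ((U pi) ^t*)%sesqui *m scmx G (U pi) = 1%:M.
Proof. by rewrite -scmxM eigU2 scmx1. Qed.

Definition eig_mx pi : 'M[C]_(irr_dim pi) := U pi *m a pi *m ((U pi) ^t*)%sesqui.

Lemma mR_eirr pi i j : mR (eirr Q pi i j) = \sum_k eig_mx pi k j *: eirr Q pi i k.
Proof.
have [ml mE] := hmR.
rewrite -scmx_mulr.
suff /(congr1 (fun M : 'M[G]_(irr_dim pi) => M i j)) :
    map_mx mR (eirr Q pi) = eirr Q pi *m scmx G (eig_mx pi) by rewrite [LHS]mxE.
rewrite map_mx_eirr// mE /eig_mx !scmxM /eirr.
by rewrite !mulmxA -(mulmxA _ (scmx G ((U pi) ^t*)%sesqui)) scmx_eigU mulmx1.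
Qed.

Definition sqrtD pi : 'M[C]_(irr_dim pi) := diag_mx (\row_i (Num.sqrt (eigQ Q i))%:C).
Definition sqrtDV pi : 'M[C]_(irr_dim pi) := diag_mx (\row_i ((Num.sqrt (eigQ Q i))^-1)%:C).

Lemma sqrtmxE pi : sqrtmx (Q pi) = ((U pi) ^t*)%sesqui *m sqrtD pi *m U pi.
Proof.
rewrite /sqrtmx (invmx_unitary (spectral_unitarymx _)).
suff -> : map_mx sqrtC (spectral_diag (Q pi)) = \row_i (Num.sqrt (eigQ Q i))%:C by [].
apply/rowP => i; rewrite !mxE -(eigQE hQ).
have q0 := ltW (eigQ_gt0 hQ i).
rewrite -{1}(sqr_sqrtr q0) rmorphXn/= sqrCK//.
by rewrite (_ : 0 = 0%:C)// lecR sqrtr_ge0.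
Qed.

Lemma sqrtD_inv pi : sqrtD pi *m sqrtDV pi = 1%:M.
Proof.
rewrite mulmx_diag; apply/matrixP => i j; rewrite !mxE -rmorphM mulfV//.
by rewrite gt_eqF// sqrtr_gt0 (eigQ_gt0 hQ).
Qed.

Lemma invmx_sqrtmxE pi : invmx (sqrtmx (Q pi)) = ((U pi) ^t*)%sesqui *m sqrtDV pi *m U pi.
Proof.
have E : sqrtmx (Q pi) *m (((U pi) ^t*)%sesqui *m sqrtDV pi *m U pi) = 1%:M.
  rewrite sqrtmxE !mulmxA -(mulmxA _ (U pi)) eigU1 mulmx1.
  by rewrite -(mulmxA _ (sqrtD pi)) sqrtD_inv mulmx1 eigU2.
have [Su _] := mulmx1_unit E.
by rewrite -[LHS]mulmx1 -E mulKmx.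
Qed.

Lemma mL_eirr pi i j : mL (eirr Q pi i j) = \sum_k
  (((Num.sqrt (eigQ Q i))^-1)%:C * Num.conj (eig_mx pi k i) * (Num.sqrt (eigQ Q k))%:C)
    *: eirr Q pi k j.
Proof.
have [ml mE] := hmL.
pose c := sqrtDV pi *m ((eig_mx pi) ^t*)%sesqui *m sqrtD pi.
transitivity ((scmx G c *m eirr Q pi) i j).
  suff /(congr1 (fun M : 'M[G]_(irr_dim pi) => M i j)) :
    map_mx mL (eirr Q pi) = scmx G c *m eirr Q pi by rewrite [LHS]mxE.
  rewrite map_mx_eirr// mE /eirr.
  have : c = U pi *m (invmx (sqrtmx (Q pi)) *m ((a pi) ^t*)%sesqui *m sqrtmx (Q pi))
      *m ((U pi) ^t*)%sesqui.
    rewrite invmx_sqrtmxE sqrtmxE !mulmxA eigU1 mul1mx -!mulmxA eigU1 mulmx1.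
    rewrite /c /eig_mx !mulmxA; congr (_ *m _); rewrite -!mulmxA; congr (_ *m _).
    by rewrite !trmx_mul !map_mxM/= trmxCK mulmxA.
  move: (_ *m sqrtmx (Q pi)) => c' ->; rewrite -[scalar_mx_of G c']/(scmx G c').
  rewrite !scmxM !mulmxA; congr (_ *m _).
  by rewrite -(mulmxA _ (scmx G ((U pi) ^t*)%sesqui)) scmx_eigU mulmx1.
rewrite scmx_mull; apply: eq_bigr => k _; congr (_ *: _).
rewrite /c mul_diag_mx mul_mx_diag !mxE.
by [].
Qed.

Lemma mR_Pol x : Pol I x -> Pol I (mR x).
Proof.
have [ml _] := hmR.
elim/(Pol_ind (Q := Q)) => [|c m y py IH]; first by rewrite linear_on_Pol0//; exact: Pol0.
rewrite ml//; last exact: coeff_in_Pol.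
apply: PolD => //; rewrite mR_eirr; apply: lin_span_sum => k.
exact: (coeff_in_Pol Q (coeff_at _ k)).
Qed.

(** With b the matrix of a in the eigenbasis, both sides at e_ij are the sum over k of conj(b_kj)
    sqrt(q_k / q_i) e_ki. On the right, the factor sqrt(q_j / q_i) of [theta] meets sqrt(q_k / q_j)
    from the powers of Q around a^*. *)
Lemma theta_mult x : Pol I x -> theta (mR x) = mL (theta x).
Proof.
have [ml _] := hmR; have [ml' _] := hmL; have tD := thetaD hh hQ.
elim/(Pol_ind (Q := Q)) => [|c m y py IH].
  by rewrite linear_on_Pol0// (antilin0 tD) linear_on_Pol0.
have pm := coeff_in_Pol Q m.
rewrite ml// !tD//; [|exact: mR_Pol|exact: mR_Pol].
rewrite ml' ?IH; [|exact: theta_Pol|exact: theta_Pol].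
congr (_ *: _ + _); case: m pm => pi [i j] _.
have s0 k : Num.sqrt (eigQ Q (pi := pi) k) != 0.
  by rewrite gt_eqF// sqrtr_gt0 (eigQ_gt0 hQ).
have te k l : theta (eirr Q pi k l) =
    (Num.sqrt (eigQ Q l) / Num.sqrt (eigQ Q k))%:C *: eirr Q pi l k.
  rewrite [LHS](theta_coeff hh hQ (coeff_at k l)); congr (_%:C *: _).
  rewrite /coeff_wt/= sqrtrM ?ltW ?(eigQ_gt0 hQ)// sqrtrV ?ltW ?(eigQ_gt0 hQ)//.
  by rewrite invf_div.
rewrite -[coeff _ _]/(eirr Q pi i j) mR_eirr te.
rewrite (antilin_sum _ _ tD) => [|k]; last exact: (coeff_in_Pol Q (coeff_at i k)).
rewrite -[X in mL X]addr0 ml'; [|exact: (coeff_in_Pol Q (coeff_at j i))|exact: Pol0].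
rewrite linear_on_Pol0// addr0 mL_eirr scaler_sumr; apply: eq_bigr => k _.
rewrite te !scalerA; congr (_ *: _).
rewrite !rmorphM/= !fmorphV/=; field.
by rewrite !(inj_eq (@complexI R)) !s0.
Qed.

End Main.

Theorem lemma2p5 (R : realType) (G : compact_quantum_group R)
    (h : {scalar G}) (hh : haar_state h) (L2 : gns_triple h)
    (I : irr_family G) (Q : forall pi : I, 'M[R[i]]_(irr_dim pi))
    (hQ : modular_matrices h Q) (p : \bar R) (hp : (1 <= p)%E) (E : set I)
    (a : forall pi : I, 'M[R[i]]_(irr_dim pi)) (mR mL : G -> G)
    (hmR : right_mult a mR)
    (hmL : left_mult (fun pi : I =>
             invmx (sqrtmx (Q pi)) *m ((a pi) ^t*)%sesqui *m sqrtmx (Q pi)) mL) :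
  Lp_opnorm I L2 p (coeff_span E) mR = Lp_opnorm I L2 p (coeff_span E) mL.
Proof.
have mM := theta_mult hh hQ hmR hmL.
have PE := coeff_span_Pol hh hQ (E := E).
have mP := mR_Pol Q hmR.
(* The two sets of norms coincide, not only their suprema: [theta] maps the unit ball of X to
   itself, and x for one multiplier corresponds to theta x for the other. *)
congr ereal_sup; apply/seteqP; split=> _ [x [xE x1] <-]; exists (theta hh hQ x).
- split; first exact: theta_coeff_span.
  by rewrite Lp_norm_theta//; exact: PE.
- by rewrite -mM ?Lp_norm_theta//; [exact/mP/PE|exact: PE].
- split; first exact: theta_coeff_span.
  by rewrite Lp_norm_theta//; exact: PE.
- have px := PE _ xE; have ptx := theta_Pol hh hQ x.
  by rewrite -(Lp_norm_theta hh L2 hQ) ?mM ?thetaK//; exact: mP.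
Qed.
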